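(* Let $\Gamma=\Gamma_f$ be an entire intrinsic Lipschitz graph and let $W\subset\mathbb{H}$ be an open set. Suppose there is a locally bounded Borel function $\tau\colon W\to\mathbb{R}$ such that $\tau(p)=\nabla_ff(\Pi(p))$ for almost every $p\in W\cap\Gamma$. Suppose further that the horizontal vector field $$M(p)=-\tau(p)X_p+\Bigl(1-\frac{\tau(p)^2}2\Bigr)Y_p$$ is conservative on $W$. Then $\Gamma$ is energy-minimizing on $W$.
   Context: Heisenberg group: $\mathbb{H}=\mathbb{R}^3$ with $(x,y,z)\cdot(x',y',z')=(x+x',y+y',z+z'+\frac{xy'-yx'}{2})$; left-invariant fields $X=(1,0,-\frac y2)$, $Y=(0,1,\frac x2)$, orthonormal for the inner product on the horizontal distribution $\mathsf{A}=\mathrm{span}(X,Y)$; $Y^t=(0,t,0)$; $d$ is the Carnot–Carathéodory metric, with balls $B(p,r)$. $V_0=\{y=0\}$ with Lebesgue measure $\mu$; $\Pi(x,y,z)=(x,0,z-\frac{xy}2)$. For $f\colon V_0\to\mathbb{R}$, $\Gamma_f=\{v\cdot Y^{f(v)}:v\in V_0\}$; it is an entire intrinsic Lipschitz graph if for some $\lambda\in(0,1)$, $|y(q)-y(p)|\le\lambda d(p,q)$ for all $p,q\in\Gamma_f$. Then $\nabla_ff\in L_\infty$ is defined by $\int_{V_0}\nabla_ff\,\psi\,d\mu=\int_{V_0}-f\partial_x\psi+\frac{f^2}2\partial_z\psi\,d\mu$ for $\psi\in C_c^1(V_0)$. ''Almost every $p\in W\cap\Gamma$'' is with respect to 3-dimensional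 spherical Hausdorff measure of $d$ (equivalently, $\mu$-a.e. $\Pi(p)$). Perimeter and flux: a measurable $E\subset\mathbb{H}$ has finite perimeter if $\mathbf{1}_E$ has finite total horizontal variation, i.e. $\sup\{\int_E(Xv_1+Yv_2):v_1X+v_2Y\in C_c^1(\mathbb{H};\mathsf{A}),|v_1X+v_2Y|\le1\}<\infty$ (Lebesgue measure); then the distributional horizontal gradient is $\nabla\mathbf{1}_E=\nu_E|\partial E|$ with $|\partial E|$ a Radon measure (perimeter measure) and $\nu_E$ the horizontal inward unit normal. For a Borel horizontal vector field $V$ and open $U$, the flux is $\mathcal{F}_U(E,V)=\int_U\langle\nu_E,V\rangle\,d|\partial E|$. $V$ is conservative on $U$ if $\mathcal{F}_U(E,V)=0$ for every finite-perimeter set $E$ compactly contained in $U$. Energy: for bounded measurable $U\subset V_0$, $E_U(f)=\frac12\int_U(\nabla_ff)^2d\mu$; for bounded open $W'\subset\mathbb{H}$ and $\Gamma=\Gamma_f$, $E_{W'}(\Gamma)=E_{\Pi(W'\cap\Gamma)}(f)$. Epigraph: $\Gamma^+=\{pY^t:p\in\Gamma,t\ge0\}$. An entire intrinsic Lipschitz graph $\Gamma$ is energy-minimizing on open $W$ if $E_{W\cap B(p,r)}(\Gamma)\le E_{W\cap B(p,r)}(\Lambda)$ for every $p\in\mathbb{H}$, $r>0$ and entire intrinsic Lipschitz graph $\Lambda$ with $\Gamma^+\triangle\Lambda^+$ compactly contained in $W\cap B(p,r)$. *)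

(* Defs.v *)
From HB Require Import structures.
From mathcomp Require Import all_boot all_order all_algebra.
From mathcomp Require Import all_classical all_reals all_analysis.
Set Implicit Arguments.
Unset Strict Implicit.
Unset Printing Implicit Defensive.
Import Order.TTheory GRing.Theory Num.Theory.
Import numFieldNormedType.Exports.
Local Open Scope classical_set_scope.
Local Open Scope ring_scope.

(* H is R^3 with its Euclidean topology, which is also the topology of the
   Carnot-Caratheodory metric.  V_0 = {y = 0} is parametrised by (x, z) in
   R^2; [emb] is the inclusion V_0 -> H.  A horizontal vector field
   v_1 X + v_2 Y is encoded by its coefficients (v_1, v_2) in R^2, so the
   inner product making X, Y orthonormal is the Euclidean one. *)
Notation heis R := (R * R * R)%type.
Notation plane R := (R * R)%type.

Section Heisenberg.
Context {R : realType}.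
Implicit Types (p q : heis R) (v : plane R) (t r : R).

Definition hx p : R := p.1.1.
Definition hy p : R := p.1.2.
Definition hz p : R := p.2.

Definition hmul p q : heis R :=
  (hx p + hx q, hy p + hy q, hz p + hz q + (hx p * hy q - hy p * hx q) / 2).

Definition Xfield p : heis R := (1, 0, - (hy p / 2)).
Definition Yfield p : heis R := (0, 1, hx p / 2).

Definition Ypow t : heis R := (0, t, 0).

Definition emb v : heis R := (v.1, 0, v.2).
Definition vproj p : plane R := (hx p, hz p - hx p * hy p / 2).

Definition leb2 :
    {measure set (measurableTypeR R * measurableTypeR R) -> \bar R} :=
  (lebesgue_measure \x lebesgue_measure)%E.
Definition leb3 :
    {measure set (measurableTypeR R * measurableTypeR R * measurableTypeR R)
       -> \bar R} :=
  (lebesgue_measure \x lebesgue_measure \x lebesgue_measure)%E.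

Definition lebesgue_measurable (E : set (heis R)) :=
  exists2 B : set (heis R), measurable B & leb3.-negligible (E `+` B).

(* gamma is absolutely continuous on [0, 1] and
   gamma' = a X_gamma + b Y_gamma almost everywhere. *)
Definition horizontal_curve (gamma : R -> heis R) (a b : R -> R) :=
  [/\ lebesgue_measure.-integrable `[0, 1] (EFin \o a),
      lebesgue_measure.-integrable `[0, 1] (EFin \o b) &
      forall t, 0 <= t <= 1 ->
        let dgamma s := a s *: Xfield (gamma s) + b s *: Yfield (gamma s) in
        gamma t = gamma 0 +
          (\int[lebesgue_measure]_(s in `[0, t]) hx (dgamma s),
           \int[lebesgue_measure]_(s in `[0, t]) hy (dgamma s),
           \int[lebesgue_measure]_(s in `[0, t]) hz (dgamma s))].

Definition curve_length (a b : R -> R) : \bar R :=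
  (\int[lebesgue_measure]_(s in `[0%R, 1%R])
     (Num.sqrt (a s ^+ 2 + b s ^+ 2))%:E)%E.

Definition ccdist p q : \bar R :=
  ereal_inf [set l | exists gamma a b,
    [/\ horizontal_curve gamma a b, gamma 0 = p, gamma 1 = q &
        l = curve_length a b]].

Definition ccball p r : set (heis R) := [set q | (ccdist p q < r%:E)%E].

(* Radii may be 0 (empty balls), so finite coverings are included. *)
Definition spherical_hausdorff_pre (m : nat) (delta : R) (A : set (heis R)) :
    \bar R :=
  ereal_inf [set s | exists (c : nat -> heis R) (r : nat -> R),
    [/\ forall i, 0 <= r i <= delta,
        A `<=` \bigcup_i ccball (c i) (r i) &
        s = (\sum_(0 <= i <oo) ((2 * r i) ^+ m)%:E)%E]].

Definition spherical_hausdorff (m : nat) (A : set (heis R)) : \bar R :=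
  ereal_sup [set spherical_hausdorff_pre m delta A | delta in [set e | 0 < e]].

Definition Cc1 (V : normedModType R) (psi : V -> R) :=
  [/\ forall x, differentiable psi x,
      forall w, continuous ('D_w psi) &
      compact (closure [set x | psi x != 0])].

Definition graph (f : plane R -> R) : set (heis R) :=
  range (fun v => hmul (emb v) (Ypow (f v))).

Definition epigraph (f : plane R -> R) : set (heis R) :=
  [set p | exists q t, [/\ graph f q, 0 <= t & p = hmul q (Ypow t)]].

Definition intrinsic_lipschitz (f : plane R -> R) :=
  exists2 lambda : R, 0 < lambda < 1 &
    forall p q, graph f p -> graph f q ->
      (`|hy q - hy p|%:E <= lambda%:E * ccdist p q)%E.

(* g is a representative of the class nabla_f f in L_infty(V_0). *)
Definition intrinsic_gradient (f g : plane R -> R) :=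
  g \in Lfun leb2 +oo%E /\
  forall psi : plane R -> R, Cc1 psi ->
    (\int[leb2]_v (g v * psi v)%:E =
     \int[leb2]_v (- f v * 'D_(1, 0) psi v
                   + f v ^+ 2 / 2 * 'D_(0, 1) psi v)%:E)%E.

(* E_U(f).  All representatives of nabla_f f give the same integral, so the
   infimum is over a single value whenever nabla_f f exists (in particular for
   every intrinsic Lipschitz f). *)
Definition energy (U : set (plane R)) (f : plane R -> R) : \bar R :=
  ereal_inf [set (2^-1%:E * \int[leb2]_(v in U) (g v ^+ 2)%:E)%E
            | g in intrinsic_gradient f].

(* E_{W'}(Gamma_f) *)
Definition graph_energy (W' : set (heis R)) (f : plane R -> R) : \bar R :=
  energy (vproj @` (W' `&` graph f)) f.

Definition compactly_contained (A U : set (heis R)) :=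
  compact (closure A) /\ closure A `<=` U.

Definition energy_minimizing (f : plane R -> R) (W : set (heis R)) :=
  forall p r (h : plane R -> R), 0 < r -> intrinsic_lipschitz h ->
    compactly_contained (epigraph f `+` epigraph h) (W `&` ccball p r) ->
    (graph_energy (W `&` ccball p r) f <= graph_energy (W `&` ccball p r) h)%E.

Definition hdot v (w : plane R) : R := v.1 * w.1 + v.2 * w.2.

Definition hdiv (v1 v2 : heis R -> R) p : R :=
  'D_(Xfield p) v1 p + 'D_(Yfield p) v2 p.

Definition finite_perimeter (E : set (heis R)) :=
  lebesgue_measurable E /\
  (ereal_sup [set s | exists v1 v2 : heis R -> R,
     [/\ Cc1 v1, Cc1 v2,
         forall p, (Num.sqrt (v1 p ^+ 2 + v2 p ^+ 2) <= 1)%R &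
         s = \int[leb3]_(p in E) (hdiv v1 v2 p)%:E]] < +oo)%E.

(* P = |dE| and nu = nu_E: the distributional horizontal gradient of 1_E is
   nu P, with P Radon and |nu| = 1 P-almost everywhere.  The pair is unique up
   to P-null changes of nu. *)
Definition perimeter_of (E : set (heis R))
    (P : {measure set (heis R) -> \bar R}) (nu : heis R -> plane R) :=
  [/\ forall K : set (heis R), compact K -> (P K < +oo)%E,
      measurable_fun [set: heis R] nu,
      {ae P, forall p, Num.sqrt (hdot (nu p) (nu p)) = 1} &
      forall v1 v2 : heis R -> R, Cc1 v1 -> Cc1 v2 ->
        (\int[leb3]_(p in E) (hdiv v1 v2 p)%:E =
         - \int[P]_p (hdot (nu p) (v1 p, v2 p))%:E)%E].

(* F_U(E, V) where P = |dE| and nu = nu_E *)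
Definition flux (U : set (heis R)) (P : {measure set (heis R) -> \bar R})
    (nu V : heis R -> plane R) : \bar R :=
  (\int[P]_(p in U) (hdot (nu p) (V p))%:E)%E.

Definition conservative (U : set (heis R)) (V : heis R -> plane R) :=
  forall E, finite_perimeter E -> compactly_contained E U ->
    forall P nu, perimeter_of E P nu -> flux U P nu V = 0%E.

End Heisenberg.

(* Main.v *)
Require Import Defs.
From HB Require Import structures.
From mathcomp Require Import all_boot all_order all_algebra.
From mathcomp Require Import all_classical all_reals all_analysis.
From mathcomp Require Import measurable_realfun.
From mathcomp Require Import ring lra.
Set Implicit Arguments.
Unset Strict Implicit.
Unset Printing Implicit Defensive.
Import Order.TTheory GRing.Theory Num.Theory.
Import numFieldNormedType.Exports.
Local Open Scope classical_set_scope.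
Local Open Scope ring_scope.

(** Write points of H as v . Y^t with v = (x, zeta) in V_0; in the coordinates
    (v, t) one has X = d_x - t d_zeta, Y = d_t and Gamma_f = {t = f v}.

    Let Lambda = Gamma_h be a competitor with gradient gh.  For D = {f < h} the
    set E = {f < t < h} has finite perimeter; its inner conormal is
    (- gf, 1) / sqrt (1 + gf^2) on Gamma_f and (gh, -1) / sqrt (1 + gh^2) on
    Gamma_h.  Since M is conservative,
    int_D (gf tau_f + 1 - tau_f^2 / 2) = int_D (gh tau_h + 1 - tau_h^2 / 2),
    where tau_f, tau_h are the values of tau on the two graphs.  As tau_f = gf
    a.e. and gh tau_h - tau_h^2 / 2 <= gh^2 / 2, this yields
    int_D gf^2 <= int_D gh^2.  The same holds on {h < f}, and on {f = h} the two
    gradients agree a.e.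

    The perimeter of E rests on the identity, for test functions phi,
      int_D (phi(v, h) gh - phi(v, f) gf + int_f^h (phi_x - t phi_zeta) dt) dv = 0,
    proved by mollifying f and h at scale e = s^2: as f, h are locally
    1/2-Hoelder, f_e - f = O(s), the partial derivatives of f_e are O(1/s), and
    d_x f_e - f_e d_zeta f_e stays bounded and converges weakly to gf.  A cut-off
    in (h_e - f_e) / s localizes to D, and the divergence theorem is applied to
    the interpolations f_e + theta (h_e - f_e), 0 <= theta <= 1.

    The Carnot-Caratheodory metric only enters through two estimates: explicit
    polynomial horizontal curves show that intrinsic Lipschitz functions are
    locally 1/2-Hoelder, and the projection of a ball of radius r to V_0 lies in
    a set of measure (2r)^3, so that the projection of an H^3-null set is null. *)

(** * Borel sets and Lebesgue measure *)

(** The field [M] comes from convex duality: g^2 / 2 is the supremum over tau of g tau - tau^2 / 2,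
    attained only at tau = g, so [M] calibrates the energy.

    The analytic obstacle is that f -> d_x f - f d_zeta f is quadratic and f only 1/2-Hoelder, so
    mollification does not commute with it. The defect is (f - f_e)^2 / 2 convolved with a
    derivative of the kernel: s^2 times 1 / s^2, bounded with nothing to spare. Weak convergence is
    therefore all there is; it suffices because the gradients enter linearly, against weights that
    converge boundedly.

    The cut-off has a derivative of order 1 / s, multiplied by derivatives again of order 1 / s. But
    it varies only where h_e - f_e = O(s), and the derivatives occur in a combination equal to a
    difference of two bounded gradients plus h_e - f_e times O(1 / s). The product stays bounded,
    and at each fixed point it is eventually zero.

    The domains of the energies are not shown to be measurable, so the gradient of f is chosen to
    coincide with that of h wherever f = h, and integrals are compared only on the open set where f
    and h differ. *)

Section product_borel.
Context {R : realType}.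

(** Countability comes from the factor [R] alone: an open set is a countable union of rectangles
    whose second side is a ball with rational centre and radius 1 / (n + 1), the first side being
    the interior of the set of points whose whole fibre over that ball lies in [A]. The maps [i] and
    [j] identify the Borel carrier with the topological one. *)
Lemma open_measurable_prod d (T : measurableType d) (U : topologicalType)
    (i : U -> T) (j : T -> U) (ij : cancel i j) (ji : cancel j i) :
  (forall A : set U, open A -> measurable (j @^-1` A)) ->
  forall A : set (U * R), open A ->
    measurable ((fun x : T * R => (j x.1, x.2)) @^-1` A).
Proof.
move=> oU A oA.
pose S (q : rat) (n : nat) : set (T * R) :=
  (j @^-1` [set x | forall y, ball (ratr q : R) n.+1%:R^-1 y -> A (x, y)]°) `*`
  ball (ratr q : R) n.+1%:R^-1.
suff -> : (fun x : T * R => (j x.1, x.2)) @^-1` A = \bigcup_q \bigcup_n S q n.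
  apply: bigcupT_measurable_rat => q; apply: bigcupT_measurable => n.
  by apply: measurableX; [apply: oU; exact: open_interior|exact: measurable_ball].
apply/seteqP; split=> [[x y] /= Axy|[x y] [q _ [n _ [/= /interior_subset Sx qy]]]].
  have [[U1 V1] /= [U1x V1y] UVA] : nbhs (j x, y) A by exact: open_nbhs_nbhs.
  have [e /= e0 eV] : exists2 e : R, 0 < e & ball y e `<=` V1 by apply/nbhs_ballP.
  (* Any two points of a ball of radius below e / 2 are less than e apart. *)
  have [n ne] : exists n : nat, n.+1%:R^-1 < e / 2.
    have [n] : exists n : nat, (e / 2)^-1 < n%:R.
      by exists (Num.bound (e / 2)^-1); apply: archi_boundP; rewrite invr_ge0 divr_ge0// ltW.
    move=> ne; exists n; rewrite invf_plt ?posrE ?divr_gt0//.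
    by apply: (lt_trans ne); rewrite ltr_nat.
  have [q] : exists q : rat, ratr q \in `](y - n.+1%:R^-1), (y + n.+1%:R^-1)[.
    by apply: rat_in_itvoo; rewrite ltrBlDr -addrA ltrDl addr_gt0// invr_gt0.
  rewrite in_itv/= => /andP[q1 q2].
  have yq : ball (ratr q : R) n.+1%:R^-1 y.
    by move: q1 q2; rewrite /ball/= ltr_distl; set a := _^-1; set b := ratr q => q1 q2; apply/andP; split; lra.
  exists q => //; exists n => //; split => //=.
  apply: (filterS _ U1x) => u uU y' qy'; apply: (UVA (u, y')); split => //=.
  apply: eV; rewrite /ball/=; move: ne yq qy'; rewrite /ball/= !ltr_distl.
  set a := n.+1%:R^-1; set b := ratr q => ne; clearbody a b.
  by move=> /andP[? ?] /andP[? ?]; apply/andP; split; lra.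
exact: Sx.
Qed.

Lemma plane_open_measurable (A : set (plane R)) : open A -> measurable A.
Proof.
move=> oA; have := @open_measurable_prod _ R R id id (fun=> erefl) (fun=> erefl) _ A oA.
have -> : (fun x : R * R => (id x.1, x.2)) @^-1` A = A.
  by apply/seteqP; split => -[].
by apply => B; exact: open_measurable.
Qed.

Lemma heis_open_measurable (A : set (heis R)) : open A -> measurable A.
Proof.
move=> oA; have := @open_measurable_prod _ (plane R) (plane R) id id (fun=> erefl) (fun=> erefl) _ A oA.
have -> : (fun x : plane R * R => (id x.1, x.2)) @^-1` A = A.
  by apply/seteqP; split => -[].
by apply => B; exact: plane_open_measurable.
Qed.

Lemma measurable_fun_open d (T : measurableType d) (f : T -> R) :
  (forall B : set R, open B -> measurable (f @^-1` B)) -> measurable_fun setT f.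
Proof.
move=> fo mT; apply: (measurability _ (RGenOInfty.measurableE R)) => //.
by move=> _ [_ [a ->] <-]; rewrite setTI; apply: fo; exact: interval_open.
Qed.

Lemma plane_continuous_measurable (f : plane R -> R) :
  continuous f -> measurable_fun setT f.
Proof.
move=> cf; apply: measurable_fun_open => B oB.
by apply: plane_open_measurable; exact: open_comp.
Qed.

Lemma heis_continuous_measurable (f : heis R -> R) :
  continuous f -> measurable_fun setT f.
Proof.
move=> cf; apply: measurable_fun_open => B oB.
by apply: heis_open_measurable; exact: open_comp.
Qed.

End product_borel.

Section lebesgue.
Context {R : realType}.
Notation mR := (measurableTypeR R).
Local Open Scope ereal_scope.
Notation L1 := (@lebesgue_measure R).

Definition box (M : R) : set (plane R) := `[(- M)%R, M] `*` `[(- M)%R, M].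

Lemma box_leb2 (M : R) : (0 <= M)%R -> leb2 (box M) = ((2 * M) ^+ 2)%:E.
Proof.
move=> M0; transitivity (L1 `[(- M)%R, M] * L1 `[(- M)%R, M]).
  exact: product_measure1E.
rewrite !lebesgue_measure_itv/= !lte_fin !opprK -!EFinD.
case: ifP => [_|/negbT]; first by rewrite -EFinM; congr EFin; ring.
rewrite -leNgt => M1; have -> : M = 0%R by lra.
by rewrite mulr0 expr0n mule0.
Qed.

Lemma box_cover (v : plane R) : (\bigcup_n box n%:R) v.
Proof.
exists (Num.bound (Num.max `|v.1|%R `|v.2|%R)) => //.
have := archi_boundP (_ : 0 <= Num.max `|v.1|%R `|v.2|%R)%R.
rewrite le_max normr_ge0 => /(_ isT); rewrite gt_max => /andP[/ltW + /ltW].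
by rewrite !ler_norml /box/= !in_itv/=.
Qed.

Lemma leb2_sigma_finite : sigma_finite [set: mR * mR] (@leb2 R).
Proof.
exists (fun n => box n%:R).
  apply/seteqP; split => //; rewrite /setT/= => -[x y] _; exact: box_cover.
move=> n; split; first exact: measurableX.
by rewrite box_leb2// ltry.
Qed.

(** Fubini for [leb3], the product of [leb2] with a line, asks for a bundled sigma-finite first
    factor. *)
Definition sleb2 : {sigma_finite_measure set (mR * mR)%type -> \bar R} :=
  HB.pack_for {sigma_finite_measure set (mR * mR)%type -> \bar R} (@leb2 R : set (mR * mR)%type -> \bar R)
   (Measure.class (@leb2 R))
   (Measure_isSigmaFinite.Build _ _ _ (@leb2 R) leb2_sigma_finite).
Lemma leb2E (g : mR * mR -> \bar R) : measurable_fun setT g -> (forall z, 0 <= g z) ->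
    \int[leb2]_p g p = \int[lebesgue_measure]_v \int[lebesgue_measure]_z g (v, z).
Proof.
move=> mg g0.
have := fubini_tonelli1 (m1 := L1) (m2 := L1) g mg g0.
exact.
Qed.
Lemma leb3E (g : mR * mR * mR -> \bar R) : measurable_fun setT g -> (forall z, 0 <= g z) ->
    \int[leb3]_p g p = \int[leb2]_v \int[lebesgue_measure]_z g (v, z).
Proof.
move=> mg g0.
have := fubini_tonelli1 (m1 := sleb2) (m2 := L1) g mg g0.
exact.
Qed.

Lemma lebesgue_translation (c : R) (A : set mR) : measurable A ->
  lebesgue_measure ((fun z : mR => (z + c)%R : mR) @^-1` A) = lebesgue_measure A.
Proof.
have mc : measurable_fun [set: mR] (fun z : mR => (z + c)%R : mR).
  by apply: measurable_funD => //; exact: measurable_cst.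
move=> mA; symmetry.
pose mf : {mfun mR >-> mR} := HB.pack (fun z : mR => (z + c)%R : mR)
  (isMeasurableFun.Build _ _ _ _ _ mc).
apply: (lebesgue_measure_unique (mu := pushforward lebesgue_measure mf)) => //.
move=> X [[a b] /= _ <-]; rewrite /pushforward.
have -> : mf @^-1` `]a, b]%classic = `](a - c)%R, (b - c)%R]%classic.
  by apply/seteqP; split => z /=; rewrite !in_itv/= ltrBlDr lerBrDr.
rewrite !lebesgue_measure_itv/= !lte_fin ltrD2r.
by case: ifP => // _; rewrite -!EFinB; congr (_%:E); lra.
Qed.

Lemma ge0_integral_translation (c : R) (f : mR -> \bar R) : measurable_fun setT f ->
  (forall z, 0 <= f z) ->
  \int[lebesgue_measure]_z f (z + c)%R = \int[lebesgue_measure]_z f z.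
Proof.
move=> mf f0.
have mc : measurable_fun [set: mR] (fun z : mR => (z + c)%R : mR).
  by apply: measurable_funD => //; exact: measurable_cst.
pose mF : {mfun mR >-> mR} := HB.pack (fun z : mR => (z + c)%R : mR)
  (isMeasurableFun.Build _ _ _ _ _ mc).
transitivity (\int[pushforward lebesgue_measure mF]_z f z).
  by rewrite (ge0_integral_pushforward mc).
by apply: eq_measure_integral => A mA _; exact: lebesgue_translation.
Qed.

(* (x, zeta, t) |-> (x, 0, zeta) . Y^t, which preserves volume *)
Definition heis_chart (p : mR * mR * mR) : mR * mR * mR :=
  (p.1.1, p.2, p.1.2 + p.1.1 * p.2 / 2)%R.

Lemma measurable_heis_chart : measurable_fun setT heis_chart.
Proof.
have m11 : measurable_fun [set: mR * mR * mR] (fun p => p.1.1 : R) by exact: measurableT_comp.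
have m12 : measurable_fun [set: mR * mR * mR] (fun p => p.1.2 : R) by exact: measurableT_comp.
apply: measurable_fun_pair.
  by apply: measurable_fun_pair => //; exact: measurable_snd.
apply: measurable_funD => //; apply: measurable_funM; last exact: measurable_cst.
by apply: measurable_funM => //; exact: measurable_snd.
Qed.

(** With x held fixed, the chart amounts to an exchange of the two inner integrals and, for each y,
    a translation of z by x y / 2. *)
Lemma ge0_integral_heis_chart (f : mR * mR * mR -> \bar R) : measurable_fun setT f ->
  (forall z, 0 <= f z) ->
  \int[leb3]_p f (heis_chart p) = \int[leb3]_p f p.
Proof.
move=> mf f0.
have mfc : measurable_fun setT (f \o heis_chart).
  by apply: measurableT_comp => //; exact: measurable_heis_chart.
have mFf : measurable_fun setT (fubini_F L1 f).
  exact: (measurable_fun_fubini_tonelli_F f mf f0).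
have mFfc : measurable_fun setT (fubini_F L1 (f \o heis_chart)).
  by apply: (measurable_fun_fubini_tonelli_F _ mfc) => p; exact: f0.
rewrite (leb3E mf f0) (leb3E mfc (fun p => f0 (heis_chart p))).
rewrite (leb2E mFfc); last by move=> v; apply: integral_ge0 => *; exact: f0.
rewrite (leb2E mFf); last by move=> v; apply: integral_ge0 => *; exact: f0.
apply: eq_integral => x _.
pose g (w : mR * mR) := f (x, w.2, w.1 + x * w.2 / 2)%R.
have mg : measurable_fun setT g.
  apply: (measurableT_comp mf); apply: measurable_fun_pair.
    by apply: measurable_fun_pair; [exact: measurable_cst|exact: measurable_snd].
  apply: measurable_funD; first exact: measurable_fst.
  apply: measurable_funM; last exact: measurable_cst.
  by apply: measurable_funM; [exact: measurable_cst|exact: measurable_snd].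
have g0 w : 0 <= g w by exact: f0.
transitivity (\int[lebesgue_measure]_y \int[lebesgue_measure]_z g (z, y)).
  exact: (fubini_tonelli g mg g0).
apply: eq_integral => y _.
pose k z := f (x, y, z).
have mk : measurable_fun setT k.
  by apply: (measurableT_comp mf); apply: measurable_fun_pair => //; exact: measurable_cst.
exact: (ge0_integral_translation (x * y / 2) mk (fun z => f0 (x, y, z))).
Qed.

Lemma integral_heis_chart (f : mR * mR * mR -> \bar R) : measurable_fun setT f ->
  \int[leb3]_p f (heis_chart p) = \int[leb3]_p f p.
Proof.
move=> mf; rewrite integralE [RHS]integralE; congr (_ - _).
  pose g := f^\+; have mg : measurable_fun setT g by exact: measurable_funepos.
  have g0 p : 0 <= g p by exact: funepos_ge0.
  by rewrite -(ge0_integral_heis_chart mg g0); apply: eq_integral => x _; rewrite /g !funeposE.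
pose g := f^\-; have mg : measurable_fun setT g by exact: measurable_funeneg.
have g0 p : 0 <= g p by exact: funeneg_ge0.
by rewrite -(ge0_integral_heis_chart mg g0); apply: eq_integral => x _; rewrite /g !funenegE.
Qed.

End lebesgue.

(** * Bounded measurable functions on sets of finite measure *)

Section bounded_measurable.
Context d (T : measurableType d) (R : realType).
Implicit Types (D : set T) (F G : T -> R).

(** This class is stable under products, unlike integrability, and integrable on sets of finite
    measure; integrability side conditions are discharged through it. *)
Definition bdm D F := measurable_fun D F /\ exists M, forall x, D x -> `|F x| <= M.

Lemma bdm_cst D (k : R) : bdm D (fun=> k).
Proof. by split; [exact: measurable_cst|exists `|k|]. Qed.

Lemma bdmD D F G : bdm D F -> bdm D G -> bdm D (fun x => F x + G x).
Proof.
move=> [mF [M FM]] [mG [M' GM]]; split; first exact: measurable_funD.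
by exists (M + M') => x Dx; rewrite (le_trans (ler_normD _ _))// lerD ?FM ?GM.
Qed.

Lemma bdmM D F G : bdm D F -> bdm D G -> bdm D (fun x => F x * G x).
Proof.
move=> [mF [M FM]] [mG [M' GM]]; split; first exact: measurable_funM.
by exists (M * M') => x Dx; rewrite normrM ler_pM ?FM ?GM.
Qed.

Lemma bdmN D F : bdm D F -> bdm D (fun x => - F x).
Proof.
move=> [mF [M FM]]; split; first exact: measurable_funN.
by exists M => x Dx; rewrite normrN FM.
Qed.

Lemma bdmB D F G : bdm D F -> bdm D G -> bdm D (fun x => F x - G x).
Proof. by move=> bF bG; apply: bdmD => //; exact: bdmN. Qed.

Lemma bdmX D F n : bdm D F -> bdm D (fun x => F x ^+ n).
Proof.
move=> [mF [M FM]]; split; first exact: measurable_funX.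
by exists (M ^+ n) => x Dx; rewrite normrX lerXn2r ?nnegrE ?FM// (le_trans _ (FM _ Dx)).
Qed.

Lemma bdm_sub D D' F : measurable D -> D' `<=` D -> bdm D F -> bdm D' F.
Proof.
move=> mD sD [mF [M FM]]; split; first exact: measurable_funS mF.
by exists M => x /sD; exact: FM.
Qed.

Context (mu : {measure set T -> \bar R}) (D : set T).
Hypotheses (mD : measurable D) (muD : (mu D < +oo)%E).

Lemma bdm_integrable F : bdm D F -> mu.-integrable D (EFin \o F).
Proof.
move=> [mF [M FM]]; apply: measurable_bounded_integrable => //.
exists M; split; first exact: num_real.
by move=> x Mx y Dy; apply: le_trans (ltW Mx); exact: FM.
Qed.

Lemma RintegralE_bdm F : bdm D F ->
  (\int[mu]_(x in D) (F x)%:E)%E = (\int[mu]_(x in D) F x)%:E.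
Proof.
move=> bF; rewrite /Rintegral fineK//; apply: integrable_fin_num => //.
exact: bdm_integrable.
Qed.

Lemma bdm_le_Rintegral F (K : R) : 0 <= K -> bdm D F ->
  (forall x, D x -> `|F x| <= K) ->
  `|\int[mu]_(x in D) F x| <= K * fine (mu D).
Proof.
move=> K0 bF FK; apply: le_trans (le_normr_Rintegral _ (bdm_integrable bF)) _ => //.
rewrite -Rintegral_cst//; apply: le_Rintegral => //.
  apply: bdm_integrable; split; first by apply: measurableT_comp => //; case: bF.
  by exists K => x Dx; rewrite normr_id FK.
by apply: bdm_integrable; exact: bdm_cst.
Qed.

Lemma bounded_convergence (F_ : nat -> T -> R) F (K : R) :
  (forall n, measurable_fun D (F_ n)) -> measurable_fun D F ->
  (forall n x, D x -> `|F_ n x| <= K) ->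
  (forall x, D x -> F_ ^~ x @ \oo --> F x) ->
  (fun n => \int[mu]_(x in D) F_ n x) @ \oo --> \int[mu]_(x in D) F x.
Proof.
move=> mF_ mF FK cF.
have [|||||] := @dominated_convergence _ T R mu D mD (fun n => EFin \o F_ n) (EFin \o F)
  (cst K%:E).
- by move=> n; exact/measurable_EFinP.
- exact/measurable_EFinP.
- apply: aeW => x Dx; apply: cvg_EFin; first exact: nearW.
  exact: cF.
- exact/bdm_integrable/bdm_cst.
- by apply: aeW => x n Dx; rewrite lee_fin; exact: FK.
move=> iF _ cv; apply: fine_cvg; rewrite fineK//; exact: integrable_fin_num iF.
Qed.

End bounded_measurable.

(** * Mollification *)

Section truncated_powers.
Context {R : realType}.
Implicit Types (s t h : R).

(** A quadratic remainder survives integration against a bounded function, so this one criterion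
    serves both the splines and their convolutions. *)
Lemma is_derive_quadratic (F : R -> R) (s d L : R) :
  (forall h, `|h| <= 1 -> `|F (s + h) - F s - h * d| <= L * h ^+ 2) ->
  is_derive s 1 F d.
Proof.
move=> FL; have L0 : 0 <= L.
  by have := FL 1; rewrite normr1 expr1n mulr1 => /(_ (lexx _)); apply: le_trans.
have dF : h^-1 *: ((F \o shift s) (h *: 1) - F s) @[h --> 0^'] --> d.
  apply/cvgrPdist_le => /= e e0; near=> h.
  have h0 : h != 0 by near: h; exact: nbhs_dnbhs_neq.
  have h1 : `|h| <= 1.
    by near: h; apply: dnbhs0_le.
  have hL : L * `|h| <= e.
    have he : `|h| <= e / (L + 1) by near: h; apply: dnbhs0_le; rewrite divr_gt0// ltr_wpDl.
    apply: (@le_trans _ _ ((L + 1) * `|h|)); first by rewrite ler_wpM2r// lerDl.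
    by rewrite mulrC -ler_pdivlMr// ltr_wpDl.
  rewrite /shift/= [h *: 1]mulr1 (addrC h).
  have -> : d - h^-1 *: (F (s + h) - F s) = - (h^-1 * (F (s + h) - F s - h * d)).
    by rewrite [_ *: _]/(_ * _) mulrBr mulKf// opprB.
  rewrite normrN normrM normfV mulrC ler_pdivrMr ?normr_gt0//.
  rewrite (le_trans (FL _ h1))// -[h ^+ 2]real_normK ?num_real// expr2 mulrA ler_wpM2r//.
split; first by apply/cvg_ex; exists d.
exact/cvg_lim.
Unshelve. all: end_near. Qed.

(** The truncated power s_+^n; third differences of such powers with unit step give B-splines. *)
Definition tp n s : R := Num.max s 0 ^+ n.

Lemma tp2_quad s h : `|tp 2 (s + h) - tp 2 s - h * (2 * tp 1 s)| <= h ^+ 2.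
Proof.
rewrite /tp expr1; case: (leP s 0) => s0; case: (leP (s + h) 0) => sh0;
  rewrite ler_norml; apply/andP; split; nra.
Qed.

Lemma tp3_quad s h : `|h| <= 1 ->
  `|tp 3 (s + h) - tp 3 s - h * (3 * tp 2 s)| <= (3 * `|s| + 1) * h ^+ 2.
Proof.
move=> h1; have [h2 h3] : -1 <= h /\ h <= 1 by move: h1; rewrite ler_norml => /andP.
have sa := ler_norm s; have sa0 := normr_ge0 s; set a := `|s| in sa sa0 *; clearbody a.
have hh : 0 <= h ^+ 2 by exact: sqr_ge0.
have ah : 0 <= a * h ^+ 2 by exact: mulr_ge0.
have sah : s * h ^+ 2 <= a * h ^+ 2 by rewrite ler_wpM2r.
have h3h : `|h ^+ 3| <= h ^+ 2.
  by rewrite exprS normrM (ger0_norm hh) ler_piMl.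
move: h3h; rewrite ler_norml => /andP[h31 h32].
rewrite /tp; case: (leP s 0) => s0; case: (leP (s + h) 0) => sh0.
- by rewrite !expr0n/= !mulr0 !subr0 normr0; nra.
- rewrite !expr0n/= !mulr0 !subr0 ger0_norm; last by rewrite exprn_ge0// ltW.
  apply: (@le_trans _ _ (h ^+ 3)); last by nra.
  by rewrite lerXn2r ?nnegrE//; lra.
- have -> : 0 ^+ 3 - s ^+ 3 - h * (3 * s ^+ 2) = s ^+ 2 * (3 * (- h) - s) by ring.
  have s2 : s ^+ 2 <= s * (- h) by rewrite expr2 ler_wpM2l; lra.
  rewrite ger0_norm; last by rewrite mulr_ge0 ?sqr_ge0//; lra.
  apply: (@le_trans _ _ (s * (- h) * (3 * (- h)))).
    by apply: ler_pM; rewrite ?sqr_ge0//; lra.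
  have -> : s * (- h) * (3 * (- h)) = 3 * (s * h ^+ 2) by ring.
  by lra.
- have -> : (s + h) ^+ 3 - s ^+ 3 - h * (3 * s ^+ 2) = 3 * (s * h ^+ 2) + h ^+ 3 by ring.
  have sh : 0 <= s * h ^+ 2 by rewrite mulr_ge0// ltW.
  by rewrite ler_norml; apply/andP; split; lra.
Qed.

(* B-splines: spline3 is a C^2 step from 0 to 1, spline2 its derivative (a bump
   supported in [-3/2, 3/2]), and spline1 the derivative of spline2. *)
Definition spline3 s : R := (tp 3 (s + 3 / 2) - 3 * tp 3 (s + 1 / 2)
  + 3 * tp 3 (s - 1 / 2) - tp 3 (s - 3 / 2)) / 6.
Definition spline2 s : R := (tp 2 (s + 3 / 2) - 3 * tp 2 (s + 1 / 2)
  + 3 * tp 2 (s - 1 / 2) - tp 2 (s - 3 / 2)) / 2.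
Definition spline1 s : R := tp 1 (s + 3 / 2) - 3 * tp 1 (s + 1 / 2)
  + 3 * tp 1 (s - 1 / 2) - tp 1 (s - 3 / 2).

Lemma tp_cases n s : (0 < n)%N -> (s <= 0 /\ tp n s = 0) \/ (0 <= s /\ tp n s = s ^+ n).
Proof.
rewrite /tp; case: (leP s 0) => s0 n0; [left|right]; split => //; last exact: ltW.
by rewrite expr0n gtn_eqF.
Qed.

Ltac tpc n s := let H := fresh "H" in let E := fresh "E" in
  have [[H E]|[H E]] := @tp_cases n s isT; rewrite ?E; clear E.

Lemma spline3_le s : s <= - (3 / 2) -> spline3 s = 0.
Proof.
move=> s32; rewrite /spline3 /tp.
by rewrite !max_r ?expr0n/=; lra.
Qed.

Lemma spline3_ge s : 3 / 2 <= s -> spline3 s = 1.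
Proof.
move=> s32; rewrite /spline3 /tp.
by rewrite !max_l; try lra; field.
Qed.

Lemma spline2_out s : 3 / 2 <= `|s| -> spline2 s = 0.
Proof.
rewrite /spline2 /tp ler_normr => /orP[s32|s32].
  by rewrite !max_l; try lra; field.
by rewrite !max_r ?expr0n/=; lra.
Qed.

Lemma spline1_out s : 3 / 2 <= `|s| -> spline1 s = 0.
Proof.
rewrite /spline1 /tp ler_normr => /orP[s32|s32].
  by rewrite !max_l; try lra; field.
by rewrite !max_r ?expr1/=; lra.
Qed.

Lemma spline2_bound s : 0 <= spline2 s <= 1.
Proof.
have [s1|s1] := leP (3 / 2) `|s|; first by rewrite spline2_out// lexx ler01.
move: s1; rewrite ltr_norml => /andP[s1 s2]; rewrite /spline2.
tpc 2%N (s + 3 / 2); tpc 2%N (s + 1 / 2); tpc 2%N (s - 1 / 2); tpc 2%N (s - 3 / 2);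
  apply/andP; split; nra.
Qed.

Lemma spline1_bound s : `|spline1 s| <= 1.
Proof.
have [s1|s1] := leP (3 / 2) `|s|; first by rewrite spline1_out// normr0.
move: s1; rewrite ltr_norml => /andP[s1 s2]; rewrite /spline1.
tpc 1%N (s + 3 / 2); tpc 1%N (s + 1 / 2); tpc 1%N (s - 1 / 2); tpc 1%N (s - 3 / 2);
  rewrite ler_norml; apply/andP; split; nra.
Qed.

Lemma spline3_bound s : 0 <= spline3 s <= 1.
Proof.
have [s1|s1] := leP s (- (3 / 2)); first by rewrite spline3_le// lexx ler01.
have [s2|s2] := leP (3 / 2) s; first by rewrite spline3_ge// lexx ler01.
have h3 t : 0 <= t -> t <= 1 -> 0 <= t ^+ 3 <= t ^+ 2.
  by move=> t0 t1; rewrite exprn_ge0//= exprS ler_piMl// sqr_ge0.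
rewrite /spline3 /tp (@max_l _ _ (s + 3 / 2)) ?(@max_r _ _ (s - 3 / 2)); try lra.
rewrite expr0n/= subr0.
have [s3|s3] := leP (s + 1 / 2) 0.
  rewrite max_r ?expr0n/=; last lra.
  have := h3 (s + 3 / 2); move=> /(_ _ _)/andP[]; [lra|lra|] => a1 a2.
  by apply/andP; split; nra.
have [s4|s4] := leP (s - 1 / 2) 0.
  rewrite expr0n/= mulr0 addr0; apply/andP; split; nra.
have := h3 (3 / 2 - s); move=> /(_ _ _)/andP[]; [lra|lra|] => a1 a2.
(* The full third difference of the untruncated cube is the constant 6; here its last term is
   missing. *)
have -> : (s + 3 / 2) ^+ 3 - 3 * (s + 1 / 2) ^+ 3 + 3 * (s - 1 / 2) ^+ 3 = 6 - (3 / 2 - s) ^+ 3 by field.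
by apply/andP; split; nra.
Qed.

Lemma spline2_quad s h : `|spline2 (s + h) - spline2 s - h * spline1 s| <= 4 * h ^+ 2.
Proof.
have q t := tp2_quad t h.
have := q (s + 3 / 2); have := q (s + 1 / 2); have := q (s - 1 / 2); have := q (s - 3 / 2).
rewrite /spline2 /spline1 ![s + _ + h]addrAC !ler_norml.
move=> /andP[? ?] /andP[? ?] /andP[? ?] /andP[? ?].
by apply/andP; split; lra.
Qed.

Lemma spline1_lip s h : `|spline1 (s + h) - spline1 s| <= 8 * `|h|.
Proof.
have q t : `|tp 1 (t + h) - tp 1 t| <= `|h|.
  rewrite /tp !expr1; have [h0|h0] := leP 0 h.
    rewrite [`|h|]ger0_norm//; case: (leP t 0) => s0; case: (leP (t + h) 0) => sh0; rewrite ler_norml; apply/andP; split; lra.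
  rewrite [`|h|]ltr0_norm//; case: (leP t 0) => s0; case: (leP (t + h) 0) => sh0; rewrite ler_norml; apply/andP; split; lra.
have := q (s + 3 / 2); have := q (s + 1 / 2); have := q (s - 1 / 2); have := q (s - 3 / 2).
rewrite /spline1 ![s + _ + h]addrAC !ler_norml; set a := `|h|; clearbody a.
move=> /andP[? ?] /andP[? ?] /andP[? ?] /andP[? ?].
by apply/andP; split; lra.
Qed.

Lemma spline2_lip s h : `|spline2 (s + h) - spline2 s| <= 5 * `|h|.
Proof.
have [h1|h1] := leP `|h| 1.
  have -> : spline2 (s + h) - spline2 s =
    (spline2 (s + h) - spline2 s - h * spline1 s) + h * spline1 s by ring.
  rewrite (le_trans (ler_normD _ _))//.
  have -> : 5 * `|h| = 4 * `|h| + `|h| by ring.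
  apply: lerD.
    rewrite (le_trans (spline2_quad _ _))// ler_pM2l// -real_normK ?num_real//.
    by rewrite expr2 ler_piMl.
  by rewrite normrM ler_piMr// spline1_bound.
have /andP[? ?] := spline2_bound (s + h); have /andP[? ?] := spline2_bound s.
apply: (@le_trans _ _ 1); last lra.
by rewrite ler_norml; apply/andP; split; lra.
Qed.

Lemma is_derive_spline3 s : is_derive s 1 spline3 (spline2 s).
Proof.
pose K := 3 * `|s + 3 / 2| + 1 + (3 * (3 * `|s + 1 / 2| + 1)) + (3 * (3 * `|s - 1 / 2| + 1)) + (3 * `|s - 3 / 2| + 1).
apply: (@is_derive_quadratic _ _ _ K) => h h1.
have h2 : 0 <= h ^+ 2 by exact: sqr_ge0.
have q t := @tp3_quad t h h1.
have := q (s + 3 / 2); have := q (s + 1 / 2); have := q (s - 1 / 2); have := q (s - 3 / 2).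
rewrite /spline3 /spline2 /K ![s + _ + h]addrAC.
move: (normr_ge0 (s + 3 / 2)) (normr_ge0 (s + 1 / 2)) (normr_ge0 (s - 1 / 2)) (normr_ge0 (s - 3 / 2)).
move: `|s + 3 / 2| `|s + 1 / 2| `|s - 1 / 2| `|s - 3 / 2| => a b c d a0 b0 c0 d0.
rewrite !ler_norml => /andP[? ?] /andP[? ?] /andP[? ?] /andP[? ?].
have aa : 0 <= a * h ^+ 2 by exact: mulr_ge0.
have bb : 0 <= b * h ^+ 2 by exact: mulr_ge0.
have cc : 0 <= c * h ^+ 2 by exact: mulr_ge0.
have dd : 0 <= d * h ^+ 2 by exact: mulr_ge0.
by apply/andP; split; lra.
Qed.

End truncated_powers.

(** * Convolution with product kernels *)

Section convolution.
Context {R : realType}.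
Implicit Types (s t h L : R) (k : R -> R) (f : plane R -> R) (v w : plane R).

Definition kern k := [/\ exists B, forall s, `|k s| <= B &
  exists A, forall s h, `|k (s + h) - k s| <= A * `|h|].

Lemma near_dist_le s (e : R) : 0 < e -> \forall x \near s, `|s - x| <= e.
Proof. by move=> e0; apply: (@cvgr_dist_le _ _ _ (nbhs s) _ id s) => //; exact: cvg_id. Qed.

Lemma real_continuousP (F : R -> R) s :
  (forall e, 0 < e -> exists2 d, 0 < d & forall t, `|t - s| <= d -> `|F t - F s| <= e) ->
  {for s, continuous F}.
Proof.
move=> FP; apply/cvgrPdist_le => /= e /FP[d d0 dP].
by have := near_dist_le s d0; apply: filterS => t st; rewrite distrC; apply: dP; rewrite distrC.
Qed.

Lemma plane_continuousP (F : plane R -> R) v :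
  (forall e, 0 < e -> exists2 d, 0 < d &
     forall w, `|w.1 - v.1| <= d -> `|w.2 - v.2| <= d -> `|F w - F v| <= e) ->
  {for v, continuous F}.
Proof.
move=> FP; apply/cvgrPdist_le => /= e /FP[d d0 dP].
have : \forall w \near v, `|v.1 - w.1| <= d /\ `|v.2 - w.2| <= d.
  have [n1 n2] := (near_dist_le v.1 d0, near_dist_le v.2 d0).
  by exists ([set x | `|v.1 - x| <= d], [set x | `|v.2 - x| <= d]).
by apply: filterS => w [d1 d2]; rewrite distrC; apply: dP; rewrite distrC.
Qed.

Lemma plane_continuous_dist (F : plane R -> R) v : {for v, continuous F} ->
  forall e, 0 < e -> exists2 d, 0 < d &
     forall w, `|w.1 - v.1| <= d -> `|w.2 - v.2| <= d -> `|F w - F v| <= e.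
Proof.
move=> /cvgrPdist_le/= FP e /FP[[A B] /= [A1 B1] AB].
have [d1 /= d10 d1A] : exists2 d : R, 0 < d & ball v.1 d `<=` A by apply/nbhs_ballP.
have [d2 /= d20 d2B] : exists2 d : R, 0 < d & ball v.2 d `<=` B by apply/nbhs_ballP.
exists (Num.min d1 d2 / 2); first by rewrite divr_gt0// lt_min d10.
move=> w w1 w2; rewrite distrC; apply: (AB w); split.
  apply: d1A; rewrite /ball/= distrC (le_lt_trans w1)// ltr_pdivrMr// gt_min.
  by rewrite ltr_pMr// ltr1n.
apply: d2B; rewrite /ball/= distrC (le_lt_trans w2)// ltr_pdivrMr// gt_min.
by rewrite (@ltr_pMr _ 2 d2)// ltr1n orbT.
Qed.

Lemma kern_continuous k : kern k -> continuous k.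
Proof.
move=> [_ [A kA]] s; apply: real_continuousP => e e0.
have A0 : 0 <= A by have := le_trans (normr_ge0 _) (kA 0 1); rewrite normr1 mulr1.
exists (e / (A + 1)); first by rewrite divr_gt0// ltr_wpDl.
move=> t ts; have := kA s (t - s); rewrite addrCA subrr addr0 => /le_trans; apply.
apply: (@le_trans _ _ ((A + 1) * `|t - s|)); first by rewrite ler_wpM2r// lerDl.
by rewrite mulrC -ler_pdivlMr ?ltr_wpDl.
Qed.

Lemma kern_measurable k : kern k -> measurable_fun setT k.
Proof. by move=> /kern_continuous; exact: continuous_measurable_fun. Qed.

Lemma measurable_box L : measurable (box L).
Proof. exact: measurableX. Qed.

Lemma box_fin L : (leb2 (box L) < +oo)%E.
Proof.
have [L0|L0] := leP 0 L; first by rewrite box_leb2// ltry.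
rewrite (_ : box L = set0) ?measure0 ?ltry//.
apply/seteqP; split => // -[x y] [/= /andP[/= + +] _]; rewrite !bnd_simp => a b.
by have := le_trans a b; lra.
Qed.

(** Restricting the integral to [box L] asks for boundedness of [f] on that box only, and goes
    unnoticed at points farther from its boundary than the support radius of the kernels. *)
Definition cv L f k1 k2 v : R :=
  \int[leb2]_(w in box L) (f w * (k1 (v.1 - w.1) * k2 (v.2 - w.2))).

Lemma bdm_kern1 k x (D : set (plane R)) : kern k -> bdm D (fun w => k (x - w.1)).
Proof.
move=> kk; split; last by case: kk => -[B kB] _; exists B.
apply: measurable_funTS; apply: (measurableT_comp (kern_measurable kk)).
by apply: measurable_funB; [exact: measurable_cst|exact: measurable_fst].
Qed.

Lemma bdm_kern2 k x (D : set (plane R)) : kern k -> bdm D (fun w => k (x - w.2)).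
Proof.
move=> kk; split; last by case: kk => -[B kB] _; exists B.
apply: measurable_funTS; apply: (measurableT_comp (kern_measurable kk)).
by apply: measurable_funB; [exact: measurable_cst|exact: measurable_snd].
Qed.

Section fixed_function.
Variables (L : R) (f : plane R -> R).
Hypothesis bf : bdm (box L) f.
Let mB := measurable_box L.
Let fB := box_fin L.

Lemma bdm_cv k1 k2 v : kern k1 -> kern k2 ->
  bdm (box L) (fun w => f w * (k1 (v.1 - w.1) * k2 (v.2 - w.2))).
Proof.
by move=> kk1 kk2; apply: bdmM => //; apply: bdmM; [exact: bdm_kern1|exact: bdm_kern2].
Qed.

Lemma IntB F G : bdm (box L) F -> bdm (box L) G ->
  \int[leb2]_(w in box L) (F w - G w) =
  \int[leb2]_(w in box L) F w - \int[leb2]_(w in box L) G w.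
Proof. by move=> bF bG; rewrite RintegralB//; exact: bdm_integrable. Qed.

Lemma IntD F G : bdm (box L) F -> bdm (box L) G ->
  \int[leb2]_(w in box L) (F w + G w) =
  \int[leb2]_(w in box L) F w + \int[leb2]_(w in box L) G w.
Proof. by move=> bF bG; rewrite RintegralD//; exact: bdm_integrable. Qed.

Lemma IntZ (c : R) F : bdm (box L) F ->
  \int[leb2]_(w in box L) (c * F w) = c * \int[leb2]_(w in box L) F w.
Proof. by move=> bF; rewrite RintegralZl//; exact: bdm_integrable. Qed.

(** The quadratic remainder of the kernel is uniform in its argument, hence integrates to a
    quadratic remainder of the convolution. *)
Lemma cv_derive1 k1 k1' k2 v (A : R) : kern k1 -> kern k1' -> kern k2 ->
  (forall s h, `|k1 (s + h) - k1 s - h * k1' s| <= A * h ^+ 2) ->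
  is_derive v.1 1 (fun x => cv L f k1 k2 (x, v.2)) (cv L f k1' k2 v).
Proof.
move=> kk1 kk1' kk2 kA.
have [_ [M fM]] := bf; have [[B kB] _] := kk2.
have B0 : 0 <= B by exact: le_trans (normr_ge0 _) (kB 0).
have A0 : 0 <= A.
  by have := le_trans (normr_ge0 _) (kA 0 1); rewrite expr1n mulr1.
apply: (@is_derive_quadratic _ _ _ _ (`|M| * A * B * fine (leb2 (box L)))) => h _.
rewrite /cv -IntZ; last exact: bdm_cv.
have b1 := @bdm_cv k1 k2 (v.1 + h, v.2) kk1 kk2.
have b2 := @bdm_cv k1 k2 (v.1, v.2) kk1 kk2.
have b3 := @bdm_cv k1' k2 v kk1' kk2.
have b4 : bdm (box L) (fun w => h * (f w * (k1' (v.1 - w.1) * k2 (v.2 - w.2)))).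
  by apply: bdmM => //; exact: bdm_cst.
rewrite -IntB// -IntB//; last exact: bdmB.
have -> : `|M| * A * B * fine (leb2 (box L)) * h ^+ 2 = (`|M| * (A * h ^+ 2 * B)) * fine (leb2 (box L)) by ring.
apply: bdm_le_Rintegral => //; [|by apply: bdmB => //; exact: bdmB|].
  by do 3![apply: mulr_ge0 => //]; exact: sqr_ge0.
move=> w Bw /=.
have -> : f w * (k1 (v.1 + h - w.1) * k2 (v.2 - w.2)) - f w * (k1 (v.1 - w.1) * k2 (v.2 - w.2)) -
   h * (f w * (k1' (v.1 - w.1) * k2 (v.2 - w.2))) =
   f w * ((k1 ((v.1 - w.1) + h) - k1 (v.1 - w.1) - h * k1' (v.1 - w.1)) * k2 (v.2 - w.2)).
  by rewrite (addrAC v.1 h); ring.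
by rewrite !normrM ler_pM// ?mulr_ge0// ?(le_trans (fM _ Bw)) ?ler_norm// ler_pM.
Qed.

Lemma cv_derive2 k1 k2 k2' v (A : R) : kern k1 -> kern k2 -> kern k2' ->
  (forall s h, `|k2 (s + h) - k2 s - h * k2' s| <= A * h ^+ 2) ->
  is_derive v.2 1 (fun z => cv L f k1 k2 (v.1, z)) (cv L f k1 k2' v).
Proof.
move=> kk1 kk2 kk2' kA.
have [_ [M fM]] := bf; have [[B kB] _] := kk1.
have B0 : 0 <= B by exact: le_trans (normr_ge0 _) (kB 0).
have A0 : 0 <= A.
  by have := le_trans (normr_ge0 _) (kA 0 1); rewrite expr1n mulr1.
apply: (@is_derive_quadratic _ _ _ _ (`|M| * A * B * fine (leb2 (box L)))) => h _.
rewrite /cv -IntZ; last exact: bdm_cv.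
have b1 := @bdm_cv k1 k2 (v.1, v.2 + h) kk1 kk2.
have b2 := @bdm_cv k1 k2 (v.1, v.2) kk1 kk2.
have b3 := @bdm_cv k1 k2' v kk1 kk2'.
have b4 : bdm (box L) (fun w => h * (f w * (k1 (v.1 - w.1) * k2' (v.2 - w.2)))).
  by apply: bdmM => //; exact: bdm_cst.
rewrite -IntB// -IntB//; last exact: bdmB.
have -> : `|M| * A * B * fine (leb2 (box L)) * h ^+ 2 = (`|M| * (B * (A * h ^+ 2))) * fine (leb2 (box L)) by ring.
apply: bdm_le_Rintegral => //; [|by apply: bdmB => //; exact: bdmB|].
  by do 3![apply: mulr_ge0 => //]; exact: sqr_ge0.
move=> w Bw /=.
have -> : f w * (k1 (v.1 - w.1) * k2 (v.2 + h - w.2)) - f w * (k1 (v.1 - w.1) * k2 (v.2 - w.2)) -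
   h * (f w * (k1 (v.1 - w.1) * k2' (v.2 - w.2))) =
   f w * (k1 (v.1 - w.1) * (k2 ((v.2 - w.2) + h) - k2 (v.2 - w.2) - h * k2' (v.2 - w.2))).
  by rewrite (addrAC v.2 h); ring.
by rewrite !normrM ler_pM// ?mulr_ge0// ?(le_trans (fM _ Bw)) ?ler_norm// ler_pM.
Qed.

Lemma cv_continuous k1 k2 : kern k1 -> kern k2 -> continuous (cv L f k1 k2).
Proof.
move=> kk1 kk2 v; have [_ [M fM]] := bf.
have [[B1 kB1] [A1 kA1]] := kk1; have [[B2 kB2] [A2 kA2]] := kk2.
have B10 : 0 <= B1 by exact: le_trans (normr_ge0 _) (kB1 0).
have B20 : 0 <= B2 by exact: le_trans (normr_ge0 _) (kB2 0).
have A10 : 0 <= A1 by have := le_trans (normr_ge0 _) (kA1 0 1); rewrite normr1 mulr1.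
have A20 : 0 <= A2 by have := le_trans (normr_ge0 _) (kA2 0 1); rewrite normr1 mulr1.
have m0 : 0 <= fine (leb2 (box L)) by rewrite fine_ge0.
pose C := `|M| * (A1 * B2 + B1 * A2) * fine (leb2 (box L)).
have C0 : 0 <= C by rewrite !mulr_ge0// addr_ge0// mulr_ge0.
apply: plane_continuousP => e e0; exists (e / (C + 1)); first by rewrite divr_gt0// ltr_wpDl.
move=> u u1 u2; set d := e / (C + 1) in u1 u2 *.
have d0 : 0 < d by rewrite divr_gt0// ltr_wpDl.
apply: (@le_trans _ _ (C * d)); last first.
  rewrite /d mulrCA; apply: ler_piMr; first exact: ltW.
  by rewrite ler_pdivrMr ?ltr_wpDl// mul1r lerDl.
have b1 := @bdm_cv k1 k2 u kk1 kk2; have b2 := @bdm_cv k1 k2 v kk1 kk2.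
rewrite /cv -IntB//.
have -> : C * d = (`|M| * (A1 * d * B2 + B1 * (A2 * d))) * fine (leb2 (box L)) by rewrite /C; ring.
apply: bdm_le_Rintegral => //; [|exact: bdmB|].
  have d0' := ltW d0; apply: mulr_ge0 => //; apply: addr_ge0; apply: mulr_ge0 => //; exact: mulr_ge0.
move=> w Bw /=; rewrite -mulrBr normrM ler_pM// ?(le_trans (fM _ Bw)) ?ler_norm//.
have -> : k1 (u.1 - w.1) * k2 (u.2 - w.2) - k1 (v.1 - w.1) * k2 (v.2 - w.2) =
  (k1 (u.1 - w.1) - k1 (v.1 - w.1)) * k2 (u.2 - w.2) +
  k1 (v.1 - w.1) * (k2 (u.2 - w.2) - k2 (v.2 - w.2)) by ring.
rewrite (le_trans (ler_normD _ _))// !normrM lerD// ler_pM//.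
  have -> : u.1 - w.1 = (v.1 - w.1) + (u.1 - v.1) by ring.
  by rewrite (le_trans (kA1 _ _))// ler_wpM2l.
have -> : u.2 - w.2 = (v.2 - w.2) + (u.2 - v.2) by ring.
by rewrite (le_trans (kA2 _ _))// ler_wpM2l.
Qed.

End fixed_function.

End convolution.

(** * Fubini on rectangles of finite measure *)

Section rectangle_Fubini.
Context d1 d2 (T1 : measurableType d1) (T2 : measurableType d2) (R : realType).
Variables (m1 : {sigma_finite_measure set T1 -> \bar R})
  (m2 : {sigma_finite_measure set T2 -> \bar R}).
Variables (A : set T1) (B : set T2) (F : T1 * T2 -> R).
Hypotheses (mA : measurable A) (mB : measurable B)
  (fA : (m1 A < +oo)%E) (fB : (m2 B < +oo)%E) (bF : bdm (A `*` B) F).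

Let mAB : measurable (A `*` B). Proof. exact: measurableX. Qed.

Lemma rect_fin : ((m1 \x m2)%E (A `*` B) < +oo)%E.
Proof.
rewrite product_measure1E//; apply: lte_mul_pinfty => //.
by rewrite ge0_fin_numE.
Qed.

Lemma bdm_slice1 x : A x -> bdm B (fun y => F (x, y)).
Proof.
move=> Ax; case: bF => mF [M FM]; split; last by exists M => y By; apply: FM.
have mF' : measurable_fun setT (F \_ (A `*` B)) by apply/(measurable_restrictT _ _).1.
have := measurableT_comp mF' (measurable_pair1 x).
move=> /(@measurable_funTS _ _ _ _ B); apply: eq_measurable_fun => y /set_mem By /=.
by rewrite patchE mem_set.
Qed.

Lemma bdm_slice2 y : B y -> bdm A (fun x => F (x, y)).
Proof.
move=> By; case: bF => mF [M FM]; split; last by exists M => x Ax; apply: FM.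
have mF' : measurable_fun setT (F \_ (A `*` B)) by apply/(measurable_restrictT _ _).1.
have := measurableT_comp mF' (measurable_pair2 y).
move=> /(@measurable_funTS _ _ _ _ A); apply: eq_measurable_fun => x /set_mem Ax /=.
by rewrite patchE mem_set.
Qed.

Let E := (EFin \o F) \_ (A `*` B).

Let iE : (m1 \x m2)%E.-integrable setT E.
Proof.
apply/(integrable_mkcond _ mAB).1; apply: bdm_integrable => //; exact: rect_fin.
Qed.

Lemma rect_Fubini1 : \int[(m1 \x m2)%E]_(v in A `*` B) F v =
  \int[m1]_(x in A) \int[m2]_(y in B) F (x, y).
Proof.
rewrite /Rintegral; congr fine; rewrite integral_mkcond [RHS]integral_mkcond.
transitivity (\int[m1]_x fubini_F m2 E x)%E; first by rewrite integral12_prod_meas1.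
apply: eq_integral => x _; rewrite /fubini_F patchE; case: ifPn => xA.
  rewrite -[RHS](RintegralE_bdm mB fB (bdm_slice1 (set_mem xA))).
  rewrite [RHS]integral_mkcond; apply: eq_integral => y _; rewrite /E !patchE.
  by rewrite in_setX xA.
by apply: integral0_eq => y _; rewrite /E patchE in_setX (negbTE xA).
Qed.

Lemma rect_Fubini2 : \int[(m1 \x m2)%E]_(v in A `*` B) F v =
  \int[m2]_(y in B) \int[m1]_(x in A) F (x, y).
Proof.
rewrite /Rintegral; congr fine; rewrite integral_mkcond [RHS]integral_mkcond.
transitivity (\int[m2]_x fubini_G m1 E x)%E; first by rewrite integral21_prod_meas1.
apply: eq_integral => y _; rewrite /fubini_G patchE; case: ifPn => yB.
  rewrite -[RHS](RintegralE_bdm mA fA (bdm_slice2 (set_mem yB))).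
  rewrite [RHS]integral_mkcond; apply: eq_integral => x _; rewrite /E !patchE.
  by rewrite in_setX yB andbT.
by apply: integral0_eq => x _; rewrite /E patchE in_setX (negbTE yB) andbF.
Qed.

End rectangle_Fubini.

Section plane_integrals.
Context {R : realType}.
Notation L1 := (@lebesgue_measure R).
Implicit Types (L x : R) (F : plane R -> R).

Lemma itv_fin L : (L1 `[(- L)%R, L]%classic < +oo)%E.
Proof. by rewrite lebesgue_measure_itv/=; case: ifP => _; rewrite ?ltry// -EFinB ltry. Qed.

Lemma box_Fubini1 L F : bdm (box L) F -> \int[leb2]_(v in box L) F v =
  \int[L1]_(x in `[(- L), L]) \int[L1]_(y in `[(- L), L]) F (x, y).
Proof. by move=> bF; apply: rect_Fubini1 => //; exact: itv_fin. Qed.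

Lemma box_Fubini2 L F : bdm (box L) F -> \int[leb2]_(v in box L) F v =
  \int[L1]_(y in `[(- L), L]) \int[L1]_(x in `[(- L), L]) F (x, y).
Proof. by move=> bF; apply: rect_Fubini2 => //; exact: itv_fin. Qed.

Lemma Rintegral_derive (F f : R -> R) (a b : R) : a < b ->
  (forall x, is_derive x 1 F (f x)) -> continuous f ->
  \int[L1]_(x in `[a, b]) f x = F b - F a.
Proof.
move=> ab dF cf; rewrite /Rintegral (@continuous_FTC2 _ f F)//.
- exact: continuous_subspaceT.
- have cF : continuous F.
    by move=> x; apply: differentiable_continuous; apply/derivable1_diffP; case: (dF x).
  split; first by move=> x _; case: (dF x).
  + by apply: cvg_at_right_filter; exact: cF.
  + by apply: cvg_at_left_filter; exact: cF.
- by move=> x _; rewrite derive1E; exact: derive_val.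
Qed.

End plane_integrals.

(** * Planar functions with continuous partial derivatives *)

Section plane_C1.
Context {R : realType}.
Implicit Types (v w : plane R).

Lemma MVT_increment (F dF : R -> R) (x a : R) : (forall y : R, is_derive y 1 F (dF y)) ->
  exists2 c, `|c - x| <= `|a| & F (x + a) - F x = a * dF c.
Proof.
move=> DF.
have cF : continuous F.
  by move=> y; apply: differentiable_continuous; apply/derivable1_diffP; case: (DF y).
have [a0|a0] := leP 0 a.
  have xa : x <= x + a by rewrite lerDl.
  have [c] := MVT_segment xa (fun y _ => DF y) (continuous_subspaceT cF).
  rewrite in_itv/= => /andP[c1 c2] ->; exists c; last by ring.
  by rewrite !ger0_norm// ?subr_ge0// lerBlDl.
have xa : x + a <= x by rewrite gerDl ltW.
have [c] := MVT_segment xa (fun y _ => DF y) (continuous_subspaceT cF).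
rewrite in_itv/= => /andP[c1 c2] FE; exists c.
  by rewrite ler0_norm ?subr_le0// ltr0_norm// opprB; lra.
by rewrite -opprB FE; ring.
Qed.

Variables (F P Q : plane R -> R).
Hypotheses (F1 : forall v, is_derive v.1 1 (fun x => F (x, v.2)) (P v))
  (F2 : forall v, is_derive v.2 1 (fun z => F (v.1, z)) (Q v))
  (cP : continuous P) (cQ : continuous Q).

Definition plane_diff v w : R := w.1 * P v + w.2 * Q v.

Lemma plane_diff_linear v : linear (plane_diff v).
Proof. move=> k x y; rewrite /plane_diff.
have -> : (k *: x + y).1 = k * x.1 + y.1 by [].
have -> : (k *: x + y).2 = k * x.2 + y.2 by [].
by rewrite -[k *: (_ + _)]/(k * (_ + _)); ring. Qed.

HB.instance Definition _ v := @GRing.isLinear.Build R (plane R) R _ (plane_diff v)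
  (plane_diff_linear v).

Lemma plane_diff_continuous v : continuous (plane_diff v).
Proof.
move=> w; apply: cvgD; apply: cvgM; try exact: cvg_cst.
  exact: cvg_fst.
exact: cvg_snd.
Qed.

Let V : normedModType R := plane R.

(** The increment is taken along two sides of a coordinate rectangle. On each side the mean value
    theorem yields a partial derivative at a nearby point, and continuity of [P] and [Q] makes the
    error little-o. *)
Lemma plane_C1_expansion v :
  (F : V -> R^o) \o shift (v : V) = cst (F v) + (plane_diff v : V -> R^o) +o_ (0 : V) id.
Proof.
apply/eqaddoP => _/posnumP[eps]; set e := eps%:num / 2.
have e0 : 0 < e by rewrite divr_gt0.
have [d1 d10 Pd] := plane_continuous_dist (@cP v) e0.
have [d2 d20 Qd] := plane_continuous_dist (@cQ v) e0.
have d0 : 0 < Num.min d1 d2 by rewrite lt_min d10.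
have : \forall h \near (0 : V), `|0 - h| <= Num.min d1 d2.
  exact: (@cvgr_dist_le _ _ _ (nbhs (0 : V)) _ id 0 cvg_id _ d0).
apply: filterS => h; rewrite sub0r normrN => hd /=.
have h1 : `|h.1| <= `|h| by rewrite {2}/Num.norm/= le_max lexx.
have h2 : `|h.2| <= `|h| by rewrite {2}/Num.norm/= le_max lexx orbT.
have [hd1 hd2] : `|h| <= d1 /\ `|h| <= d2 by move: hd; rewrite le_min => /andP.
have [c1 c1h E1] := @MVT_increment (fun y => F (y, v.2 + h.2)) (fun y => P (y, v.2 + h.2))
  v.1 h.1 (fun y => F1 (y, v.2 + h.2)).
have [c2 c2h E2] := @MVT_increment (fun y => F (v.1, y)) (fun y => Q (v.1, y))
  v.2 h.2 (fun y => F2 (v.1, y)).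
have -> : (F \o shift v - (cst (F v) + plane_diff v)) h =
  h.1 * (P (c1, v.2 + h.2) - P v) + h.2 * (Q (v.1, c2) - Q v).
  move: E1 E2 => /= E1 E2.
  rewrite !mulrBr -E1 -E2.
  have -> : (F \o shift v - (cst (F v) + plane_diff v)) h =
    F (h + v) - (F v + (h.1 * P v + h.2 * Q v)) by [].
  have -> : h + v = (v.1 + h.1, v.2 + h.2).
    by case: (h) (v) => [h1' h2'] [v1' v2']; congr (_, _); rewrite addrC.
  have -> : F v = F (v.1, v.2) by case: (v).
  by ring.
rewrite (le_trans (ler_normD _ _))// !normrM.
have -> : eps%:num * `|h| = `|h| * e + `|h| * e by rewrite /e; field.
apply: lerD; apply: ler_pM => //.
  apply: Pd => /=; first exact: le_trans c1h (le_trans h1 hd1).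
  by rewrite addrAC subrr add0r (le_trans h2).
apply: Qd => /=; first by rewrite subrr normr0 ltW.
exact: le_trans c2h (le_trans h2 hd2).
Qed.

Lemma plane_C1_diff v : 'd F v = plane_diff v :> (plane R -> R).
Proof.
apply: (@diff_unique _ _ _ F (plane_diff v)); first exact: plane_diff_continuous.
exact: plane_C1_expansion.
Qed.

Lemma plane_C1_differentiable v : differentiable F v.
Proof.
apply/diff_locallyP; rewrite plane_C1_diff; split; first exact: plane_diff_continuous.
exact: plane_C1_expansion.
Qed.

Lemma plane_C1_derive w v : 'D_w F v = w.1 * P v + w.2 * Q v.
Proof. by rewrite deriveE ?plane_C1_diff//; exact: plane_C1_differentiable. Qed.

Lemma compact_box (L : R) : compact (box L).
Proof. by apply: compact_setX; exact: segment_compact. Qed.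

Lemma plane_C1_Cc1 L : (forall v, ~ box L v -> F v = 0) -> Cc1 F.
Proof.
move=> FL; split; [exact: plane_C1_differentiable| |].
  move=> w; rewrite (_ : 'D_w F = fun v => w.1 * P v + w.2 * Q v); last first.
    by apply/funext => v; exact: plane_C1_derive.
  by move=> v; apply: cvgD; apply: cvgM; try exact: cvg_cst; [exact: cP|exact: cQ].
have cl : closed (box L).
  by apply: compact_closed; [exact: norm_hausdorff|exact: compact_box].
apply: (subclosed_compact _ (@compact_box L)); first exact: closed_closure.
rewrite [X in _ `<=` X](proj1 (closure_id _) cl); apply: closureS => v /= /eqP Fv.
by apply: contrapT => /FL.
Qed.

End plane_C1.

(** * The mollifying kernel and its estimates *)

Section mollifier.
Context {R : realType}.
Notation L1 := (@lebesgue_measure R).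
Implicit Types (v : plane R) (e s h : R).

(** The rescaled bump has mass 1 because [spline3], the primitive of [spline2], climbs from 0 to
    1. *)
Definition pk e s : R := spline2 (s / e) / e.
Definition pk' e s : R := spline1 (s / e) / e ^+ 2.

Lemma pk_quad e s h : 0 < e -> `|pk e (s + h) - pk e s - h * pk' e s| <= 4 / e ^+ 3 * h ^+ 2.
Proof.
move=> e0; have e1 : e != 0 by rewrite gt_eqF.
have -> : pk e (s + h) - pk e s - h * pk' e s =
  (spline2 (s / e + h / e) - spline2 (s / e) - h / e * spline1 (s / e)) / e.
  by rewrite /pk /pk' -mulrDl; field.
rewrite normrM normfV (gtr0_norm e0) ler_pdivrMr//.
by rewrite (le_trans (spline2_quad _ _))// le_eqVlt; apply/orP; left; apply/eqP; field.
Qed.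

Lemma pk_bound e s : 0 < e -> `|pk e s| <= e^-1.
Proof.
move=> e0; rewrite /pk normrM normfV (gtr0_norm e0); apply: ler_piMl; first by rewrite invr_ge0 ltW.
by have /andP[? ?] := spline2_bound (s / e); rewrite ger0_norm.
Qed.

Lemma pk'_bound e s : 0 < e -> `|pk' e s| <= (e ^+ 2)^-1.
Proof.
move=> e0; have e2 : 0 < e ^+ 2 by rewrite exprn_gt0.
rewrite /pk' normrM normfV (gtr0_norm e2); apply: ler_piMl; first by rewrite invr_ge0 ltW.
exact: spline1_bound.
Qed.

Lemma kern_pk e : 0 < e -> kern (pk e).
Proof.
move=> e0; split; first by exists e^-1 => s; exact: pk_bound.
exists (5 / e ^+ 2) => s h; rewrite /pk -mulrBl normrM normfV (gtr0_norm e0).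
rewrite ler_pdivrMr// [in X in `|X|]mulrDl (le_trans (spline2_lip _ _))//.
rewrite normrM normfV (gtr0_norm e0) le_eqVlt; apply/orP; left; apply/eqP.
by field; rewrite gt_eqF.
Qed.

Lemma kern_pk' e : 0 < e -> kern (pk' e).
Proof.
move=> e0; split; first by exists (e ^+ 2)^-1 => s; exact: pk'_bound.
have e2 : 0 < e ^+ 2 by rewrite exprn_gt0.
exists (8 / e ^+ 3) => s h; rewrite /pk' -mulrBl normrM normfV (gtr0_norm e2).
rewrite ler_pdivrMr// [in X in `|X|]mulrDl (le_trans (spline1_lip _ _))//.
rewrite normrM normfV (gtr0_norm e0) le_eqVlt; apply/orP; left; apply/eqP.
by field; rewrite gt_eqF.
Qed.

(** The support radius 3 e / 2 is rounded up to 2 e, which is exactly s^2 for the scale e = s^2 / 2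
    used in the estimates. *)
Lemma pk_out e s : 0 < e -> 2 * e <= `|s| -> pk e s = 0.
Proof.
move=> e0 es; rewrite /pk spline2_out ?mul0r// normrM normfV (gtr0_norm e0).
by rewrite ler_pdivlMr//; lra.
Qed.

Lemma pk'_out e s : 0 < e -> 2 * e <= `|s| -> pk' e s = 0.
Proof.
move=> e0 es; rewrite /pk' spline1_out ?mul0r// normrM normfV (gtr0_norm e0).
by rewrite ler_pdivlMr//; lra.
Qed.

Lemma is_derive_reflect (F : R -> R) (x e w d : R) :
  is_derive ((x - w) / e) 1 F d ->
  is_derive w 1 (fun w => - F ((x - w) / e)) (d / e).
Proof.
move=> DF.
have Dg : is_derive w 1 (fun w => (x - w) / e) (- e^-1).
  apply: (@is_derive_quadratic _ _ _ _ 0) => h _.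
  by rewrite mul0r -mulrBl (_ : _ - _ = 0) ?normr0//; ring.
have -> : d / e = - (d * - e^-1) by ring.
exact: is_deriveN.
Qed.

Lemma is_derive_pk e s : 0 < e -> is_derive s 1 (pk e) (pk' e s).
Proof.
move=> e0; apply: (@is_derive_quadratic _ _ _ _ (4 / e ^+ 3)) => h _; exact: pk_quad.
Qed.

Lemma Rintegral_pk (e x L : R) : 0 < e -> `|x| + 2 * e <= L ->
  \int[L1]_(w in `[(- L), L]) pk e (x - w) = 1.
Proof.
move=> e0 xL; have x0 := normr_ge0 x.
have [x1 x2] : - `|x| <= x /\ x <= `|x| by move: (lexx `|x|); rewrite {1}ler_norml => /andP.
have D (w : R) : is_derive w 1 (fun u => - spline3 ((x - u) / e)) (pk e (x - w)).
  by apply: is_derive_reflect; exact: is_derive_spline3.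
have c : continuous (fun w : R => pk e (x - w)).
  move=> w; apply: (@continuous_comp _ _ _ (fun w : R => x - w) (pk e)).
    by apply: cvgB; [exact: cvg_cst|exact: cvg_id].
  exact/kern_continuous/kern_pk.
rewrite (@Rintegral_derive _ _ _ (- L) L _ D c)//; last lra.
rewrite spline3_le ?spline3_ge ?oppr0 ?add0r ?opprK//.
  by rewrite ler_pdivlMr//; lra.
by rewrite ler_pdivrMr//; lra.
Qed.

Lemma Rintegral_pk' (e x L : R) : 0 < e -> `|x| + 2 * e <= L ->
  \int[L1]_(w in `[(- L), L]) pk' e (x - w) = 0.
Proof.
move=> e0 xL; have x0 := normr_ge0 x.
have [x1 x2] : - `|x| <= x /\ x <= `|x| by move: (lexx `|x|); rewrite {1}ler_norml => /andP.
have D (w : R) : is_derive w 1 (fun u => - pk e ((x - u) / 1)) (pk' e (x - w)).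
  rewrite -[pk' e (x - w)]divr1; apply: is_derive_reflect.
  by rewrite divr1; exact: is_derive_pk.
have c : continuous (fun w : R => pk' e (x - w)).
  move=> w; apply: (@continuous_comp _ _ _ (fun w : R => x - w) (pk' e)).
    by apply: cvgB; [exact: cvg_cst|exact: cvg_id].
  exact/kern_continuous/kern_pk'.
rewrite (@Rintegral_derive _ _ _ (- L) L _ D c)//; last lra.
rewrite !divr1 !pk_out ?subrr//.
  by rewrite ler_normr; apply/orP; left; lra.
by rewrite ler_normr; apply/orP; right; lra.
Qed.

Section localization.
Context d (T : measurableType d) (mu : {measure set T -> \bar R}).

Lemma Rintegral_subset (S D : set T) (G : T -> R) : S `<=` D ->
  (forall x, D x -> ~ S x -> G x = 0) ->
  \int[mu]_(x in D) G x = \int[mu]_(x in S) G x.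
Proof.
move=> SD GS; rewrite Rintegral_mkcond [RHS]Rintegral_mkcond; congr (Rintegral _ _ _).
apply/funext => x; rewrite !patchE; case: ifPn => xD; case: ifPn => xS //.
  by apply: GS; [exact: set_mem|move=> /mem_set; rewrite (negbTE xS)].
by move: xD; rewrite mem_set//; exact/SD/set_mem.
Qed.

Lemma integral_vanish (D : set T) (G : T -> R) : measurable D -> (mu D < +oo)%E ->
  bdm D G -> (forall x, ~ D x -> G x = 0) ->
  (\int[mu]_x (G x)%:E)%E = (\int[mu]_(x in D) G x)%:E.
Proof.
move=> mD fD bG GD; rewrite -RintegralE_bdm// [RHS]integral_mkcond.
by apply: eq_integral => x _; rewrite patchE; case: ifPn => // /negP xD; rewrite GD// => /mem_set.
Qed.

End localization.

Definition square v (r : R) : set (plane R) :=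
  `[v.1 - r, v.1 + r]%classic `*` `[v.2 - r, v.2 + r]%classic.

Lemma measurable_square v r : measurable (square v r).
Proof. exact: measurableX. Qed.

Lemma square_leb2 v (r : R) : 0 < r -> leb2 (square v r) = (4 * r ^+ 2)%:E.
Proof.
move=> r0; transitivity (L1 `[(v.1 - r)%R, (v.1 + r)%R]%classic * L1 `[(v.2 - r)%R, (v.2 + r)%R]%classic)%E.
  exact: product_measure1E.
rewrite !lebesgue_measure_itv/= !lte_fin !ifT; [|lra|lra].
by rewrite -!EFinB -EFinM; congr (_%:E); ring.
Qed.

Lemma square_sub_box v (r N : R) : box N v -> square v r `<=` box (N + r).
Proof.
rewrite /box /square/= !in_itv/= => -[/andP[? ?] /andP[? ?]] u /=.
by rewrite !in_itv/= => -[/andP[? ?] /andP[? ?]]; split; apply/andP; split; lra.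
Qed.

(** Only the values of [F] on a square of half-side 2 e, hence of area 16 e^2, are seen by the
    kernels. When [F] is an increment of [f], this turns Hoelder continuity into bounds on the
    mollified function and its derivatives. *)
Lemma cv_local_bound (L N e A B1 B2 : R) (F : plane R -> R) k1 k2 v :
  0 < e -> N + 2 * e <= L -> box N v -> bdm (box L) F -> kern k1 -> kern k2 ->
  0 <= A -> 0 <= B1 -> 0 <= B2 ->
  (forall w, box L w -> square v (2 * e) w -> `|F w| <= A) ->
  (forall s, `|k1 s| <= B1) -> (forall s, `|k2 s| <= B2) ->
  (forall s, 2 * e <= `|s| -> k1 s = 0) -> (forall s, 2 * e <= `|s| -> k2 s = 0) ->
  `|cv L F k1 k2 v| <= A * (B1 * B2) * (16 * e ^+ 2).
Proof.
move=> e0 NL Nv bF kk1 kk2 A0 B10 B20 FA kB1 kB2 k10 k20.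
have e20 : 0 < 2 * e by lra.
have SL : square v (2 * e) `<=` box L.
  move=> w /(square_sub_box Nv); rewrite /box/= !in_itv/= => -[/andP[? ?] /andP[? ?]].
  by split; apply/andP; split; lra.
have bG := bdm_cv bF v kk1 kk2.
rewrite /cv (@Rintegral_subset _ _ leb2 (square v (2 * e)))//; last first.
  move=> w Lw wS; have [w1|w1] := leP (2 * e) `|v.1 - w.1|; first by rewrite k10// mul0r mulr0.
  have [w2|w2] := leP (2 * e) `|v.2 - w.2|; first by rewrite k20// !mulr0.
  exfalso; apply: wS; move: w1 w2; rewrite /square/= !in_itv/= !ltr_norml => /andP[? ?] /andP[? ?].
  by split; apply/andP; split; lra.
have -> : 16 * e ^+ 2 = fine (leb2 (square v (2 * e))) by rewrite square_leb2//=; ring.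
apply: bdm_le_Rintegral => //; first exact: measurable_square.
- by rewrite square_leb2// ltry.
- by rewrite !mulr_ge0.
- by apply: bdm_sub bG => //; exact: measurable_box.
- move=> w Sw; rewrite !normrM ler_pM// ?mulr_ge0//; first by apply: FA => //; exact: SL.
  by rewrite ler_pM.
Qed.

Lemma cv1 (N L e : R) k1 k2 v : 0 < e -> N + 2 * e <= L -> box N v -> kern k1 -> kern k2 ->
  cv L (fun=> 1) k1 k2 v =
  (\int[L1]_(x in `[(- L), L]) k1 (v.1 - x)) * (\int[L1]_(y in `[(- L), L]) k2 (v.2 - y)).
Proof.
move=> e0 NL Nv kk1 kk2; rewrite /cv box_Fubini1; last exact/bdm_cv/kk2/kk1/bdm_cst.
have b1 : bdm `[(- L), L]%classic (fun x : R => k1 (v.1 - x)).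
  split; last by case: kk1 => -[B kB] _; exists B.
  apply: measurable_funTS; apply: (measurableT_comp (kern_measurable kk1)).
  by apply: measurable_funB; [exact: measurable_cst|exact: measurable_id].
have b2 : bdm `[(- L), L]%classic (fun x : R => k2 (v.2 - x)).
  split; last by case: kk2 => -[B kB] _; exists B.
  apply: measurable_funTS; apply: (measurableT_comp (kern_measurable kk2)).
  by apply: measurable_funB; [exact: measurable_cst|exact: measurable_id].
rewrite -RintegralZr//; last exact/bdm_integrable/b1/itv_fin.
apply: eq_Rintegral => x _ /=; rewrite -RintegralZl//; last exact/bdm_integrable/b2/itv_fin.
by apply: eq_Rintegral => y _; rewrite mul1r.
Qed.

(** The distributional half of [intrinsic_gradient]. The essential bound is replaced below by a
    bound at every point, for a suitable representative. *)
Definition weak_gradient (f g : plane R -> R) :=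
  forall psi : plane R -> R, Cc1 psi ->
    (\int[leb2]_v (g v * psi v)%:E =
     \int[leb2]_v (- f v * 'D_(1, 0) psi v
                   + f v ^+ 2 / 2 * 'D_(0, 1) psi v)%:E)%E.

Lemma weak_gradient_box (L : R) (f g psi P Q : plane R -> R) : weak_gradient f g ->
  bdm (box L) f -> bdm (box L) g -> 
  (forall v, is_derive v.1 1 (fun x => psi (x, v.2)) (P v)) ->
  (forall v, is_derive v.2 1 (fun z => psi (v.1, z)) (Q v)) ->
  continuous P -> continuous Q -> bdm (box L) psi -> bdm (box L) P -> bdm (box L) Q ->
  (forall v, ~ box L v -> [/\ psi v = 0, P v = 0 & Q v = 0]) ->
  \int[leb2]_(v in box L) (g v * psi v) =
  \int[leb2]_(v in box L) (- f v * P v + f v ^+ 2 / 2 * Q v).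
Proof.
move=> fg bf bg dP dQ cP cQ bpsi bP bQ out.
have /fg : Cc1 psi by apply: (plane_C1_Cc1 dP dQ cP cQ (L := L)) => v /out[].
under [in RHS]eq_integral => v _ do
  rewrite !(plane_C1_derive dP dQ cP cQ) /= !mul1r !mul0r addr0 add0r.
have -> : (\int[leb2]_v (g v * psi v)%:E = (\int[leb2]_(v in box L) (g v * psi v))%:E)%E.
  apply: integral_vanish; [exact: measurable_box|exact: box_fin|exact: bdmM|].
  by move=> v /out[-> _ _]; rewrite mulr0.
have -> : (\int[leb2]_v (- f v * P v + f v ^+ 2 / 2 * Q v)%:E =
  (\int[leb2]_(v in box L) (- f v * P v + f v ^+ 2 / 2 * Q v))%:E)%E.
  apply: integral_vanish; [exact: measurable_box|exact: box_fin| |].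
    apply: bdmD; first by apply: bdmM => //; exact: bdmN.
    by apply: bdmM => //; apply: bdmM; [exact: bdmX|exact: bdm_cst].
  by move=> v /out[_ -> ->]; rewrite !mulr0 addr0.
by move=> [].
Qed.

Section estimates.
Variables (N L C G : R) (f g : plane R -> R).
Hypotheses (NL : L = N + 1) (C0 : 0 <= C) (G0 : 0 <= G).
Hypotheses (bf : bdm (box L) f) (mg : measurable_fun setT g) (gG : forall v, `|g v| <= G)
  (fg : weak_gradient f g).
Hypothesis fC : forall s v w, 0 <= s -> box L v -> box L w ->
  `|w.1 - v.1| <= s ^+ 2 -> `|w.2 - v.2| <= s ^+ 2 -> `|f w - f v| <= C * s.

Variables (s : R).
Hypotheses (s0 : 0 < s) (s1 : s <= 1).
Let e := s ^+ 2 / 2.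
Let e0 : 0 < e. Proof. by rewrite divr_gt0// exprn_gt0. Qed.
Let NLe : N + 2 * e <= L.
Proof.
by rewrite NL lerD2l /e mulrCA divff// mulr1 exprn_ile1// ltW.
Qed.

(* f convolved with a bump of width e, and its two partial derivatives *)
Definition moll := cv L f (pk e) (pk e).
Definition moll1 := cv L f (pk' e) (pk e).
Definition moll2 := cv L f (pk e) (pk' e).

Let kp := kern_pk e0.
Let kp' := kern_pk' e0.

Lemma is_derive_moll1 v : is_derive v.1 1 (fun x => moll (x, v.2)) (moll1 v).
Proof. by apply: (@cv_derive1 _ L f bf _ _ _ v (4 / e ^+ 3)) => // t h; exact: pk_quad. Qed.

Lemma is_derive_moll2 v : is_derive v.2 1 (fun z => moll (v.1, z)) (moll2 v).
Proof. by apply: (@cv_derive2 _ L f bf _ _ _ v (4 / e ^+ 3)) => // t h; exact: pk_quad. Qed.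

Lemma moll_continuous : continuous moll. Proof. exact: cv_continuous. Qed.
Lemma moll1_continuous : continuous moll1. Proof. exact: cv_continuous. Qed.
Lemma moll2_continuous : continuous moll2. Proof. exact: cv_continuous. Qed.

Variable v : plane R.
Hypothesis Nv : box N v.

Let Lv : box L v.
Proof.
by move: Nv; rewrite /box/= !in_itv/= NL => -[/andP[? ?] /andP[? ?]]; split; apply/andP; split; lra.
Qed.

Let N0 : `|v.1| <= N /\ `|v.2| <= N.
Proof. by move: Nv; rewrite /box/= !in_itv/= -!ler_norml => -[]. Qed.

Let near_f w : box L w -> square v (2 * e) w -> `|f w - f v| <= C * s.
Proof.
move=> Lw; have -> : 2 * e = s ^+ 2 by rewrite /e; field.
rewrite /square/= !in_itv/= => -[/andP[? ?] /andP[? ?]].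
by apply: fC => //; [exact: ltW|rewrite ler_norml; apply/andP; split; lra..].
Qed.

(** Together with the masses 1 and 0 of the kernels computed next, this replaces the size of [f] in
    the estimates by its oscillation. *)
Let cv_center k1 k2 (c : R) : kern k1 -> kern k2 ->
  cv L f k1 k2 v - c * cv L (fun=> 1) k1 k2 v = cv L (fun w => f w - c) k1 k2 v.
Proof.
move=> kk1 kk2; rewrite /cv.
have b1 := bdm_cv bf v kk1 kk2.
have b2 := bdm_cv (bdm_cst (box L) 1) v kk1 kk2.
have b3 : bdm (box L) (fun w => c * (1 * (k1 (v.1 - w.1) * k2 (v.2 - w.2)))).
  by apply: bdmM => //; exact: bdm_cst.
rewrite -(IntZ (L := L))// -(IntB (L := L))//.
by apply: eq_Rintegral => w _; ring.
Qed.

Let cv1_pp : cv L (fun=> 1) (pk e) (pk e) v = 1.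
Proof.
rewrite (cv1 e0 NLe)//; case: N0 => n1 n2.
by rewrite !Rintegral_pk ?mulr1// (le_trans _ NLe)// lerD2r.
Qed.

Let cv1_p'p : cv L (fun=> 1) (pk' e) (pk e) v = 0.
Proof.
rewrite (cv1 e0 NLe)//; case: N0 => n1 n2.
by rewrite Rintegral_pk' ?mul0r// (le_trans _ NLe)// lerD2r.
Qed.

Let cv1_pp' : cv L (fun=> 1) (pk e) (pk' e) v = 0.
Proof.
rewrite (cv1 e0 NLe)//; case: N0 => n1 n2.
by rewrite (Rintegral_pk' (x := v.2)) ?mulr0// (le_trans _ NLe)// lerD2r.
Qed.

Let bfc c : bdm (box L) (fun w => f w - c).
Proof. by apply: bdmB => //; exact: bdm_cst. Qed.

Let i1 : 0 <= e^-1. Proof. by rewrite invr_ge0 ltW. Qed.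
Let i2 : 0 <= (e ^+ 2)^-1. Proof. by rewrite invr_ge0 exprn_ge0 ?ltW. Qed.
Let Cs0 : 0 <= C * s. Proof. by rewrite mulr_ge0// ltW. Qed.
Let sn0 : s != 0. Proof. by rewrite gt_eqF. Qed.

(** The factors are C s for the oscillation of [f] on the support, 1 / e for each kernel, and 16 e^2
    for the area. *)
Lemma moll_dist : `|moll v - f v| <= 16 * C * s.
Proof.
rewrite -[f v]mulr1 -[X in f v * X]cv1_pp cv_center//.
apply: le_trans (cv_local_bound e0 NLe Nv (bfc (f v)) kp kp Cs0 i1 i1
  _ (fun t => pk_bound t e0) (fun t => pk_bound t e0)
  (fun t => pk_out e0) (fun t => pk_out e0)) _; first exact: near_f.
by rewrite le_eqVlt; apply/orP; left; apply/eqP; rewrite /e; field; rewrite ?expf_neq0.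
Qed.

(** One kernel is now differentiated and has size 1 / e^2, which gives 16 C s / e = 32 C / s. *)
Lemma moll2_bound : `|moll2 v| <= 32 * C / s.
Proof.
rewrite -[moll2 v]subr0 -(mulr0 (f v)) -cv1_pp' cv_center//.
apply: le_trans (cv_local_bound e0 NLe Nv (bfc (f v)) kp kp' Cs0 i1 i2
  _ (fun t => pk_bound t e0) (fun t => pk'_bound t e0)
  (fun t => pk_out e0) (fun t => pk'_out e0)) _; first exact: near_f.
by rewrite le_eqVlt; apply/orP; left; apply/eqP; rewrite /e; field; rewrite ?expf_neq0.
Qed.

Definition moll_grad u := moll1 u - moll u * moll2 u.

Let is_derive_pk_reflect (x w : R) : is_derive w 1 (fun t => pk e (x - t)) (- pk' e (x - w)).
Proof.
apply: (@is_derive_quadratic _ _ _ _ (4 / e ^+ 3)) => h _.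
have := pk_quad (x - w) (- h) e0; rewrite sqrrN; apply: le_trans.
by rewrite le_eqVlt; apply/orP; left; apply/eqP; congr (`|_|); rewrite opprD addrA; ring.
Qed.

(** The weak equation is tested with the kernel centred at [v]; derivatives in the integration
    variable are minus the derivatives in [v]. *)
Lemma moll_grad_weak : moll1 v - cv L (fun w => f w ^+ 2 / 2) (pk e) (pk' e) v = cv L g (pk e) (pk e) v.
Proof.
have bg : bdm (box L) g by split; [exact: measurable_funTS|exists G].
have bf2 : bdm (box L) (fun w => f w ^+ 2 / 2).
  by apply: bdmM; [exact: bdmX|exact: bdm_cst].
pose psi (w : plane R) := pk e (v.1 - w.1) * pk e (v.2 - w.2).
pose P (w : plane R) := - pk' e (v.1 - w.1) * pk e (v.2 - w.2).
pose Q (w : plane R) := - (pk e (v.1 - w.1) * pk' e (v.2 - w.2)).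
have c1 k : kern k -> continuous (fun w : plane R => k (v.1 - w.1)).
  move=> kk w; apply: (@continuous_comp _ _ _ (fun w : plane R => v.1 - w.1) k).
    by apply: cvgB; [exact: cvg_cst|exact: cvg_fst].
  exact: kern_continuous.
have c2 k : kern k -> continuous (fun w : plane R => k (v.2 - w.2)).
  move=> kk w; apply: (@continuous_comp _ _ _ (fun w : plane R => v.2 - w.2) k).
    by apply: cvgB; [exact: cvg_cst|exact: cvg_snd].
  exact: kern_continuous.
have bpsi : bdm (box L) psi by apply: bdmM; [exact: bdm_kern1|exact: bdm_kern2].
have bP : bdm (box L) P by apply: bdmM; [apply: bdmN; exact: bdm_kern1|exact: bdm_kern2].
have bQ : bdm (box L) Q by apply: bdmN; apply: bdmM; [exact: bdm_kern1|exact: bdm_kern2].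
have DP (w : plane R) : is_derive w.1 1 (fun t => psi (t, w.2)) (P w).
  have := @is_deriveM _ _ (fun t => pk e (v.1 - t)) (fun _ => pk e (v.2 - w.2)) w.1 1 _ 0
    (is_derive_pk_reflect v.1 w.1) (is_derive_cst _ _ _).
  rewrite scaler0 add0r.
  by have -> : pk e (v.2 - w.2) *: - pk' e (v.1 - w.1) = P w by rewrite /P mulrC.
have DQ (w : plane R) : is_derive w.2 1 (fun t => psi (w.1, t)) (Q w).
  have := @is_deriveM _ _ (fun _ => pk e (v.1 - w.1)) (fun t => pk e (v.2 - t)) w.2 1 0 _
    (is_derive_cst _ _ _) (is_derive_pk_reflect v.2 w.2).
  rewrite scaler0 addr0.
  by have -> : pk e (v.1 - w.1) *: - pk' e (v.2 - w.2) = Q w by rewrite /Q -[RHS]mulrN.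
have cP : continuous P.
  by move=> w; apply: cvgM; [apply: cvgN; exact: (c1 _ kp')|exact: (c2 _ kp)].
have cQ : continuous Q.
  by move=> w; apply: cvgN; apply: cvgM; [exact: (c1 _ kp)|exact: (c2 _ kp')].
have out w : ~ box L w -> [/\ psi w = 0, P w = 0 & Q w = 0].
  move=> wL; have [w1|w1] := leP (2 * e) `|v.1 - w.1|.
    by rewrite /psi /P /Q (pk_out e0 w1) (pk'_out e0 w1) oppr0 !mul0r oppr0.
  have [w2|w2] := leP (2 * e) `|v.2 - w.2|.
    by rewrite /psi /P /Q (pk_out e0 w2) (pk'_out e0 w2) !mulr0 oppr0.
  exfalso; apply: wL; move: NLe w1 w2 Nv; rewrite /box/= !in_itv/= !ltr_norml.
  move=> ? /andP[? ?] /andP[? ?] [/andP[? ?] /andP[? ?]].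
  by split; apply/andP; split; lra.
have wg := @weak_gradient_box L f g psi P Q fg bf bg DP DQ cP cQ bpsi bP bQ out.
transitivity (\int[leb2]_(w in box L) (- f w * P w + f w ^+ 2 / 2 * Q w)); last by rewrite -wg.
rewrite /moll1 /cv -(IntB (L := L)); [|exact: bdm_cv|exact: bdm_cv].
by apply: eq_Rintegral => w _; rewrite /P /Q; ring.
Qed.

(** A commutator estimate. As the differentiated kernel has mass zero, f^2 / 2 - k f may be
    completed to (f - k)^2 / 2 with [k] the mollified value at [v]. By the 1/2-Hoelder bound this
    square is O(s^2), which compensates exactly the factor 1 / e = 2 / s^2. The number 17 is 1 for
    the oscillation of [f] plus 16 from [moll_dist]. *)
Lemma moll_grad_bound : `|moll_grad v| <= 16 * G + 16 * (17 * C) ^+ 2.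
Proof.
have bg : bdm (box L) g by split; [exact: measurable_funTS|exists G].
have bf2 : bdm (box L) (fun w => f w ^+ 2 / 2).
  by apply: bdmM; [exact: bdmX|exact: bdm_cst].
set k := moll v.
have bk : bdm (box L) (fun w => (f w - k) ^+ 2 / 2).
  by apply: bdmM; [exact: bdmX|exact: bdm_cst].
have -> : moll_grad v = cv L g (pk e) (pk e) v + cv L (fun w => (f w - k) ^+ 2 / 2) (pk e) (pk' e) v.
  rewrite -moll_grad_weak /moll_grad -/k.
  have -> : cv L (fun w => (f w - k) ^+ 2 / 2) (pk e) (pk' e) v =
     cv L (fun w => f w ^+ 2 / 2) (pk e) (pk' e) v - k * moll2 v.
    (* A vanishing term is inserted to complete the square. *)
    have <- : k ^+ 2 / 2 * cv L (fun=> 1) (pk e) (pk' e) v +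
      (cv L (fun w => f w ^+ 2 / 2) (pk e) (pk' e) v - k * moll2 v) =
      cv L (fun w => f w ^+ 2 / 2) (pk e) (pk' e) v - k * moll2 v.
      by rewrite cv1_pp' mulr0 add0r.
    have b1 := bdm_cv (bdm_cst (box L) 1) v kp kp'.
    have b2 := bdm_cv bf2 v kp kp'; have b3 := bdm_cv bf v kp kp'.
    rewrite /moll2 /cv -!(IntZ (L := L))// -(IntB (L := L))//; last first.
      by apply: bdmM => //; exact: bdm_cst.
    rewrite -(IntD (L := L))//; first last.
    - by apply: bdmB => //; apply: bdmM => //; exact: bdm_cst.
    - by apply: bdmM => //; exact: bdm_cst.
    by apply: eq_Rintegral => w _; field.
  ring.
rewrite (le_trans (ler_normD _ _))//; apply: lerD.
  apply: le_trans (cv_local_bound e0 NLe Nv bg kp kp G0 i1 i1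
    (fun w _ _ => gG w) (fun t => pk_bound t e0) (fun t => pk_bound t e0)
    (fun t => pk_out e0) (fun t => pk_out e0)) _.
  by rewrite le_eqVlt; apply/orP; left; apply/eqP; rewrite /e; field; rewrite ?expf_neq0.
have A0 : 0 <= (17 * C * s) ^+ 2 / 2 by rewrite divr_ge0// sqr_ge0.
apply: le_trans (cv_local_bound e0 NLe Nv bk kp kp' A0 i1 i2
  _ (fun t => pk_bound t e0) (fun t => pk'_bound t e0)
  (fun t => pk_out e0) (fun t => pk'_out e0)) _; last first.
  by rewrite le_eqVlt; apply/orP; left; apply/eqP; rewrite /e; field; rewrite ?expf_neq0.
move=> w Lw Sw; rewrite ger0_norm ?divr_ge0 ?sqr_ge0// ler_pM2r ?invr_gt0//.
rewrite -real_normK ?num_real// lerXn2r ?nnegrE//.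
  by rewrite !mulr_ge0// ltW.
have -> : f w - k = (f w - f v) - (k - f v) by ring.
rewrite (le_trans (ler_normB _ _))//.
have -> : 17 * C * s = C * s + 16 * C * s by ring.
by apply: lerD; [exact: near_f|exact: moll_dist].
Qed.

End estimates.

End mollifier.

Section calculus.
Context {R : realType}.
Implicit Types (x d : R) (F G : R -> R).

Lemma derD F G x dF dG : is_derive x 1 F dF -> is_derive x 1 G dG ->
  is_derive x 1 (fun t => F t + G t) (dF + dG).
Proof. by move=> ? ?; exact: is_deriveD. Qed.

Lemma derB F G x dF dG : is_derive x 1 F dF -> is_derive x 1 G dG ->
  is_derive x 1 (fun t => F t - G t) (dF - dG).
Proof. by move=> ? ?; exact: is_deriveB. Qed.

Lemma derM F G x dF dG : is_derive x 1 F dF -> is_derive x 1 G dG ->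
  is_derive x 1 (fun t => F t * G t) (dF * G x + F x * dG).
Proof.
move=> DF DG; have := @is_deriveM _ _ F G x 1 dF dG DF DG.
have -> // : F x *: dG + G x *: dF = dF * G x + F x * dG.
by rewrite addrC; congr (_ + _); rewrite [LHS]mulrC.
Qed.

Lemma der_comp F G x dF dG : is_derive (G x) 1 F dF -> is_derive x 1 G dG ->
  is_derive x 1 (fun t => F (G t)) (dF * dG).
Proof. by move=> ? ?; exact: is_derive1_comp. Qed.

Lemma der_cst (c x : R) : is_derive x 1 (fun=> c) 0.
Proof. exact: is_derive_cst. Qed.

Lemma der_id x : is_derive x 1 (fun t => t) 1.
Proof. exact: is_derive_id. Qed.

Lemma der_eq F x d d' : is_derive x 1 F d -> d = d' -> is_derive x 1 F d'.
Proof. by move=> ? <-. Qed.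

Lemma der_continuous F G : (forall x, is_derive x 1 F (G x)) -> continuous F.
Proof.
by move=> DF x; apply: differentiable_continuous; apply/derivable1_diffP; case: (DF x).
Qed.

End calculus.

(** * Integration over boxes and slabs *)

Section C1_box.
Context {R : realType}.
Notation L1 := (@lebesgue_measure R).
Implicit Types (v : plane R).

(** The boundary of [box N] belongs to this set, so functions vanishing on it leave no boundary
    terms when their partial derivatives are integrated over the box. *)
Definition off (N : R) v := N <= `|v.1| \/ N <= `|v.2|.

Lemma off_box N v : ~ box N v -> off N v.
Proof.
move=> bv; have [v1|v1] := leP N `|v.1|; first by left.
have [v2|v2] := leP N `|v.2|; first by right.
by exfalso; apply: bv; rewrite /box/= !in_itv/= -!ler_norml !ltW.
Qed.

(* P and Q are the partial derivatives of F, which is supported in box N. *)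
Definition C1box (N : R) (F P Q : plane R -> R) :=
  [/\ forall v, is_derive v.1 1 (fun x => F (x, v.2)) (P v),
      forall v, is_derive v.2 1 (fun z => F (v.1, z)) (Q v),
      [/\ continuous F, continuous P & continuous Q] &
      forall v, off N v -> [/\ F v = 0, P v = 0 & Q v = 0]].

Lemma bdm_continuous_plane N (F : plane R -> R) : continuous F -> bdm (box N) F.
Proof.
move=> cF; split; first by apply: measurable_funTS; exact: plane_continuous_measurable.
have /compact_bounded[M [_ FM]] : compact (F @` box N).
  by apply: continuous_compact; [exact: continuous_subspaceT|exact: compact_box].
exists (M + 1) => v bv; apply: (FM (M + 1)); [by rewrite ltrDl ltr01|by exists v].
Qed.

(** The factor [0, 1] is the range of the parameter interpolating between two graphs, not a
    coordinate of H. *)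
Definition slab (N : R) : set (heis R) := box N `*` `[0, 1]%classic.

Lemma compact_slab N : compact (slab N).
Proof. by apply: compact_setX; [exact: compact_box|exact: segment_compact]. Qed.

Lemma measurable_slab N : measurable (slab N).
Proof. by apply: measurableX; [exact: measurable_box|exact: measurable_itv]. Qed.

Lemma itv01_fin : (L1 `[0%R, 1%R]%classic < +oo)%E.
Proof. by rewrite lebesgue_measure_itv/=; case: ifP => _; rewrite ?ltry// -EFinB ltry. Qed.

Lemma slab_fin N : (leb3 (slab N) < +oo)%E.
Proof.
exact: (@rect_fin _ _ _ _ _ (@sleb2 R) L1 (box N) `[0, 1]%classic
  (measurable_box N) (measurable_itv _) (box_fin N) itv01_fin).
Qed.

Lemma bdm_continuous_slab N (F : heis R -> R) : continuous F -> bdm (slab N) F.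
Proof.
move=> cF; split; first by apply: measurable_funTS; exact: heis_continuous_measurable.
have /compact_bounded[M [_ FM]] : compact (F @` slab N).
  by apply: continuous_compact; [exact: continuous_subspaceT|exact: compact_slab].
exists (M + 1) => v bv; apply: (FM (M + 1)); [by rewrite ltrDl ltr01|by exists v].
Qed.

Lemma slab_Fubini1 N (F : heis R -> R) : bdm (slab N) F ->
  \int[leb3]_(p in slab N) F p =
  \int[leb2]_(v in box N) \int[L1]_(t in `[0, 1]) F (v, t).
Proof.
move=> bF; exact: (@rect_Fubini1 _ _ _ _ _ (@sleb2 R) L1 (box N) `[0, 1]%classic F
  (measurable_box N) (measurable_itv _) (box_fin N) itv01_fin bF).
Qed.

Lemma slab_Fubini2 N (F : heis R -> R) : bdm (slab N) F ->
  \int[leb3]_(p in slab N) F p =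
  \int[L1]_(t in `[0, 1]) \int[leb2]_(v in box N) F (v, t).
Proof.
move=> bF; exact: (@rect_Fubini2 _ _ _ _ _ (@sleb2 R) L1 (box N) `[0, 1]%classic F
  (measurable_box N) (measurable_itv _) (box_fin N) itv01_fin bF).
Qed.

Lemma continuous_pair (T U V : topologicalType) (f : T -> U) (g : T -> V) :
  continuous f -> continuous g -> continuous (fun x => (f x, g x)).
Proof.
move=> cf cg x.
exact: (@cvg_pair _ _ _ (nbhs x) (nbhs (f x)) (nbhs (g x)) _ _ _ f g (cf x) (cg x)).
Qed.

Lemma plane_slice1 (F : plane R -> R) z : continuous F -> continuous (fun x => F (x, z)).
Proof.
move=> cF x; apply: (@continuous_comp _ _ _ (fun x : R => (x, z)) F); last exact: cF.
by apply: continuous_pair => y; [exact: cvg_id|exact: cvg_cst].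
Qed.

Lemma plane_slice2 (F : plane R -> R) x : continuous F -> continuous (fun z => F (x, z)).
Proof.
move=> cF z; apply: (@continuous_comp _ _ _ (fun z : R => (x, z)) F); last exact: cF.
by apply: continuous_pair => y; [exact: cvg_cst|exact: cvg_id].
Qed.

Lemma C1box_int1 (N : R) F P Q : 0 < N -> C1box N F P Q -> \int[leb2]_(v in box N) P v = 0.
Proof.
move=> N0 [F1 F2 [cF cP cQ] out].
rewrite box_Fubini2; last exact: bdm_continuous_plane.
rewrite (@eq_Rintegral _ _ _ L1 _ (fun=> 0)) ?Rintegral_cst ?mul0r// => z _.
rewrite (@Rintegral_derive _ (fun x => F (x, z)) (fun x => P (x, z)) _ _ _
  (fun x => F1 (x, z)) (plane_slice1 cP)); last lra.
have [-> _ _] := out (N, z) (or_introl (ler_norm _)).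
by have [|-> _ _] := out (- N, z); rewrite ?subrr//; left; rewrite /= normrN ler_norm.
Qed.

Lemma C1box_int2 (N : R) F P Q : 0 < N -> C1box N F P Q -> \int[leb2]_(v in box N) Q v = 0.
Proof.
move=> N0 [F1 F2 [cF cP cQ] out].
rewrite box_Fubini1; last exact: bdm_continuous_plane.
rewrite (@eq_Rintegral _ _ _ L1 _ (fun=> 0)) ?Rintegral_cst ?mul0r// => x _.
rewrite (@Rintegral_derive _ (fun z => F (x, z)) (fun z => Q (x, z)) _ _ _
  (fun z => F2 (x, z)) (plane_slice2 cQ)); last lra.
have [-> _ _] := out (x, N) (or_intror (ler_norm _)).
by have [|-> _ _] := out (x, - N); rewrite ?subrr//; right; rewrite /= normrN ler_norm.
Qed.

Lemma C1boxM (N : R) F P Q a a1 a2 : C1box N F P Q ->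
  (forall v, is_derive v.1 1 (fun x => a (x, v.2)) (a1 v)) ->
  (forall v, is_derive v.2 1 (fun z => a (v.1, z)) (a2 v)) ->
  continuous a -> continuous a1 -> continuous a2 ->
  C1box N (fun v => F v * a v) (fun v => P v * a v + F v * a1 v) (fun v => Q v * a v + F v * a2 v).
Proof.
move=> [F1 F2 [cF cP cQ] out] da1 da2 ca ca1 ca2; split.
- by move=> v; have := derM (F1 v) (da1 v); case: v.
- by move=> v; have := derM (F2 v) (da2 v); case: v.
- split=> v; [|apply: cvgD|apply: cvgD]; apply: cvgM;
    [exact: cF|exact: ca|exact: cP|exact: ca|exact: cF|exact: ca1|exact: cQ|exact: ca|exact: cF|exact: ca2].
- by move=> v /out[-> -> ->]; rewrite !mul0r addr0.
Qed.

End C1_box.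

Section bounded_integrals.
Context d (T : measurableType d) (R : realType) (mu : {measure set T -> \bar R}) (D : set T).
Hypotheses (mD : measurable D) (muD : (mu D < +oo)%E).

Lemma bdm_norm (F : T -> R) : bdm D F -> bdm D (fun x => `|F x|).
Proof.
move=> [mF [M FM]]; split; first exact: measurableT_comp.
by exists M => x Dx; rewrite normr_id FM.
Qed.

Lemma RintegralM_le (F H : T -> R) (B : R) : bdm D F -> bdm D H ->
  (forall x, D x -> `|H x| <= B) ->
  `|\int[mu]_(x in D) (F x * H x)| <= B * \int[mu]_(x in D) `|F x|.
Proof.
move=> bF bH HB; have bFH := bdmM bF bH; have bnF := bdm_norm bF.
rewrite (le_trans (le_normr_Rintegral _ (bdm_integrable mD muD bFH)))//.
rewrite -RintegralZl//; last exact: bdm_integrable.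
apply: le_Rintegral => //.
- by apply: bdm_integrable => //; exact: bdm_norm.
- by apply: bdm_integrable => //; apply: bdmM => //; exact: bdm_cst.
- by move=> x Dx; rewrite normrM mulrC ler_wpM2r// HB.
Qed.

Lemma Rintegral_norm_cvg0 (F_ : nat -> T -> R) (F : T -> R) (K : R) :
  (forall n, measurable_fun D (F_ n)) -> measurable_fun D F ->
  (forall n x, D x -> `|F_ n x| <= K) -> (forall x, D x -> `|F x| <= K) ->
  (forall x, D x -> F_ ^~ x @ \oo --> F x) ->
  (fun n => \int[mu]_(x in D) `|F_ n x - F x|) @ \oo --> 0.
Proof.
move=> mF_ mF FK FK' cF.
rewrite [X in _ --> X](_ : 0 = \int[mu]_(x in D) (cst 0 x)); last first.
  by rewrite Rintegral_cst// mul0r.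
apply: (@bounded_convergence _ T R mu D mD muD _ _ (K + K)) => //.
- by move=> n; apply: measurableT_comp => //; exact: measurable_funB.
- by move=> n x Dx; rewrite normr_id (le_trans (ler_normB _ _))// lerD ?FK ?FK'.
- move=> x Dx; rewrite -(@normr0 _ R); apply: cvg_norm.
  rewrite /= -[X in _ --> X](subrr (F x)); apply: cvgB; [exact: cF|exact: cvg_cst].
Qed.

Lemma bounded_cvg_bound (F_ : nat -> T -> R) (F : T -> R) (K : R) :
  (forall n x, D x -> `|F_ n x| <= K) ->
  (forall x, D x -> F_ ^~ x @ \oo --> F x) -> forall x, D x -> `|F x| <= K.
Proof.
move=> FK cF x Dx; have cn : (fun n => `|F_ n x|) @ \oo --> `|F x| by apply: cvg_norm; exact: cF.
rewrite -(cvg_lim _ cn)//; apply: limr_le; first by apply/cvg_ex; exists `|F x|.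
by apply: nearW => n; exact: FK.
Qed.

End bounded_integrals.

(** * The divergence identity *)

Section weak_limit.
Context {R : realType}.
Variables (N L C G : R) (f g : plane R -> R).
Hypotheses (N0 : 0 < N) (NL : L = N + 1) (C0 : 0 <= C) (G0 : 0 <= G).
Hypotheses (cf : continuous f) (mg : measurable_fun setT g) (gG : forall v, `|g v| <= G)
  (fg : weak_gradient f g).
Hypothesis fC : forall s v w, 0 <= s -> box L v -> box L w ->
  `|w.1 - v.1| <= s ^+ 2 -> `|w.2 - v.2| <= s ^+ 2 -> `|f w - f v| <= C * s.

Definition sc (n : nat) : R := n.+1%:R^-1.

Lemma sc_gt0 n : 0 < sc n. Proof. by rewrite invr_gt0. Qed.

Lemma sc_le1 n : sc n <= 1. Proof. by rewrite invf_le1// ler1n. Qed.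

Lemma sc_cvg0 : sc @ \oo --> 0.
Proof. exact: cvg_harmonic. Qed.

Let bfL : bdm (box L) f. Proof. exact: bdm_continuous_plane. Qed.
Let mB := @measurable_box R N.
Let fB := @box_fin R N.
Let bgN : bdm (box N) g. Proof. by split; [exact: measurable_funTS|exists G]. Qed.

Let a n := moll L f (sc n).
Let a1 n := moll1 L f (sc n).
Let a2 n := moll2 L f (sc n).
Let Ga n := moll_grad L f (sc n).

Let ca n : continuous (a n). Proof. exact: moll_continuous (sc_gt0 n). Qed.
Let ca1 n : continuous (a1 n). Proof. exact: moll1_continuous (sc_gt0 n). Qed.
Let ca2 n : continuous (a2 n). Proof. exact: moll2_continuous (sc_gt0 n). Qed.

Lemma moll_grad_continuous n : continuous (Ga n).
Proof. by move=> v; apply: cvgB; [exact: ca1|apply: cvgM; [exact: ca|exact: ca2]]. Qed.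

Lemma moll_cvg v : box N v -> (fun n => moll L f (sc n) v) @ \oo --> f v.
Proof.
move=> Nv; apply/cvgrPdist_le => /= eps eps0.
have /cvgrPdist_le/(_ (eps / (16 * C + 1)))/= : sc @ \oo --> 0 by exact: sc_cvg0.
rewrite divr_gt0 ?ltr_wpDl ?mulr_ge0// => /(_ isT); apply: filterS => n.
rewrite sub0r normrN gtr0_norm ?sc_gt0// ler_pdivlMr ?ltr_wpDl ?mulr_ge0// => h.
rewrite distrC (le_trans (moll_dist NL C0 bfL fC (sc_gt0 n) (sc_le1 n) Nv))//.
by apply: le_trans h; rewrite mulrC ler_wpM2l ?(ltW (sc_gt0 n))// lerDl.
Qed.

Let GaB n v : box N v -> `|Ga n v| <= 16 * G + 16 * (17 * C) ^+ 2.
Proof. move=> Nv; exact: (moll_grad_bound NL C0 G0 bfL mg gG fg fC (sc_gt0 n) (sc_le1 n) Nv). Qed.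

(** A fixed C^1 weight can take over the derivatives: the integrals of d_x (k a) and d_zeta (k a^2 /
    2) vanish, what is left involves [a] but not its derivatives, and [a] converges boundedly to
    [f]. The limit is the weak equation for [g] tested with [k]. *)
Lemma moll_grad_test k P Q : C1box N k P Q ->
  (fun n => \int[leb2]_(v in box N) (k v * Ga n v)) @ \oo -->
  \int[leb2]_(v in box N) (k v * g v).
Proof.
move=> kC1; have [k1 k2 [ck cP cQ] out] := kC1.
have bk := @bdm_continuous_plane _ N _ ck; have bP := @bdm_continuous_plane _ N _ cP.
have bQ := @bdm_continuous_plane _ N _ cQ; have bf := @bdm_continuous_plane _ N _ cf.
have -> : \int[leb2]_(v in box N) (k v * g v) =
    \int[leb2]_(v in box N) (- f v * P v + f v ^+ 2 / 2 * Q v).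
  rewrite -(weak_gradient_box fg bf bgN k1 k2)//; first by apply: eq_Rintegral => v _; rewrite mulrC.
  by move=> v /off_box /out.
have ba n := @bdm_continuous_plane _ N _ (@ca n).
have E n : \int[leb2]_(v in box N) (k v * Ga n v) =
    \int[leb2]_(v in box N) (- a n v * P v + a n v ^+ 2 / 2 * Q v).
  have da1 := is_derive_moll1 bfL (sc_gt0 n); have da2 := is_derive_moll2 bfL (sc_gt0 n).
  have ka := C1boxM kC1 da1 da2 (@ca n) (@ca1 n) (@ca2 n).
  have kaa := C1boxM ka da1 da2 (@ca n) (@ca1 n) (@ca2 n).
  have i1 := C1box_int1 N0 ka; have i2 := C1box_int2 N0 kaa.
  have b1 : bdm (box N) (fun v => P v * a n v + k v * a1 n v).
    by case: ka => _ _ [_ c _] _; exact: bdm_continuous_plane.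
  have b2 : bdm (box N) (fun v => (Q v * a n v + k v * a2 n v) * a n v + k v * a n v * a2 n v).
    by case: kaa => _ _ [_ _ c] _; exact: bdm_continuous_plane.
  have b2' : bdm (box N) (fun v => 2^-1 * ((Q v * a n v + k v * a2 n v) * a n v + k v * a n v * a2 n v)).
    by apply: bdmM => //; exact: bdm_cst.
  have b3 : bdm (box N) (fun v => - a n v * P v + a n v ^+ 2 / 2 * Q v).
    apply: bdmD; first by apply: bdmM => //; exact: bdmN.
    by apply: bdmM => //; apply: bdmM; [exact: bdmX|exact: bdm_cst].
  rewrite -[RHS]addr0 -{1}i1 -(IntD (L := N))//.
  rewrite -[RHS]subr0 -[X in _ - X](mulr0 2^-1) -{1}i2 -(IntZ (L := N))// -(IntB (L := N))//; last exact: bdmD.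
  by apply: eq_Rintegral => v _; rewrite /Ga /moll_grad -/(a n v) -/(a1 n v) -/(a2 n v); field.
under eq_fun do rewrite E.
have [M fM] : exists M, forall v, box N v -> `|f v| <= M by case: bf.
have [MP PM] : exists M, forall v, box N v -> `|P v| <= M by case: bP.
have [MQ QM] : exists M, forall v, box N v -> `|Q v| <= M by case: bQ.
pose M' := M + 16 * C.
have aM n v : box N v -> `|a n v| <= M'.
  move=> Nv; have -> : a n v = f v + (a n v - f v) by ring.
  rewrite (le_trans (ler_normD _ _))// lerD ?fM//.
  rewrite (le_trans (moll_dist NL C0 bfL fC (sc_gt0 n) (sc_le1 n) Nv))//.
  by rewrite ler_piMr ?sc_le1// mulr_ge0.
apply: (@bounded_convergence _ _ R leb2 _ mB fB _ _ (M' * MP + M' ^+ 2 / 2 * MQ)).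
- move=> n; have c : continuous (fun v => - a n v * P v + a n v ^+ 2 / 2 * Q v).
    move=> v; apply: cvgD; apply: cvgM; [apply: cvgN; exact: ca|exact: cP| |exact: cQ].
    by apply: cvgM; [apply: cvgM; exact: ca|exact: cvg_cst].
  by case: (@bdm_continuous_plane _ N _ c).
- have c : continuous (fun v => - f v * P v + f v ^+ 2 / 2 * Q v).
    move=> v; apply: cvgD; apply: cvgM; [apply: cvgN; exact: cf|exact: cP| |exact: cQ].
    by apply: cvgM; [apply: cvgM; exact: cf|exact: cvg_cst].
  by case: (@bdm_continuous_plane _ N _ c).
- move=> n v Nv; rewrite (le_trans (ler_normD _ _))// !normrM normrN expr2.
  rewrite [`|2^-1|]ger0_norm ?invr_ge0//.
  apply: lerD; apply: ler_pM => //; [exact: aM|exact: PM| |exact: QM].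
  by rewrite ler_wpM2r ?invr_ge0// ler_pM// aM.
- move=> v Nv; apply: cvgD; apply: cvgM; try exact: cvg_cst.
    by apply: cvgN; exact: moll_cvg.
  apply: cvgM; last exact: cvg_cst.
  by apply: cvgM; exact: moll_cvg.
Qed.

(** The weights needed later contain the cut-off and so change with n. They converge in L^1 by
    bounded convergence while the gradients stay bounded, so the weight can be frozen at a late
    index [J], where [moll_grad_test] applies. *)
Lemma moll_grad_weak_cvg (k_ P_ Q_ : nat -> plane R -> R) (k : plane R -> R) (K : R) :
  (forall n, C1box N (k_ n) (P_ n) (Q_ n)) ->
  (forall n v, box N v -> `|k_ n v| <= K) ->
  (forall v, box N v -> k_ ^~ v @ \oo --> k v) ->
  (fun n => \int[leb2]_(v in box N) (k_ n v * Ga n v)) @ \oo -->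
  \int[leb2]_(v in box N) (k v * g v).
Proof.
move=> kC1 kK ck.
have bk_ n : bdm (box N) (k_ n).
  by case: (kC1 n) => _ _ [c _ _] _; exact: bdm_continuous_plane.
have mk : measurable_fun (box N) k.
  by apply: (measurable_fun_cvg (h := k_)) => // n; case: (bk_ n).
have kK' := bounded_cvg_bound kK ck.
have bk : bdm (box N) k by split => //; exists K.
pose A n := \int[leb2]_(v in box N) `|k_ n v - k v|.
have A0 : A @ \oo --> 0.
  apply: (@Rintegral_norm_cvg0 _ _ R leb2 _ mB fB k_ k K) => // n.
  by case: (bk_ n).
pose G' := 16 * G + 16 * (17 * C) ^+ 2.
have G'0 : 0 <= G' by rewrite addr_ge0 ?mulr_ge0// ?sqr_ge0.
have bGa n : bdm (box N) (Ga n) by apply: bdm_continuous_plane; exact: moll_grad_continuous.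
apply/cvgrPdist_le => /= eps eps0.
(* Freezing the weight costs three L^1 errors, against two mollified gradients bounded by [G'] and
   one [g] bounded by [G]. *)
pose eta := eps / (2 * (2 * G' + G + 1)).
have eta0 : 0 < eta by rewrite divr_gt0// mulr_gt0// ltr_wpDl// addr_ge0// mulr_ge0.
move/cvgrPdist_le : A0 => /(_ _ eta0)/= [J _ AJ].
have {}AJ j : (J <= j)%N -> A j <= eta.
  by move=> /AJ /=; rewrite sub0r normrN; apply: le_trans; rewrite ler_norm.
have /cvgrPdist_le/(_ (eps / 2))/= := moll_grad_test (kC1 J).
rewrite divr_gt0// => /(_ isT) [n1 _ Hn1].
exists (maxn J n1) => // n /=; rewrite geq_max => /andP[Jn n1n].
have b1 : bdm (box N) (fun v => k_ n v - k v) by exact: bdmB.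
have b2 : bdm (box N) (fun v => k_ J v - k v) by exact: bdmB.
have E : \int[leb2]_(v in box N) (k v * g v) - \int[leb2]_(v in box N) (k_ n v * Ga n v) =
  (\int[leb2]_(v in box N) (k_ J v * g v) - \int[leb2]_(v in box N) (k_ J v * Ga n v))
  - \int[leb2]_(v in box N) ((k_ n v - k v) * Ga n v)
  + \int[leb2]_(v in box N) ((k_ J v - k v) * Ga n v)
  - \int[leb2]_(v in box N) ((k_ J v - k v) * g v).
  have i1 F : bdm (box N) F -> \int[leb2]_(v in box N) ((F v - k v) * Ga n v) =
      \int[leb2]_(v in box N) (F v * Ga n v) - \int[leb2]_(v in box N) (k v * Ga n v).
    move=> bF; rewrite -(IntB (L := N)); [|exact: bdmM|exact: bdmM].
    by apply: eq_Rintegral => v _; ring.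
  have i2 : \int[leb2]_(v in box N) ((k_ J v - k v) * g v) =
      \int[leb2]_(v in box N) (k_ J v * g v) - \int[leb2]_(v in box N) (k v * g v).
    rewrite -(IntB (L := N)); [|exact: bdmM|exact: bdmM].
    by apply: eq_Rintegral => v _; ring.
  by rewrite !i1// i2; ring.
have l1 := le_trans (@RintegralM_le _ _ R leb2 _ mB fB _ _ _ b1 (bGa n) (GaB n)) (ler_wpM2l G'0 (AJ n Jn)).
have l2 := le_trans (@RintegralM_le _ _ R leb2 _ mB fB _ _ _ b2 (bGa n) (GaB n)) (ler_wpM2l G'0 (AJ J (leqnn _))).
have l3 := le_trans (@RintegralM_le _ _ R leb2 _ mB fB _ _ _ b2 bgN (fun v _ => gG v)) (ler_wpM2l G0 (AJ J (leqnn _))).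
have l4 := Hn1 _ n1n.
have e1 : G' * eta + G' * eta + G * eta <= eps / 2.
  have -> : eps / 2 = (2 * G' + G + 1) * eta.
    by rewrite /eta; field; rewrite gt_eqF// ltr_wpDl// addr_ge0// mulr_ge0.
  clearbody eta G'; rewrite -subr_ge0 (_ : _ - _ = eta); [exact: ltW|by ring].
rewrite E (le_trans (ler_normB _ _))//.
have -> : eps = eps / 2 + (eps / 2) by field.
apply: le_trans (lerD (ler_normD _ _) l3) _.
apply: le_trans (lerD (lerD (ler_normB _ _) l2) (lexx _)) _.
apply: le_trans (lerD (lerD (lerD l4 l1) (lexx _)) (lexx _)) _.
by lra.
Qed.

End weak_limit.

Section continuity.
Context {R : realType} {T : topologicalType}.
Implicit Types F G : T -> R.

Lemma contD F G : continuous F -> continuous G -> continuous (fun x => F x + G x).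
Proof. by move=> cF cG x; apply: cvgD; [exact: cF|exact: cG]. Qed.

Lemma contB F G : continuous F -> continuous G -> continuous (fun x => F x - G x).
Proof. by move=> cF cG x; apply: cvgB; [exact: cF|exact: cG]. Qed.

Lemma contM F G : continuous F -> continuous G -> continuous (fun x => F x * G x).
Proof. by move=> cF cG x; apply: cvgM; [exact: cF|exact: cG]. Qed.

Lemma contComp (U V : topologicalType) (F : T -> U) (G : U -> V) :
  continuous F -> continuous G -> continuous (fun x => G (F x)).
Proof. by move=> cF cG x; apply: continuous_comp; [exact: cF|exact: cG]. Qed.

End continuity.

Section testfun.
Context {R : realType}.
Notation L1 := (@lebesgue_measure R).
Implicit Types (v : plane R).

(* p1, p2, p3 are the partial derivatives of phi, in the form of the chain rules
   along graphs that the divergence argument needs. *)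
Definition testfun (N : R) (phi p1 p2 p3 : heis R -> R) :=
  [/\ [/\ continuous phi, continuous p1, continuous p2 & continuous p3],
   (forall (m : R -> R) (z x m' : R), is_derive x 1 m m' ->
     is_derive x 1 (fun t => phi (t, z, m t)) (p1 (x, z, m x) + p3 (x, z, m x) * m')),
   (forall (m : R -> R) (x z m' : R), is_derive z 1 m m' ->
     is_derive z 1 (fun t => phi (x, t, m t)) (p2 (x, z, m z) + p3 (x, z, m z) * m')),
   (forall v (t : R), is_derive t 1 (fun t => phi (v, t)) (p3 (v, t))) &
   forall v t, off N v -> [/\ phi (v, t) = 0, p1 (v, t) = 0, p2 (v, t) = 0 & p3 (v, t) = 0]].

(** * The identity between two smooth graphs *)

Section identity.
Variables (N : R) (phi p1 p2 p3 : heis R -> R) (a a1 a2 b b1 b2 : plane R -> R) (chi chi' : R -> R).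
Hypotheses (N0 : 0 < N) (tphi : testfun N phi p1 p2 p3).
Hypotheses (da1 : forall v, is_derive v.1 1 (fun x => a (x, v.2)) (a1 v))
  (da2 : forall v, is_derive v.2 1 (fun z => a (v.1, z)) (a2 v))
  (db1 : forall v, is_derive v.1 1 (fun x => b (x, v.2)) (b1 v))
  (db2 : forall v, is_derive v.2 1 (fun z => b (v.1, z)) (b2 v)).
Hypotheses (ca : continuous a) (ca1 : continuous a1) (ca2 : continuous a2)
  (cb : continuous b) (cb1 : continuous b1) (cb2 : continuous b2).
Hypotheses (dchi : forall x : R, is_derive x 1 chi (chi' x)) (cchi' : continuous chi').

Let cchi : continuous chi. Proof. exact: der_continuous dchi. Qed.

Let w v := b v - a v.
Let w1 v := b1 v - a1 v.
Let w2 v := b2 v - a2 v.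
Let m (t : R) v := a v + t * w v.
Let m1 (t : R) v := a1 v + t * w1 v.
Let m2 (t : R) v := a2 v + t * w2 v.
Let Ga v := a1 v - a v * a2 v.
Let Gb v := b1 v - b v * b2 v.

Let dw1 v : is_derive v.1 1 (fun x => w (x, v.2)) (w1 v). Proof. exact: derB. Qed.
Let dw2 v : is_derive v.2 1 (fun x => w (v.1, x)) (w2 v). Proof. exact: derB. Qed.
Let dm1 (t : R) v : is_derive v.1 1 (fun x => m t (x, v.2)) (m1 t v).
Proof. exact: derD. Qed.
Let dm2 (t : R) v : is_derive v.2 1 (fun x => m t (v.1, x)) (m2 t v).
Proof. exact: derD. Qed.

(** The factor [w] is the Jacobian of (v, t) -> (v, m t v). At fixed t the planar field (F, - m F)
    is supported in the box, so its divergence, written [T] below, has integral zero. *)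
Let F t v := chi (w v) * w v * phi (v, m t v).
Let F1 t v := (chi' (w v) * w1 v * w v + chi (w v) * w1 v) * phi (v, m t v)
  + chi (w v) * w v * (p1 (v, m t v) + p3 (v, m t v) * m1 t v).
Let F2 t v := (chi' (w v) * w2 v * w v + chi (w v) * w2 v) * phi (v, m t v)
  + chi (w v) * w v * (p2 (v, m t v) + p3 (v, m t v) * m2 t v).

Let cfst (k : plane R -> R) : continuous k -> continuous (fun p : heis R => k p.1).
Proof.
by move=> ck p; apply: (@continuous_comp _ _ _ fst k); [exact: cvg_fst|exact: ck].
Qed.

Let cw : continuous w. Proof. by move=> v; apply: cvgB; [exact: cb|exact: ca]. Qed.
Let cw1 : continuous w1. Proof. by move=> v; apply: cvgB; [exact: cb1|exact: ca1]. Qed.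
Let cw2 : continuous w2. Proof. by move=> v; apply: cvgB; [exact: cb2|exact: ca2]. Qed.

Let cm : continuous (fun p : heis R => m p.2 p.1).
Proof.
move=> p; apply: cvgD; first exact: cfst.
by apply: cvgM; [exact: cvg_snd|exact: (cfst cw)].
Qed.
Let cm1 : continuous (fun p : heis R => m1 p.2 p.1).
Proof.
move=> p; apply: cvgD; first exact: cfst.
by apply: cvgM; [exact: cvg_snd|exact: (cfst cw1)].
Qed.
Let cm2 : continuous (fun p : heis R => m2 p.2 p.1).
Proof.
move=> p; apply: cvgD; first exact: cfst.
by apply: cvgM; [exact: cvg_snd|exact: (cfst cw2)].
Qed.

Let cphim (psi : heis R -> R) : continuous psi ->
  continuous (fun p : heis R => psi (p.1, m p.2 p.1)).
Proof.
move=> cpsi p.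
have c : continuous (fun p : heis R => (p.1, m p.2 p.1)).
  have c1 : continuous (fun p : heis R => p.1) by move=> q; exact: cvg_fst.
  exact: (@continuous_pair (heis R) (plane R) R _ _ c1 cm).
by apply: (@continuous_comp _ _ _ (fun p : heis R => (p.1, m p.2 p.1)) psi); [exact: c|exact: cpsi].
Qed.

Let ccw (k : R -> R) : continuous k -> continuous (fun v => k (w v)).
Proof. by move=> ck v; apply: (@continuous_comp _ _ _ w k); [exact: cw|exact: ck]. Qed.

Let cchiw : continuous (fun p : heis R => chi (w p.1)).
Proof. exact: (cfst (ccw cchi)). Qed.
Let cchi'w : continuous (fun p : heis R => chi' (w p.1)).
Proof. exact: (cfst (ccw cchi')). Qed.

Let cp0 : continuous phi. Proof. by case: tphi => -[]. Qed.
Let cp1 : continuous p1. Proof. by case: tphi => -[]. Qed.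
Let cp2 : continuous p2. Proof. by case: tphi => -[]. Qed.
Let cp3 : continuous p3. Proof. by case: tphi => -[]. Qed.

Let X0 := cphim cp0.
Let X1 := cphim cp1.
Let X2 := cphim cp2.
Let X3 := cphim cp3.
Let W := cfst cw.
Let W1 := cfst cw1.
Let W2 := cfst cw2.

Let cF1 : continuous (fun p : heis R => F1 p.2 p.1).
Proof.
exact: (contD (contM (contD (contM (contM cchi'w W1) W) (contM cchiw W1)) X0)
  (contM (contM cchiw W) (contD X1 (contM X3 cm1)))).
Qed.
Let cF2 : continuous (fun p : heis R => F2 p.2 p.1).
Proof.
exact: (contD (contM (contD (contM (contM cchi'w W2) W) (contM cchiw W2)) X0)
  (contM (contM cchiw W) (contD X2 (contM X3 cm2)))).
Qed.
Let cF : continuous (fun p : heis R => F p.2 p.1).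
Proof. exact: (contM (contM cchiw W) X0). Qed.

Let slice (k : heis R -> R) (t : R) : continuous k -> continuous (fun v => k (v, t)).
Proof.
move=> ck v; apply: (@continuous_comp _ _ _ (fun v : plane R => (v, t)) k); last exact: ck.
by apply: continuous_pair => u; [exact: cvg_id|exact: cvg_cst].
Qed.

Let slice2 (k : heis R -> R) v : continuous k -> continuous (fun t => k (v, t)).
Proof.
move=> ck t; apply: (@continuous_comp _ _ _ (fun t : R => (v, t)) k); last exact: ck.
by apply: continuous_pair => u; [exact: cvg_cst|exact: cvg_id].
Qed.

Let FC1 t : C1box N (F t) (F1 t) (F2 t).
Proof.
have [_ h1 h2 _ out] := tphi; split.
- move=> v.
  have d1 := @der_comp _ chi (fun x => w (x, v.2)) v.1 _ _ (dchi _) (dw1 v).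
  have d2 := @derM _ (fun x => chi (w (x, v.2))) (fun x => w (x, v.2)) v.1 _ _ d1 (dw1 v).
  have := @derM _ _ (fun x => phi (x, v.2, m t (x, v.2))) v.1 _ _ d2 (h1 _ v.2 _ _ (dm1 t v)).
  by move=> hd; apply: (der_eq hd); rewrite /F1; case: (v).
- move=> v.
  have d1 := @der_comp _ chi (fun x => w (v.1, x)) v.2 _ _ (dchi _) (dw2 v).
  have d2 := @derM _ (fun x => chi (w (v.1, x))) (fun x => w (v.1, x)) v.2 _ _ d1 (dw2 v).
  have := @derM _ _ (fun x => phi (v.1, x, m t (v.1, x))) v.2 _ _ d2 (h2 _ v.1 _ _ (dm2 t v)).
  by move=> hd; apply: (der_eq hd); rewrite /F2; case: (v).
- by split; [exact: (@slice _ t cF)|exact: (@slice _ t cF1)|exact: (@slice _ t cF2)].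
- move=> v ov; rewrite /F /F1 /F2; have [-> -> -> ->] := out v (m t v) ov.
  by rewrite !mul0r !addr0 !mulr0 !addr0.
Qed.

(** The part of the divergence that is not a derivative in t: X phi times the Jacobian, and the term
    in which the cut-off is differentiated. *)
Definition bulk (p : heis R) := let v := p.1 in let t := p.2 in
  chi (w v) * w v * (p1 (v, m t v) - m t v * p2 (v, m t v))
  + chi' (w v) * w v * phi (v, m t v) * (w1 v - m t v * w2 v).

Lemma bulk_continuous : continuous bulk.
Proof.
exact: (contD (contM (contM cchiw W) (contB X1 (contM cm X2)))
  (contM (contM (contM cchi'w W) X0) (contB W1 (contM cm W2)))).
Qed.

Let T (p : heis R) := F1 p.2 p.1 - (F2 p.2 p.1 * m p.2 p.1 + F p.2 p.1 * m2 p.2 p.1).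

Let cT : continuous T.
Proof. exact: (contB cF1 (contD (contM cF2 cm) (contM cF cm2))). Qed.

Let int_T : \int[leb3]_(p in slab N) T p = 0.
Proof.
rewrite slab_Fubini2; last exact: bdm_continuous_slab.
rewrite (@eq_Rintegral _ _ _ L1 _ (fun=> 0)) ?Rintegral_cst ?mul0r// => t _.
have cmt := @slice _ t cm; have cm1t := @slice _ t cm1; have cm2t := @slice _ t cm2.
have C2 := C1boxM (FC1 t) (dm1 t) (dm2 t) cmt cm1t cm2t.
have := C1box_int1 N0 (FC1 t); have := C1box_int2 N0 C2.
move=> i2 i1; rewrite /T/= (IntB (L := N)).
- by rewrite i1 i2 subrr.
- by apply: bdm_continuous_plane; exact: (@slice _ t cF1).
- by apply: bdm_continuous_plane; case: C2 => _ _ [].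
Qed.

(** The polynomial in t is d_x m - m d_zeta m, the gradient of the interpolated graph. It is [Ga] at
    t = 0 and [Gb] at t = 1, so an exact t-derivative produces the two graph integrals. *)
Let H (v : plane R) (t : R) := ((1 - t) * Ga v + t * Gb v + t * (1 - t) * (w v * w2 v)) * phi (v, m t v).
Let H' (v : plane R) (t : R) :=
  (Gb v - Ga v + (1 - 2 * t) * (w v * w2 v)) * phi (v, m t v)
  + ((1 - t) * Ga v + t * Gb v + t * (1 - t) * (w v * w2 v)) * (p3 (v, m t v) * w v).

Let dH v (t : R) : is_derive t 1 (H v) (H' v t).
Proof.
have [_ _ _ h3 _] := tphi.
have d1 : is_derive t 1 (fun t => (1 - t) * Ga v + t * Gb v + t * (1 - t) * (w v * w2 v))
    (Gb v - Ga v + (1 - 2 * t) * (w v * w2 v)).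
  have dt := derB (der_cst 1 t) (der_id t).
  have := derD (derD (derM dt (der_cst (Ga v) t)) (derM (der_id t) (der_cst (Gb v) t)))
    (derM (derM (der_id t) dt) (der_cst (w v * w2 v) t)).
  by move=> hd; apply: (der_eq hd); ring.
have dm : is_derive t 1 (fun t => m t v) (w v).
  have := derD (der_cst (a v) t) (derM (der_id t) (der_cst (w v) t)).
  by move=> hd; apply: (der_eq hd); ring.
have d2 := @der_comp _ (fun s => phi (v, s)) (fun t => m t v) t _ _ (h3 v (m t v)) dm.
exact: (derM d1 d2).
Qed.

Let chiH' (p : heis R) := chi (w p.1) * H' p.1 p.2.

Let cchiH' : continuous chiH'.
Proof.
have ct : continuous (fun p : heis R => p.2) by move=> p; exact: cvg_snd.
have c1 : continuous (fun _ : heis R => 1 : R) by move=> p; exact: cvg_cst.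
have c2 : continuous (fun _ : heis R => 2 : R) by move=> p; exact: cvg_cst.
have c1t := contB c1 ct.
have GaC := contB (cfst ca1) (contM (cfst ca) (cfst ca2)).
have GbC := contB (cfst cb1) (contM (cfst cb) (cfst cb2)).
have ww2 := contM W W2.
exact: (contM cchiw (contD
  (contM (contD (contB GbC GaC) (contM (contB c1 (contM c2 ct)) ww2)) X0)
  (contM (contD (contD (contM c1t GaC) (contM ct GbC)) (contM (contM ct c1t) ww2)) (contM X3 W)))).
Qed.

Let TE p : T p = chiH' p + bulk p.
Proof.
rewrite /T /chiH' /H' /bulk /F /F1 /F2 /=.
have -> : w2 p.1 = b2 p.1 - a2 p.1 by [].
have -> : Gb p.1 = (a1 p.1 + w1 p.1) - (a p.1 + w p.1) * b2 p.1.
  by rewrite /Gb /w /w1; ring.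
rewrite /m1 /m2 /Ga -/(w2 _).
have -> : w2 p.1 = b2 p.1 - a2 p.1 by [].
rewrite /m; ring.
Qed.

(** The divergence integrates to zero on every slice t = const; integrating its exact part in t
    along fibres instead leaves the values at t = 0 and t = 1. *)
Lemma smooth_identity :
  \int[leb2]_(v in box N) (chi (w v) * phi (v, b v) * Gb v) -
  \int[leb2]_(v in box N) (chi (w v) * phi (v, a v) * Ga v) +
  \int[leb3]_(p in slab N) bulk p = 0.
Proof.
have bH := bdm_continuous_slab N cchiH'; have bB := bdm_continuous_slab N bulk_continuous.
have mS := measurable_slab N; have fS := slab_fin N.
have <- : \int[leb3]_(p in slab N) chiH' p + \int[leb3]_(p in slab N) bulk p = 0.
  rewrite -int_T -RintegralD//; [|exact: bdm_integrable|exact: bdm_integrable].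
  by apply: eq_Rintegral => p _; rewrite TE.
congr (_ + _); rewrite slab_Fubini1//.
have ck (u u1 u2 : plane R -> R) : continuous u -> continuous u1 -> continuous u2 ->
    bdm (box N) (fun v => chi (w v) * phi (v, u v) * (u1 v - u v * u2 v)).
  move=> cu cu1 cu2; apply: bdm_continuous_plane => v; apply: cvgM; last first.
    by apply: cvgB; [exact: cu1|apply: cvgM; [exact: cu|exact: cu2]].
  apply: cvgM; first by apply: (@continuous_comp _ _ _ w chi); [exact: cw|exact: cchi].
  apply: (@continuous_comp _ _ _ (fun v => (v, u v)) phi); last exact: cp0.
  by apply: continuous_pair => // y; exact: cvg_id.
rewrite -(IntB (L := N)); [|exact: ck|exact: ck].
apply: eq_Rintegral => v _.
have cH' : continuous (fun t => chi (w v) * H' v t) by exact: (@slice2 _ v cchiH').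
have D (t : R) : is_derive t 1 (fun t => chi (w v) * H v t) (chi (w v) * H' v t).
  by apply: der_eq (derM (der_cst _ t) (dH v t)) _; rewrite mul0r add0r.
rewrite /chiH'/= (@Rintegral_derive _ _ _ 0 1 ltr01 D cH').
rewrite /H; have -> : m 0 v = a v by rewrite /m mul0r addr0.
have -> : m 1 v = b v by rewrite /m mul1r /w; ring.
by rewrite /Gb /Ga; ring.
Qed.

End identity.

End testfun.

(** * Passage to the limit between two intrinsic graphs *)

Section key.
Context {R : realType}.
Implicit Types (v : plane R).
Variables (N L C G : R) (f h gf gh : plane R -> R) (phi p1 p2 p3 : heis R -> R).
Hypotheses (N0 : 0 < N) (NL : L = N + 1) (C0 : 0 <= C) (G0 : 0 <= G).
Hypotheses (cf : continuous f) (ch : continuous h)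
  (mgf : measurable_fun setT gf) (mgh : measurable_fun setT gh)
  (gfG : forall v, `|gf v| <= G) (ghG : forall v, `|gh v| <= G)
  (fgf : weak_gradient f gf) (hgh : weak_gradient h gh).
Hypotheses (fC : forall s v w, 0 <= s -> box L v -> box L w ->
  `|w.1 - v.1| <= s ^+ 2 -> `|w.2 - v.2| <= s ^+ 2 -> `|f w - f v| <= C * s)
  (hC : forall s v w, 0 <= s -> box L v -> box L w ->
  `|w.1 - v.1| <= s ^+ 2 -> `|w.2 - v.2| <= s ^+ 2 -> `|h w - h v| <= C * s).
Hypothesis tphi : testfun N phi p1 p2 p3.

(** Where h <= f, the difference of the mollifications can still reach 2 * 16 C s. The shift [K]
    makes the cut-off vanish up to 32 C s, the extra 2 exceeding the half-width 3 / 2 of the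
    transition of [spline3]. *)
Let K := 32 * C + 2.
Let s (n : nat) : R := sc n.
Let s0 n : 0 < s n := sc_gt0 n.
Let s1 n : s n <= 1 := sc_le1 n.
Let K0 : 0 <= K. Proof. by rewrite addr_ge0// mulr_ge0. Qed.

Let chi n (x : R) := spline3 (x / s n - K).
Let chi' n (x : R) := spline2 (x / s n - K) / s n.

Let dchi n (x : R) : is_derive x 1 (chi n) (chi' n x).
Proof.
apply: (@der_comp _ spline3 (fun x => x / s n - K) x); first exact: is_derive_spline3.
have := derB (derM (der_id x) (der_cst (s n)^-1 x)) (der_cst K x).
by move=> hd; apply: (der_eq hd); ring.
Qed.

Let cchi' n : continuous (chi' n).
Proof.
have ks : kern (@spline2 R).
  split; first by exists 1 => t; have /andP[? ?] := spline2_bound t; rewrite ger0_norm.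
  by exists 5 => t e; exact: spline2_lip.
have cs := kern_continuous ks.
have cc (c : R) : continuous (fun _ : R => c) by move=> x; exact: cvg_cst.
have ci : continuous (fun x : R => x) by move=> x; exact: cvg_id.
have cl := contB (contM ci (cc (s n)^-1)) (cc K).
have c2 := contComp cl cs.
exact: (contM c2 (cc (s n)^-1)).
Qed.

Let chi0 n x : x <= 32 * C * s n -> chi n x = 0 /\ chi' n x = 0.
Proof.
move=> xs; have xK : x / s n - K <= - 2.
  by rewrite /K opprD addrA lerBlDr addNr subr_le0 ler_pdivrMr.
split; first by rewrite /chi spline3_le//; lra.
rewrite /chi' spline2_out ?mul0r// ler_normr; apply/orP; right; lra.
Qed.

Let chi1 n x : (K + 2) * s n <= x -> chi n x = 1 /\ chi' n x = 0.
Proof.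
move=> xs; have xK : 2 <= x / s n - K by rewrite lerBrDr ler_pdivlMr// addrC.
split; first by rewrite /chi spline3_ge//; lra.
rewrite /chi' spline2_out ?mul0r// ler_normr; apply/orP; left; lra.
Qed.

Let chi_bound n x : `|chi n x| <= 1.
Proof. by have /andP[? ?] := spline3_bound (x / s n - K); rewrite /chi ger0_norm. Qed.

Let chi'_bound n x : `|chi' n x| <= (s n)^-1.
Proof.
have /andP[? ?] := spline2_bound (x / s n - K).
rewrite /chi' normrM normfV (gtr0_norm (s0 n)); apply: ler_piMl; first by rewrite invr_ge0 ltW.
by rewrite ger0_norm.
Qed.

Let a n := moll L f (s n).
Let a1 n := moll1 L f (s n).
Let a2 n := moll2 L f (s n).
Let b n := moll L h (s n).
Let b1 n := moll1 L h (s n).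
Let b2 n := moll2 L h (s n).
Let w n v := b n v - a n v.

Let bfL : bdm (box L) f. Proof. exact: bdm_continuous_plane. Qed.
Let bhL : bdm (box L) h. Proof. exact: bdm_continuous_plane. Qed.

Let ca n : continuous (a n). Proof. exact: moll_continuous (s0 n). Qed.
Let ca1 n : continuous (a1 n). Proof. exact: moll1_continuous (s0 n). Qed.
Let ca2 n : continuous (a2 n). Proof. exact: moll2_continuous (s0 n). Qed.
Let cb n : continuous (b n). Proof. exact: moll_continuous (s0 n). Qed.
Let cb1 n : continuous (b1 n). Proof. exact: moll1_continuous (s0 n). Qed.
Let cb2 n : continuous (b2 n). Proof. exact: moll2_continuous (s0 n). Qed.
Let da1 n v : is_derive v.1 1 (fun x => a n (x, v.2)) (a1 n v).
Proof. exact: is_derive_moll1. Qed.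
Let da2 n v : is_derive v.2 1 (fun x => a n (v.1, x)) (a2 n v).
Proof. exact: is_derive_moll2. Qed.
Let db1 n v : is_derive v.1 1 (fun x => b n (x, v.2)) (b1 n v).
Proof. exact: is_derive_moll1. Qed.
Let db2 n v : is_derive v.2 1 (fun x => b n (v.1, x)) (b2 n v).
Proof. exact: is_derive_moll2. Qed.

Let af n v : box N v -> `|a n v - f v| <= 16 * C * s n.
Proof. exact: (moll_dist NL C0 bfL fC (s0 n) (s1 n)). Qed.
Let bh n v : box N v -> `|b n v - h v| <= 16 * C * s n.
Proof. exact: (moll_dist NL C0 bhL hC (s0 n) (s1 n)). Qed.

Let w_le n v : box N v -> h v <= f v -> w n v <= 32 * C * s n.
Proof.
move=> Nv hf; have := af n Nv; have := bh n Nv; rewrite /w !ler_norml.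
by move=> /andP[? ?] /andP[? ?]; lra.
Qed.

Let near_w v : box N v -> f v < h v -> \forall n \near \oo, (K + 2) * s n <= w n v.
Proof.
move=> Nv fh; have d0 : 0 < (h v - f v) / (32 * C + K + 2).
  by rewrite divr_gt0// ?subr_gt0// ltr_wpDl// addr_ge0// mulr_ge0.
have /cvgrPdist_le/(_ _ d0) : sc @ \oo --> (0 : R) by exact: sc_cvg0.
apply: filterS => n; rewrite sub0r normrN gtr0_norm ?sc_gt0//.
rewrite ler_pdivlMr; last by rewrite ltr_wpDl// addr_ge0// mulr_ge0.
have := af n Nv; have := bh n Nv; rewrite /w !ler_norml -/(s n).
by move=> /andP[? ?] /andP[? ?] ?; lra.
Qed.

Let cp0 : continuous phi. Proof. by case: tphi => -[]. Qed.
Let cp1 : continuous p1. Proof. by case: tphi => -[]. Qed.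
Let cp2 : continuous p2. Proof. by case: tphi => -[]. Qed.

Let phi_at (psi : heis R -> R) (u : plane R -> R) : continuous psi -> continuous u ->
  continuous (fun v => psi (v, u v)).
Proof.
move=> cpsi cu v; apply: (@continuous_comp _ _ _ (fun v => (v, u v)) psi); last exact: cpsi.
have ci : continuous (fun v : plane R => v) by move=> y; exact: cvg_id.
exact: (@continuous_pair (plane R) (plane R) R _ _ ci cu).
Qed.

Let k_C1 n (u u1 u2 : plane R -> R) :
  (forall v, is_derive v.1 1 (fun x => u (x, v.2)) (u1 v)) ->
  (forall v, is_derive v.2 1 (fun x => u (v.1, x)) (u2 v)) ->
  continuous u -> continuous u1 -> continuous u2 ->
  C1box N (fun v => chi n (w n v) * phi (v, u v))
    (fun v => chi' n (w n v) * (b1 n v - a1 n v) * phi (v, u v)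
      + chi n (w n v) * (p1 (v, u v) + p3 (v, u v) * u1 v))
    (fun v => chi' n (w n v) * (b2 n v - a2 n v) * phi (v, u v)
      + chi n (w n v) * (p2 (v, u v) + p3 (v, u v) * u2 v)).
Proof.
move=> du1 du2 cu cu1 cu2; have [[_ _ _ cp3] h1 h2 _ out] := tphi.
have cw : continuous (w n) := contB (@cb n) (@ca n).
have cchiw : continuous (fun v => chi n (w n v)).
  move=> v; apply: (@continuous_comp _ _ _ (w n) (chi n)); first exact: cw.
  exact: (der_continuous (dchi n)).
have cchi'w : continuous (fun v => chi' n (w n v)).
  by move=> v; apply: (@continuous_comp _ _ _ (w n) (chi' n)); [exact: cw|exact: cchi'].
split.
- move=> v.
  have dw := derB (db1 n v) (da1 n v).
  have d1 := @der_comp _ (chi n) (fun x => w n (x, v.2)) v.1 _ _ (dchi n _) dw.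
  have := @derM _ _ (fun x => phi (x, v.2, u (x, v.2))) v.1 _ _ d1 (h1 _ v.2 _ _ (du1 v)).
  by move=> hd; apply: (der_eq hd); case: (v).
- move=> v.
  have dw := derB (db2 n v) (da2 n v).
  have d1 := @der_comp _ (chi n) (fun x => w n (v.1, x)) v.2 _ _ (dchi n _) dw.
  have := @derM _ _ (fun x => phi (v.1, x, u (v.1, x))) v.2 _ _ d1 (h2 _ v.1 _ _ (du2 v)).
  by move=> hd; apply: (der_eq hd); case: (v).
- have X0 := phi_at cp0 cu; have X1 := phi_at cp1 cu; have X2 := phi_at cp2 cu; have X3 := phi_at cp3 cu.
  split; first exact: (contM cchiw X0).
    exact: (contD (contM (contM cchi'w (contB (@cb1 n) (@ca1 n))) X0) (contM cchiw (contD X1 (contM X3 cu1)))).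
  exact: (contD (contM (contM cchi'w (contB (@cb2 n) (@ca2 n))) X0) (contM cchiw (contD X2 (contM X3 cu2)))).
- move=> v ov; have [-> -> -> ->] := out v (u v) ov.
  by rewrite !mul0r !addr0 !mulr0 !addr0.
Qed.

Let ind v : R := (f v < h v)%R%:R.

Let chi_cvg v : box N v -> (fun n => chi n (w n v)) @ \oo --> ind v.
Proof.
move=> Nv; rewrite /ind; have [fh|hf] := ltP (f v) (h v).
  by apply: cvg_near_cst; apply: filterS (near_w Nv fh) => n /chi1 [-> _].
by apply: cvg_near_cst; apply: nearW => n; have [-> _] := chi0 (w_le n Nv hf).
Qed.

Let ac v : box N v -> (fun n => a n v) @ \oo --> f v.
Proof. exact: (moll_cvg NL C0 cf fC). Qed.
Let bc v : box N v -> (fun n => b n v) @ \oo --> h v.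
Proof. exact: (moll_cvg NL C0 ch hC). Qed.

Let phi_cvg (psi : heis R -> R) (u : nat -> R) (l : R) v : continuous psi ->
  u @ \oo --> l -> (fun n => psi (v, u n)) @ \oo --> psi (v, l).
Proof.
move=> cpsi ul.
have c2 : continuous (fun t : R => psi (v, t)).
  move=> t; apply: (@continuous_comp _ _ _ (fun t : R => (v, t)) psi); last exact: cpsi.
  have ci : continuous (fun t : R => t) by move=> y; exact: cvg_id.
  have cc : continuous (fun _ : R => v) by move=> y; exact: cvg_cst.
  exact: (@continuous_pair R (plane R) R _ _ cc ci).
exact: (cvg_comp _ _ ul (c2 l)).
Qed.

Let fh_bounded : exists M, 0 <= M /\ forall v, box N v -> `|f v| <= M /\ `|h v| <= M.
Proof.
have [_ [M1 fM]] := @bdm_continuous_plane _ N _ cf.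
have [_ [M2 hM]] := @bdm_continuous_plane _ N _ ch.
exists (`|M1| + `|M2|); split; first exact: addr_ge0.
move=> v Nv; split.
  by rewrite (le_trans (fM _ Nv))// (le_trans (ler_norm _))// lerDl.
by rewrite (le_trans (hM _ Nv))// (le_trans (ler_norm _))// lerDr.
Qed.

Lemma phi_bounded (psi : heis R -> R) (Mt : R) : continuous psi ->
  exists2 B, 0 <= B & forall v t, box N v -> `|t| <= Mt -> `|psi (v, t)| <= B.
Proof.
move=> cpsi; have /compact_bounded[B [_ PB]] : compact (psi @` (box N `*` `[(- Mt)%R, Mt]%classic)).
  apply: continuous_compact; first exact: continuous_subspaceT.
  by apply: compact_setX; [exact: compact_box|exact: segment_compact].
exists (`|B| + 1) => [|v t Nv tM]; first by rewrite addr_ge0.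
apply: (PB (`|B| + 1)); first by rewrite ltr_pwDr// ler_norm.
by exists (v, t) => //; split => //=; rewrite in_itv/= -ler_norml.
Qed.

Let ab_bound (Mt : R) : 0 <= Mt -> (forall v, box N v -> `|f v| <= Mt /\ `|h v| <= Mt) ->
  forall n v, box N v -> `|a n v| <= Mt + 16 * C /\ `|b n v| <= Mt + 16 * C.
Proof.
move=> M0 fhM n v Nv; have [fM hM] := fhM v Nv.
have Cs : 16 * C * s n <= 16 * C by rewrite ler_piMr// mulr_ge0.
have := af n Nv; have := bh n Nv; move: fM hM; rewrite !ler_norml.
by move=> /andP[? ?] /andP[? ?] /andP[? ?] /andP[? ?]; split; apply/andP; split; lra.
Qed.

Let Gb n v := b1 n v - b n v * b2 n v.
Let Ga n v := a1 n v - a n v * a2 n v.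

Let lim_b : (fun n => \int[leb2]_(v in box N) (chi n (w n v) * phi (v, b n v) * Gb n v)) @ \oo -->
  \int[leb2]_(v in box N) (ind v * phi (v, h v) * gh v).
Proof.
have [Mt [M0 fhM]] := fh_bounded; have [B B0 PB] := phi_bounded (Mt + 16 * C) cp0.
apply: (moll_grad_weak_cvg N0 NL C0 G0 ch mgh ghG hgh hC
  (fun n => k_C1 n (db1 n) (db2 n) (@cb n) (@cb1 n) (@cb2 n)) (K := B)).
- move=> n v Nv; rewrite normrM -[B]mul1r ler_pM//.
  by apply: PB => //; have [] := ab_bound M0 fhM n Nv.
- by move=> v Nv; apply: cvgM; [exact: chi_cvg|apply: phi_cvg => //; exact: bc].
Qed.

Let lim_a : (fun n => \int[leb2]_(v in box N) (chi n (w n v) * phi (v, a n v) * Ga n v)) @ \oo -->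
  \int[leb2]_(v in box N) (ind v * phi (v, f v) * gf v).
Proof.
have [Mt [M0 fhM]] := fh_bounded; have [B B0 PB] := phi_bounded (Mt + 16 * C) cp0.
apply: (moll_grad_weak_cvg N0 NL C0 G0 cf mgf gfG fgf fC
  (fun n => k_C1 n (da1 n) (da2 n) (@ca n) (@ca1 n) (@ca2 n)) (K := B)).
- move=> n v Nv; rewrite normrM -[B]mul1r ler_pM//.
  by apply: PB => //; have [] := ab_bound M0 fhM n Nv.
- by move=> v Nv; apply: cvgM; [exact: chi_cvg|apply: phi_cvg => //; exact: ac].
Qed.

(** The integral of X phi over f < t < h, each fibre being parametrised affinely by [0, 1]; h - f is
    the Jacobian. No term from the cut-off survives. *)
Definition limit_bulk (p : heis R) := let v := p.1 in let m := f v + p.2 * (h v - f v) in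
  (f v < h v)%R%:R * (h v - f v) * (p1 (v, m) - m * p2 (v, m)).

Let bulk_ n := bulk phi p1 p2 (a n) (a1 n) (a2 n) (b n) (b1 n) (b2 n) (chi n) (chi' n).

Let bulkE n p : bulk_ n p = chi n (w n p.1) * w n p.1 *
   (p1 (p.1, a n p.1 + p.2 * w n p.1) - (a n p.1 + p.2 * w n p.1) * p2 (p.1, a n p.1 + p.2 * w n p.1))
  + chi' n (w n p.1) * w n p.1 * phi (p.1, a n p.1 + p.2 * w n p.1) *
   ((b1 n p.1 - a1 n p.1) - (a n p.1 + p.2 * w n p.1) * (b2 n p.1 - a2 n p.1)).
Proof. by []. Qed.

Let bulk_cvg p : slab N p -> (fun n => bulk_ n p) @ \oo --> limit_bulk p.
Proof.
case: p => v t [/= Nv _]; rewrite /limit_bulk /=.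
have wc : (fun n => w n v) @ \oo --> h v - f v by apply: cvgB; [exact: bc|exact: ac].
have mc : (fun n => a n v + t * w n v) @ \oo --> f v + t * (h v - f v).
  by apply: cvgD; [exact: ac|apply: cvgM; [exact: cvg_cst|exact: wc]].
rewrite -[X in _ --> X]addr0; under eq_fun do rewrite bulkE/=; apply: cvgD.
  apply: cvgM; first by apply: cvgM; [exact: chi_cvg|exact: wc].
  by apply: cvgB; [exact: phi_cvg|apply: cvgM; [exact: mc|exact: phi_cvg]].
(* At a fixed point the cut-off is eventually constant near w: equal to 1 if f < h, to 0
   otherwise. *)
apply: cvg_near_cst.
have [fh|hf] := ltP (f v) (h v).
  by apply: filterS (near_w Nv fh) => n /chi1 [_ ->]; rewrite !mul0r.
by apply: nearW => n; have [_ ->] := chi0 (w_le n Nv hf); rewrite !mul0r.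
Qed.

Let G' := 16 * G + 16 * (17 * C) ^+ 2.
Let GbB n v : box N v -> `|Gb n v| <= G'.
Proof. exact: (moll_grad_bound NL C0 G0 bhL mgh ghG hgh hC (s0 n) (s1 n)). Qed.
Let GaB n v : box N v -> `|Ga n v| <= G'.
Proof. exact: (moll_grad_bound NL C0 G0 bfL mgf gfG fgf fC (s0 n) (s1 n)). Qed.
Let a2B n v : box N v -> `|a2 n v| <= 32 * C / s n.
Proof. exact: (moll2_bound NL C0 bfL fC (s0 n) (s1 n)). Qed.
Let b2B n v : box N v -> `|b2 n v| <= 32 * C / s n.
Proof. exact: (moll2_bound NL C0 bhL hC (s0 n) (s1 n)). Qed.

Let m_bound (A t x y : R) : 0 <= t <= 1 -> `|x| <= A -> `|y| <= A -> `|x + t * (y - x)| <= A.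
Proof.
move=> /andP[t0 t1]; rewrite !ler_norml => /andP[? ?] /andP[? ?].
have -> : x + t * (y - x) = (1 - t) * x + t * y by ring.
by apply/andP; split; nra.
Qed.

(** The cancellation behind the domination. Where the cut-off varies, w is O(s), so chi' w is
    bounded; and w1 - m w2 equals Gb - Ga + w ((1 - t) b2 + t a2), in which w absorbs the 1 / s of
    the derivatives. *)
Let front n v t : box N v -> 0 <= t <= 1 ->
  `|chi' n (w n v) * w n v * ((b1 n v - a1 n v) - (a n v + t * w n v) * (b2 n v - a2 n v))| <=
  (K + 2) * (2 * G' + (K + 2) * (64 * C)).
Proof.
move=> Nv /andP[t0 t1]; have sn := s0 n.
have G'0 : 0 <= G' by exact: le_trans (GaB n Nv).
have rhs0 : 0 <= (K + 2) * (2 * G' + (K + 2) * (64 * C)).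
  have K2 : 0 <= K + 2 by exact: addr_ge0.
  have C64 : 0 <= 64 * C by exact: mulr_ge0.
  by apply: mulr_ge0 => //; apply: addr_ge0; exact: mulr_ge0.
have [w1|w1] := leP (w n v) (32 * C * s n).
  by have [_ ->] := chi0 w1; rewrite !mul0r normr0.
have [w2|w2] := leP ((K + 2) * s n) (w n v).
  by have [_ ->] := chi1 w2; rewrite !mul0r normr0.
have C32 : 0 <= 32 * C * s n by apply: mulr_ge0; [exact: mulr_ge0|exact: ltW].
have w0 : 0 <= w n v by apply: le_trans C32 (ltW w1).
move: (chi' n (w n v)) (chi'_bound n (w n v)) => c cs.
rewrite !normrM; apply: ler_pM => //.
  apply: (@le_trans _ _ ((s n)^-1 * ((K + 2) * s n))).
    by apply: ler_pM => //; rewrite ger0_norm// ltW.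
  by rewrite mulrCA mulVf ?mulr1// gt_eqF.
have -> : (b1 n v - a1 n v) - (a n v + t * w n v) * (b2 n v - a2 n v) =
  (Gb n v - Ga n v) + w n v * ((1 - t) * b2 n v + t * a2 n v).
  by rewrite /Gb /Ga /w; ring.
rewrite (le_trans (ler_normD _ _))//; apply: lerD.
  rewrite (le_trans (ler_normB _ _))//; have := GaB n Nv; have := GbB n Nv; lra.
have -> : (K + 2) * (64 * C) = ((K + 2) * s n) * (64 * C / s n) by field; rewrite gt_eqF.
rewrite normrM; apply: ler_pM => //; first by rewrite ger0_norm// ltW.
rewrite (le_trans (ler_normD _ _))// !normrM.
have -> : 64 * C / s n = 1 * (32 * C / s n) + 1 * (32 * C / s n) by field; rewrite gt_eqF.
apply: lerD; apply: ler_pM => //; [|exact: b2B| |exact: a2B].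
  by rewrite ger0_norm; lra.
by rewrite ger0_norm.
Qed.

Let lim_bulk : (fun n => \int[leb3]_(p in slab N) bulk_ n p) @ \oo -->
  \int[leb3]_(p in slab N) limit_bulk p.
Proof.
have [Mt [M0 fhM]] := fh_bounded; pose A := Mt + 16 * C.
have A0 : 0 <= A by rewrite addr_ge0// mulr_ge0.
have [B B0 PB] := phi_bounded A cp0; have [B1 B10 PB1] := phi_bounded A cp1.
have [B2 B20 PB2] := phi_bounded A cp2.
have mb n : measurable_fun (slab N) (bulk_ n).
  suff c : continuous (bulk_ n) by case: (bdm_continuous_slab N c).
  apply: (bulk_continuous (N := N) tphi (@ca n) (@ca1 n) (@ca2 n) (@cb n) (@cb1 n) (@cb2 n) (dchi n) (@cchi' n)).
apply: (@bounded_convergence _ _ R leb3 _ (measurable_slab N) (slab_fin N) _ _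
  ((2 * A) * (B1 + A * B2) + (K + 2) * (2 * G' + (K + 2) * (64 * C)) * B)) => //.
- apply: (measurable_fun_cvg (h := bulk_)) => //; exact: bulk_cvg.
- move=> n [v t] [/= Nv]; rewrite in_itv/= => t01.
  have [aA bA] := ab_bound M0 fhM n Nv; have mA := m_bound t01 aA bA.
  rewrite bulkE /= (le_trans (ler_normD _ _))//; apply: lerD.
    move: (chi n (w n v)) (chi_bound n (w n v)) => c cs.
    rewrite 2!normrM; apply: ler_pM => //.
      rewrite -[2 * A]mul1r ler_pM// (le_trans (ler_normB _ _))//.
      by have -> : 2 * A = A + A by [ring]; exact: lerD.
    rewrite (le_trans (ler_normB _ _))// lerD ?PB1// normrM ler_pM//.
    exact: PB2.
  rewrite mulrAC normrM; apply: ler_pM => //; last exact: PB.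
  exact: front.
Qed.

Lemma key_identity :
  \int[leb2]_(v in box N) ((f v < h v)%R%:R * phi (v, h v) * gh v) -
  \int[leb2]_(v in box N) ((f v < h v)%R%:R * phi (v, f v) * gf v) +
  \int[leb3]_(p in slab N) limit_bulk p = 0.
Proof.
have lim : (fun n => \int[leb2]_(v in box N) (chi n (w n v) * phi (v, b n v) * Gb n v) -
    \int[leb2]_(v in box N) (chi n (w n v) * phi (v, a n v) * Ga n v) +
    \int[leb3]_(p in slab N) bulk_ n p) @ \oo -->
  \int[leb2]_(v in box N) (ind v * phi (v, h v) * gh v) -
  \int[leb2]_(v in box N) (ind v * phi (v, f v) * gf v) +
  \int[leb3]_(p in slab N) limit_bulk p.
  by apply: cvgD; [apply: cvgB; [exact: lim_b|exact: lim_a]|exact: lim_bulk].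
have E n := smooth_identity N0 tphi (da1 n) (da2 n) (db1 n) (db2 n) (@ca n) (@ca1 n) (@ca2 n)
  (@cb n) (@cb1 n) (@cb2 n) (dchi n) (@cchi' n).
rewrite -[LHS](cvg_lim _ lim)//; apply: cvg_lim => //.
by apply: cvg_near_cst; apply: nearW => n; exact: E.
Qed.

End key.

Section Cc1_support.
Context {R : realType} (V : normedModType R).

Lemma Cc1_vanish (F : V -> R) x : Cc1 F -> ~ closure [set y | F y != 0] x ->
  F x = 0 /\ forall w, 'D_w F x = 0.
Proof.
move=> [dF _ _] nx.
have nF : \forall y \near x, F y = 0.
  have : open_nbhs x (~` closure [set y | F y != 0]).
    by split; [rewrite openC; exact: closed_closure|exact: nx].
  move=> /open_nbhs_nbhs; apply: filterS => y ny; apply: contrapT => Fy.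
  by apply: ny; apply: subset_closure; exact/eqP.
have Fx : F x = 0 by exact: nbhs_singleton nF.
split=> // w; rewrite (near_eq_derive (g := cst 0)) ?derive_cst//.
Qed.

End Cc1_support.

(** * Test functions in graph coordinates *)

Section chain_rule.
Context {R : realType}.

Lemma heis_derive (V : heis R -> R) p (x y z : R) : differentiable V p ->
  'D_(x, y, z) V p = x * 'D_(1, 0, 0) V p + y * 'D_(0, 1, 0) V p + z * 'D_(0, 0, 1) V p.
Proof.
move=> dV; rewrite !deriveE//.
have -> : (x, y, z) = x *: ((1, 0, 0) : heis R) + y *: ((0, 1, 0) : heis R) + z *: ((0, 0, 1) : heis R).
  have E (k a b c : R) : k *: ((a, b, c) : heis R) = (k * a, k * b, k * c) by [].
  have D (a b c a' b' c' : R) : ((a, b, c) : heis R) + (a', b', c') = (a + a', b + b', c + c') by [].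
  by rewrite !E !D !mulr0 !mulr1 !addr0 !add0r.
by rewrite !linearD !linearZ.
Qed.

Lemma curve_chain (W : normedModType R) (V : W -> R) (c : R -> W) (s : R) (c' : W) :
  differentiable V (c s) -> differentiable c s -> 'd c s 1 = c' ->
  is_derive s 1 (fun s => V (c s)) ('D_c' V (c s)).
Proof.
move=> dV dc cE.
have dVc : differentiable (V \o c) s by exact: differentiable_comp.
split; first exact/derivable1_diffP.
by rewrite deriveE// diff_comp//= cE deriveE.
Qed.

Lemma is_derive_diff (x : R -> R) (s x' : R) : is_derive s 1 x x' ->
  differentiable x s /\ 'd x s 1 = x'.
Proof.
move=> dx; have d : differentiable x s by apply/derivable1_diffP; case: dx.
by split=> //; rewrite -deriveE//; exact: derive_val.
Qed.

Lemma heis_chain (V : heis R -> R) (x y z : R -> R) (s x' y' z' : R) :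
  differentiable V (x s, y s, z s) ->
  is_derive s 1 x x' -> is_derive s 1 y y' -> is_derive s 1 z z' ->
  is_derive s 1 (fun s => V (x s, y s, z s)) ('D_(x', y', z') V (x s, y s, z s)).
Proof.
move=> dV /is_derive_diff[dx xE] /is_derive_diff[dy yE] /is_derive_diff[dz zE].
apply: (@curve_chain (heis R) V (fun s => (x s, y s, z s))) => //.
  by apply: differentiable_pair => //; exact: differentiable_pair.
rewrite diff_pair//=; last exact: differentiable_pair.
by rewrite diff_pair//= xE yE zE.
Qed.

Lemma plane_chain (V : plane R -> R) (x y : R -> R) (s x' y' : R) :
  differentiable V (x s, y s) -> is_derive s 1 x x' -> is_derive s 1 y y' ->
  is_derive s 1 (fun s => V (x s, y s)) ('D_(x', y') V (x s, y s)).
Proof.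
move=> dV /is_derive_diff[dx xE] /is_derive_diff[dy yE].
apply: (@curve_chain (plane R) V (fun s => (x s, y s))) => //.
  exact: differentiable_pair.
by rewrite diff_pair//= xE yE.
Qed.

Lemma compact_plane_bound (K : set (plane R)) : compact K ->
  exists2 N : R, 0 < N & forall v, K v -> `|v.1| < N /\ `|v.2| < N.
Proof.
move=> /compact_bounded[M [_ KM]]; exists (`|M| + 2); first by rewrite ltr_wpDl.
move=> v Kv; have : `|v| <= `|M| + 1 by apply: (KM (`|M| + 1)) => //; rewrite ltr_pwDr// ler_norm.
rewrite {1}/Num.norm/= ge_max => /andP[v1 v2].
by split; [apply: le_lt_trans v1 _|apply: le_lt_trans v2 _]; rewrite ltrD2l ltr1n.
Qed.

Lemma compact_heis_bound (K : set (heis R)) : compact K ->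
  exists2 N : R, 0 < N & forall p, K p -> [/\ `|hx p| < N, `|hy p| < N & `|hz p| < N].
Proof.
move=> /compact_bounded[M [_ KM]]; exists (`|M| + 2); first by rewrite ltr_wpDl.
move=> v Kv; have : `|v| <= `|M| + 1 by apply: (KM (`|M| + 1)) => //; rewrite ltr_pwDr// ler_norm.
rewrite {1}/Num.norm/= ge_max => /andP[]; rewrite {1}/Num.norm/= ge_max => /andP[v1 v2] v3.
by split; [apply: le_lt_trans v1 _|apply: le_lt_trans v2 _|apply: le_lt_trans v3 _]; rewrite ltrD2l ltr1n.
Qed.

(** The same map as [heis_chart], on the carrier with its topology instead of its Borel
    structure. *)
Definition chart (p : heis R) : heis R := (p.1.1, p.2, p.1.2 + p.1.1 * p.2 / 2).

Lemma chart_continuous : continuous chart.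
Proof.
have c11 : continuous (fun p : heis R => p.1.1).
  by move=> p; apply: (@continuous_comp _ _ _ fst fst); exact: cvg_fst.
have c12 : continuous (fun p : heis R => p.1.2).
  by move=> p; apply: (@continuous_comp _ _ _ fst snd); [exact: cvg_fst|exact: cvg_snd].
have c2 : continuous (fun p : heis R => p.2) by move=> p; exact: cvg_snd.
have ch : continuous (fun _ : heis R => 2^-1 : R) by move=> p; exact: cvg_cst.
exact: (continuous_pair (continuous_pair c11 c2) (contD c12 (contM (contM c11 c2) ch))).
Qed.

Section heis_testfun.
Variables (V : heis R -> R).
Hypothesis V1 : Cc1 V.

(* V in the coordinates (v, t), and its partial derivatives *)
Definition tf0 p := V (chart p).
Definition tf1 p := 'D_(1, 0, 0) V (chart p) + p.2 / 2 * 'D_(0, 0, 1) V (chart p).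
Definition tf2 p := 'D_(0, 0, 1) V (chart p).
Definition tf3 p := 'D_(0, 1, 0) V (chart p) + p.1.1 / 2 * 'D_(0, 0, 1) V (chart p).

Lemma Cc1_continuous : continuous V.
Proof. by case: V1 => dV _ _ p; exact: differentiable_continuous. Qed.

Lemma tf_continuous : [/\ continuous tf0, continuous tf1, continuous tf2 & continuous tf3].
Proof.
have [dV cV _] := V1.
have cD w : continuous (fun p => 'D_w V (chart p)) by exact: contComp chart_continuous (cV w).
have ch : continuous (fun _ : heis R => 2^-1 : R) by move=> p; exact: cvg_cst.
have c11 : continuous (fun p : heis R => p.1.1).
  by move=> p; apply: (@continuous_comp _ _ _ fst fst); exact: cvg_fst.
have c2 : continuous (fun p : heis R => p.2) by move=> p; exact: cvg_snd.
split; first exact: (contComp chart_continuous Cc1_continuous).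
- exact: (contD (cD _) (contM (contM c2 ch) (cD _))).
- exact: cD.
- exact: (contD (cD _) (contM (contM c11 ch) (cD _))).
Qed.

Lemma testfun_heis : exists N0 : R, forall N, N0 <= N -> testfun N tf0 tf1 tf2 tf3.
Proof.
have [dV cV sV] := V1; have [B B0 KB] := compact_heis_bound sV.
(* On the support |x|, |t| and |z| are below [B], and zeta = z - x t / 2. *)
exists (B + B * B / 2) => N BN; split; first by have [] := tf_continuous.
- move=> m z x m' dm.
  have dz := derD (der_cst z x) (derM (derM (der_id x) dm) (der_cst 2^-1 x)).
  have := @heis_chain V (fun t => t) m (fun t => z + t * m t / 2) x _ _ _ (dV _) (der_id x) dm dz.
  move=> hd; apply: (der_eq hd); rewrite (heis_derive _ _ _ (dV _)).
  rewrite /tf1 /tf3 /chart/=.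
  move: ('D_(1, 0, 0) V _) ('D_(0, 1, 0) V _) ('D_(0, 0, 1) V _) => A1 A2 A3; ring.
- move=> m x z m' dm.
  have dz := derD (der_id z) (derM (derM (der_cst x z) dm) (der_cst 2^-1 z)).
  have := @heis_chain V (fun=> x) m (fun t => t + x * m t / 2) z _ _ _ (dV _) (der_cst x z) dm dz.
  move=> hd; apply: (der_eq hd); rewrite (heis_derive _ _ _ (dV _)).
  rewrite /tf2 /tf3 /chart/=.
  move: ('D_(1, 0, 0) V _) ('D_(0, 1, 0) V _) ('D_(0, 0, 1) V _) => A1 A2 A3; ring.
- move=> v t.
  have dz := derD (der_cst v.2 t) (derM (derM (der_cst v.1 t) (der_id t)) (der_cst 2^-1 t)).
  have := @heis_chain V (fun=> v.1) (fun t => t) (fun t => v.2 + v.1 * t / 2) t _ _ _ (dV _)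
    (der_cst v.1 t) (der_id t) dz.
  move=> hd; apply: (der_eq hd); rewrite (heis_derive _ _ _ (dV _)).
  rewrite /tf3 /chart/=.
  move: ('D_(1, 0, 0) V _) ('D_(0, 1, 0) V _) ('D_(0, 0, 1) V _) => A1 A2 A3; ring.
- move=> v t ov.
  have nK : ~ closure [set p | V p != 0] (chart (v, t)).
    move=> /KB; rewrite /chart /hx /hy /hz/= => -[vB tB zB].
    have vt : `|v.1 * t / 2| <= B * B / 2.
      by rewrite !normrM (ger0_norm (_ : 0 <= 2^-1))// ler_wpM2r// ler_pM// ltW.
    case: ov => [|]; first by have : 0 <= B * B / 2 by [rewrite !mulr_ge0// ltW]; lra.
    have -> : v.2 = (v.2 + v.1 * t / 2) - v.1 * t / 2 by ring.
    by have := ler_normB (v.2 + v.1 * t / 2) (v.1 * t / 2); lra.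
  have [V0 D0] := Cc1_vanish V1 nK.
  by rewrite /tf0 /tf1 /tf2 /tf3 !D0 V0 !mulr0 !addr0.
Qed.

Lemma tf_Xfield p : tf1 p - p.2 * tf2 p = 'D_(Xfield (chart p)) V (chart p).
Proof.
have [dV _ _] := V1.
rewrite /Xfield (heis_derive _ _ _ (dV _)) /tf1 /tf2 /hy/=.
move: ('D_(1, 0, 0) V _) ('D_(0, 1, 0) V _) ('D_(0, 0, 1) V _) => A1 A2 A3; by field.
Qed.

Lemma tf_Yfield p : tf3 p = 'D_(Yfield (chart p)) V (chart p).
Proof.
have [dV _ _] := V1.
rewrite /Yfield (heis_derive _ _ _ (dV _)) /tf3 /hx/=.
move: ('D_(1, 0, 0) V _) ('D_(0, 1, 0) V _) ('D_(0, 0, 1) V _) => A1 A2 A3; by field.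
Qed.

End heis_testfun.

Section plane_testfun.
Variables (psi : plane R -> R).
Hypothesis psi1 : Cc1 psi.

(** Test functions independent of t turn the identity between two graphs into a comparison of their
    weak gradients on {f < h}. *)
Lemma testfun_plane : exists N0 : R, forall N, N0 <= N ->
  testfun N (fun p => psi p.1) (fun p => 'D_(1, 0) psi p.1) (fun p => 'D_(0, 1) psi p.1) (fun=> 0).
Proof.
have [dV cV sV] := psi1; have [B B0 KB] := compact_plane_bound sV.
have c1 : continuous (fun p : heis R => p.1) by move=> p; exact: cvg_fst.
have cpsi : continuous psi by move=> v; exact: differentiable_continuous.
exists B => N BN; split.
- split; [exact: (contComp c1 cpsi)|exact: (contComp c1 (cV _))|exact: (contComp c1 (cV _))|].
  by move=> p; exact: cvg_cst.
- move=> m z x m' dm /=.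
  have := @plane_chain psi (fun t => t) (fun=> z) x _ _ (dV _) (der_id x) (der_cst z x).
  by move=> hd; apply: (der_eq hd); rewrite mul0r addr0.
- move=> m x z m' dm /=.
  have := @plane_chain psi (fun=> x) (fun t => t) z _ _ (dV _) (der_cst x z) (der_id z).
  by move=> hd; apply: (der_eq hd); rewrite mul0r addr0.
- by move=> v t; exact: (der_cst (psi v) t).
- move=> v t ov.
  have nK : ~ closure [set p | psi p != 0] v.
    by move=> /KB [v1 v2]; case: ov; lra.
  by have [V0 D0] := Cc1_vanish psi1 nK; rewrite /= !D0 V0.
Qed.

End plane_testfun.

End chain_rule.

(** * Admissible functions and locality of the gradient *)

Section admissible.
Context {R : realType}.
Notation L1 := (@lebesgue_measure R).
Implicit Types (v w : plane R) (f g h : plane R -> R).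

(** Local 1/2-Hoelder continuity, with increments compared to s^2 to avoid square roots; s is then
    directly the mollification parameter. *)
Definition half_holder f := forall L, exists2 C, 0 <= C & forall s v w, 0 <= s ->
  box L v -> box L w -> `|w.1 - v.1| <= s ^+ 2 -> `|w.2 - v.2| <= s ^+ 2 ->
  `|f w - f v| <= C * s.

(** What the divergence identity uses of an intrinsic Lipschitz graph, with a gradient bounded at
    every point. *)
Definition admissible f g := [/\ half_holder f, measurable_fun setT g,
  exists2 G, 0 <= G & forall v, `|g v| <= G & weak_gradient f g].

Lemma half_holder_continuous f : half_holder f -> continuous f.
Proof.
move=> fH v; have [C C0 fC] := fH (`|v.1| + `|v.2| + 1).
apply: plane_continuousP => e e0; pose s := Num.min 1 (e / (C + 1)).
have s0 : 0 < s by rewrite lt_min ltr01 divr_gt0// ltr_wpDl.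
have s1 : s <= 1 by rewrite ge_min lexx.
have se : s <= e / (C + 1) by rewrite ge_min lexx orbT.
have s2 : s ^+ 2 <= 1 by rewrite exprn_ile1// ltW.
have v1 := normr_ge0 v.1; have v2 := normr_ge0 v.2.
exists (s ^+ 2); first exact: exprn_gt0.
move=> w w1 w2; apply: (@le_trans _ _ (C * s)).
  apply: fC => //; first exact: ltW.
  - by rewrite /box/= !in_itv/= -!ler_norml; split; lra.
  - rewrite /box/= !in_itv/= -!ler_norml; split.
      have -> : w.1 = v.1 + (w.1 - v.1) by ring.
      by rewrite (le_trans (ler_normD _ _))//; lra.
    have -> : w.2 = v.2 + (w.2 - v.2) by ring.
    by rewrite (le_trans (ler_normD _ _))//; lra.
apply: (@le_trans _ _ ((C + 1) * s)); first by rewrite ler_wpM2r ?lerDl// ltW.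
by rewrite mulrC -ler_pdivlMr// ltr_wpDl.
Qed.

Lemma key_admissible (N : R) f h gf gh phi p1 p2 p3 : admissible f gf -> admissible h gh ->
  0 < N -> testfun N phi p1 p2 p3 ->
  \int[leb2]_(v in box N) ((f v < h v)%R%:R * phi (v, h v) * gh v) -
  \int[leb2]_(v in box N) ((f v < h v)%R%:R * phi (v, f v) * gf v) +
  \int[leb3]_(p in slab N) limit_bulk f h p1 p2 p = 0.
Proof.
move=> [fH mf [Gf Gf0 gfG] fgf] [hH mh [Gh Gh0 ghG] hgh] N0 tphi.
have [Cf Cf0 fC] := fH (N + 1); have [Ch Ch0 hC] := hH (N + 1).
apply: (@key_identity _ N (N + 1) (Cf + Ch) (Gf + Gh) f h gf gh phi p1 p2 p3) => //.
- exact: addr_ge0.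
- exact: addr_ge0.
- exact: half_holder_continuous.
- exact: half_holder_continuous.
- by move=> v; rewrite (le_trans (gfG v))// lerDl.
- by move=> v; rewrite (le_trans (ghG v))// lerDr.
- by move=> s v w s0 Lv Lw a b; rewrite (le_trans (fC s v w s0 Lv Lw a b))// ler_wpM2r// lerDl.
- by move=> s v w s0 Lv Lw a b; rewrite (le_trans (hC s v w s0 Lv Lw a b))// ler_wpM2r// lerDr.
Qed.

Lemma bdm_ind (D : set (plane R)) f h : continuous f -> continuous h ->
  bdm D (fun v => (f v < h v)%R%:R : R).
Proof.
move=> cf ch; split; last first.
  by exists 1 => v _; case: (_ < _); rewrite ?normr1 ?normr0.
apply: measurable_funTS.
have mA : measurable [set v | f v < h v].
  apply: plane_open_measurable.
  have -> : [set v | f v < h v] = (fun v => h v - f v) @^-1` [set t | 0 < t].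
    by apply/seteqP; split=> v /=; rewrite subr_gt0.
  apply: open_comp; last exact: open_gt.
  by move=> v _; exact: (contB ch cf).
apply: (eq_measurable_fun (\1_[set v | f v < h v] : plane R -> R)); last exact: measurable_indic.
by move=> v _; rewrite indicE mem_setE/=; congr (_%:R).
Qed.

Lemma bdm_slab_fst (N : R) (F : plane R -> R) : bdm (box N) F -> bdm (slab N) (fun p => F p.1).
Proof.
move=> [mF [M FM]]; split; last by exists M => p [Np _]; exact: FM.
have mB : measurable (box N) by exact: measurable_box.
have mF' : measurable_fun setT (F \_ (box N)) by apply/(measurable_restrictT _ _).1.
have m1 : measurable_fun setT (fun p : heis R => (F \_ (box N)) p.1).
  by apply: (measurableT_comp mF'); exact: measurable_fst.
apply: (eq_measurable_fun (fun p : heis R => (F \_ (box N)) p.1)); last exact: measurable_funTS.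
by move=> p /set_mem [Np _] /=; rewrite patchE mem_set.
Qed.

Lemma slab_cst (N : R) (F : plane R -> R) : bdm (box N) F ->
  \int[leb3]_(p in slab N) F p.1 = \int[leb2]_(v in box N) F v.
Proof.
move=> bF; rewrite slab_Fubini1; last exact: bdm_slab_fst.
apply: eq_Rintegral => v _ /=; rewrite Rintegral_cst//.
have itv1 : L1 `[0%R, 1%R]%classic = 1%E.
  by rewrite lebesgue_measure_itv/= lte_fin ltr01 -EFinB subr0.
by rewrite [X in _ * X](_ : _ = 1) ?mulr1//; exact: (congr1 fine itv1).
Qed.

Lemma limit_bulk_bdm (N : R) f h (p1 p2 : heis R -> R) : continuous f -> continuous h ->
  continuous p1 -> continuous p2 -> bdm (slab N) (limit_bulk f h p1 p2).
Proof.
move=> cf ch cp1 cp2.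
have c1 : continuous (fun p : heis R => p.1) by move=> p; exact: cvg_fst.
have c2 : continuous (fun p : heis R => p.2) by move=> p; exact: cvg_snd.
have cm := contD (contComp c1 cf) (contM c2 (contB (contComp c1 ch) (contComp c1 cf))).
have cpm := continuous_pair c1 cm.
have cX := contB (contComp cpm cp1) (contM cm (contComp cpm cp2)).
rewrite /limit_bulk; apply: bdmM; last exact: (bdm_continuous_slab N cX).
apply: bdmM; first by apply: (bdm_slab_fst (F := fun v => (f v < h v)%R%:R)); exact: bdm_ind.
exact: (bdm_continuous_slab N (contB (contComp c1 ch) (contComp c1 cf))).
Qed.

Section locality.
Variables (f h gf gh : plane R -> R).
Hypotheses (fA : admissible f gf) (hA : admissible h gh).

(** For a test function independent of t the interior term can be integrated along each fibre,
    producing h - f and (h^2 - f^2) / 2. *)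
Let half_key (N : R) (psi q1 q2 : plane R -> R) f' h' gf' gh' :
  admissible f' gf' -> admissible h' gh' ->
  0 < N -> testfun N (fun p => psi p.1) (fun p => q1 p.1) (fun p => q2 p.1) (fun=> 0) ->
  continuous q1 -> continuous q2 ->
  \int[leb2]_(v in box N) ((f' v < h' v)%R%:R * psi v * gh' v) -
  \int[leb2]_(v in box N) ((f' v < h' v)%R%:R * psi v * gf' v) +
  \int[leb2]_(v in box N) ((f' v < h' v)%R%:R * ((h' v - f' v) * q1 v - (h' v ^+ 2 - f' v ^+ 2) / 2 * q2 v)) = 0.
Proof.
move=> fA' hA' N0 tpsi c1 c2; rewrite -[RHS](key_admissible fA' hA' N0 tpsi).
have [fH' _ _ _] := fA'; have [hH' _ _ _] := hA'.
have cf := half_holder_continuous fH'; have ch := half_holder_continuous hH'.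
congr (_ + _); rewrite slab_Fubini1; last first.
  apply: limit_bulk_bdm => //.
    by have cc1 : continuous (fun p : heis R => p.1) by [move=> p; exact: cvg_fst]; exact: contComp cc1 c1.
  by have cc1 : continuous (fun p : heis R => p.1) by [move=> p; exact: cvg_fst]; exact: contComp cc1 c2.
apply: eq_Rintegral => v _; rewrite /limit_bulk/=.
set i := (_%:R); set w := h' v - f' v.
pose F t := i * w * (t * q1 v - (f' v * t + t * t * (w / 2)) * q2 v).
have D (t : R) : is_derive t 1 F (i * w * (q1 v - (f' v + t * w) * q2 v)).
  have d2 := derD (derM (der_cst (f' v) t) (der_id t)) (derM (derM (der_id t) (der_id t)) (der_cst (w / 2) t)).
  have d := derM (der_cst (i * w) t)
   (derB (derM (der_id t) (der_cst (q1 v) t)) (derM d2 (der_cst (q2 v) t))).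
  by apply: (der_eq d); field.
have cF' : continuous (fun t : R => i * w * (q1 v - (f' v + t * w) * q2 v)).
  have cc (c : R) : continuous (fun _ : R => c) by move=> x; exact: cvg_cst.
  have ci : continuous (fun x : R => x) by move=> x; exact: cvg_id.
  exact: (contM (cc (i * w)) (contB (cc (q1 v)) (contM (contD (cc (f' v)) (contM ci (cc w))) (cc (q2 v))))).
rewrite (@Rintegral_derive _ _ _ 0 1 ltr01 D cF') /F /w; by field.
Qed.

(** The difference of the two weak equations concerns the whole plane. Removing from it the
    identities on {f < h} and on {h < f} leaves the part on {f = h}, where the terms in f and h
    cancel. *)
Lemma equal_gradients psi : Cc1 psi -> exists2 N0 : R, 0 < N0 & forall N, N0 <= N ->
  \int[leb2]_(v in box N) ((f v == h v)%R%:R * psi v * (gh v - gf v)) = 0.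
Proof.
move=> psi1; have [N0 tpsi] := testfun_plane psi1.
exists (`|N0| + 1) => [|N]; first by rewrite ltr_wpDl.
move=> NN0; have N0' : 0 < N by apply: lt_le_trans NN0; rewrite ltr_wpDl.
have NN : N0 <= N by apply: le_trans NN0; rewrite (le_trans (ler_norm _))// lerDl.
have [dpsi cD _] := psi1.
pose q1 := 'D_(1, 0) psi; pose q2 := 'D_(0, 1) psi.
have T : testfun N (fun p => psi p.1) (fun p => q1 p.1) (fun p => q2 p.1) (fun=> 0) by exact: tpsi.
have k1 := half_key fA hA N0' T (cD _) (cD _).
have k2 := half_key hA fA N0' T (cD _) (cD _).
have [fH mf [Gf Gf0 gfG] fgf] := fA; have [hH mh [Gh Gh0 ghG] hgh] := hA.
have cf := half_holder_continuous fH; have ch := half_holder_continuous hH.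
have cpsi : continuous psi by move=> v; exact: differentiable_continuous.
have bf := @bdm_continuous_plane _ N _ cf; have bh := @bdm_continuous_plane _ N _ ch.
have bpsi := @bdm_continuous_plane _ N _ cpsi.
have bq1 : bdm (box N) q1 by exact: bdm_continuous_plane (cD _).
have bq2 : bdm (box N) q2 by exact: bdm_continuous_plane (cD _).
have bgf : bdm (box N) gf by split; [exact: measurable_funTS|exists Gf].
have bgh : bdm (box N) gh by split; [exact: measurable_funTS|exists Gh].
have d1 v : is_derive v.1 1 (fun x => psi (x, v.2)) (q1 v).
  have := @plane_chain _ psi (fun t => t) (fun=> v.2) v.1 _ _ (dpsi _) (der_id v.1) (der_cst v.2 v.1).
  by move=> hd; apply: (der_eq hd); case: (v).
have d2 v : is_derive v.2 1 (fun x => psi (v.1, x)) (q2 v).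
  have := @plane_chain _ psi (fun=> v.1) (fun t => t) v.2 _ _ (dpsi _) (der_cst v.1 v.2) (der_id v.2).
  by move=> hd; apply: (der_eq hd); case: (v).
have out v : ~ box N v -> [/\ psi v = 0, q1 v = 0 & q2 v = 0].
  move=> /off_box ov; have [_ _ _ _ o] := T.
  by have [? ? ? _] := o v 0 ov.
have wf := weak_gradient_box fgf bf bgf d1 d2 (cD _) (cD _) bpsi bq1 bq2 out.
have wh := weak_gradient_box hgh bh bgh d1 d2 (cD _) (cD _) bpsi bq1 bq2 out.
have bi1 := bdm_ind (box N) cf ch; have bi2 := bdm_ind (box N) ch cf.
have bsq (u : plane R -> R) : bdm (box N) u -> bdm (box N) (fun v => - u v * q1 v + u v ^+ 2 / 2 * q2 v).
  move=> bu; apply: bdmD; first by apply: bdmM => //; exact: bdmN.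
  by apply: bdmM => //; apply: bdmM; [exact: bdmX|exact: bdm_cst].
have bw u u' : bdm (box N) u -> bdm (box N) u' -> bdm (box N) (fun v => (u' v - u v) * q1 v - (u' v ^+ 2 - u v ^+ 2) / 2 * q2 v).
  move=> bu bu'; apply: bdmB; first by apply: bdmM => //; exact: bdmB.
  by apply: bdmM => //; apply: bdmM; [apply: bdmB; exact: bdmX|exact: bdm_cst].
have E1 : \int[leb2]_(v in box N) (gh v * psi v) - \int[leb2]_(v in box N) (gf v * psi v) =
  \int[leb2]_(v in box N) (- h v * q1 v + h v ^+ 2 / 2 * q2 v) -
  \int[leb2]_(v in box N) (- f v * q1 v + f v ^+ 2 / 2 * q2 v) by rewrite wf wh.
(* Pointwise this is a trichotomy: exactly one of the three indicators is nonzero. *)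
have S : \int[leb2]_(v in box N) ((f v == h v)%R%:R * psi v * (gh v - gf v)) =
  (\int[leb2]_(v in box N) (gh v * psi v) - \int[leb2]_(v in box N) (gf v * psi v))
  - (\int[leb2]_(v in box N) (- h v * q1 v + h v ^+ 2 / 2 * q2 v) -
  \int[leb2]_(v in box N) (- f v * q1 v + f v ^+ 2 / 2 * q2 v))
  - ((\int[leb2]_(v in box N) ((f v < h v)%R%:R * psi v * gh v) -
  \int[leb2]_(v in box N) ((f v < h v)%R%:R * psi v * gf v) +
  \int[leb2]_(v in box N) ((f v < h v)%R%:R * ((h v - f v) * q1 v - (h v ^+ 2 - f v ^+ 2) / 2 * q2 v)))
  - (\int[leb2]_(v in box N) ((h v < f v)%R%:R * psi v * gf v) -
  \int[leb2]_(v in box N) ((h v < f v)%R%:R * psi v * gh v) +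
  \int[leb2]_(v in box N) ((h v < f v)%R%:R * ((f v - h v) * q1 v - (f v ^+ 2 - h v ^+ 2) / 2 * q2 v)))).
  have b1 := bdmM bgh bpsi; have b2 := bdmM bgf bpsi; have b3 := bsq _ bh; have b4 := bsq _ bf.
  have b5 := bdmM (bdmM bi1 bpsi) bgh; have b6 := bdmM (bdmM bi1 bpsi) bgf.
  have b7 := bdmM bi1 (bw _ _ bf bh).
  have b8 := bdmM (bdmM bi2 bpsi) bgf; have b9 := bdmM (bdmM bi2 bpsi) bgh.
  have b10 := bdmM bi2 (bw _ _ bh bf).
  have b12 := bdmB b1 b2; have b34 := bdmB b3 b4; have b56 := bdmB b5 b6; have b567 := bdmD b56 b7.
  have b89 := bdmB b8 b9; have b890 := bdmD b89 b10.
  rewrite -(IntB b1 b2) -(IntB b3 b4) -(IntB b5 b6) -(IntD b56 b7) -(IntB b8 b9) -(IntD b89 b10).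
  rewrite -(IntB b12 b34) -(IntB b567 b890) -(IntB (bdmB b12 b34) (bdmB b567 b890)).
  apply: eq_Rintegral => v _; move: (q1 v) (q2 v) (psi v) (gf v) (gh v) => x1 x2 x3 x4 x5.
  by case: (ltgtP (f v) (h v)) => [fh|fh|->]; rewrite /= ?mulr1n ?mulr0n; field.
by rewrite S k1 k2 E1; ring.
Qed.

(** Provides a representative for [f] that coincides with [gh] everywhere on {f = h}, so that there
    the energy densities agree point by point. *)
Lemma merged_gradient : weak_gradient f (fun v => if f v == h v then gh v else gf v).
Proof.
move=> psi psi1.
have [fH mf [Gf Gf0 gfG] fgf] := fA; have [hH mh [Gh Gh0 ghG] hgh] := hA.
rewrite -fgf//.
have [N0 tpsi] := testfun_plane psi1; have [N1 N10 E] := equal_gradients psi1.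
pose N := Num.max N0 N1.
have cpsi : continuous psi by case: psi1 => d _ _ v; exact: differentiable_continuous.
have bpsi := @bdm_continuous_plane _ N _ cpsi.
have bgf : bdm (box N) gf by split; [exact: measurable_funTS|exists Gf].
have bgh : bdm (box N) gh by split; [exact: measurable_funTS|exists Gh].
have cf := half_holder_continuous fH; have ch := half_holder_continuous hH.
have bi : bdm (box N) (fun v => (f v == h v)%R%:R : R).
  have := bdmB (bdmB (bdm_cst (box N) 1) (bdm_ind (box N) cf ch)) (bdm_ind (box N) ch cf).
  congr (bdm _ _); apply/funext => v /=.
  by case: (ltgtP (f v) (h v)); rewrite ?subr0 ?subrr ?sub0r ?subrr.
have out v : ~ box N v -> psi v = 0.
  have [_ _ _ _ o] : testfun N (fun p => psi p.1) (fun p => 'D_(1, 0) psi p.1)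
    (fun p => 'D_(0, 1) psi p.1) (fun=> 0) by apply: tpsi; rewrite le_max lexx.
  by move=> /off_box ov; have [] := o v 0 ov.
have b1 := bdmM (bdmM bi bpsi) (bdmB bgh bgf); have b2 := bdmM bgf bpsi.
rewrite (@integral_vanish _ _ _ leb2 (box N) _ (measurable_box N) (box_fin N) b2); last first.
  by move=> v /out ->; rewrite mulr0.
transitivity ((\int[leb2]_(v in box N) ((f v == h v)%R%:R * psi v * (gh v - gf v) + gf v * psi v))%:E)%E.
  rewrite -(@integral_vanish _ _ _ leb2 (box N) _ (measurable_box N) (box_fin N) (bdmD b1 b2)); last first.
    by move=> v /out ->; rewrite !mulr0 mul0r addr0.
  apply: eq_integral => v _; congr (_%:E); move: (psi v) (gf v) (gh v) => x1 x2 x3.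
  by case: eqP => _; rewrite /= ?mulr1n ?mulr0n; ring.
by rewrite (IntD b1 b2) E ?add0r// le_max lexx orbT.
Qed.

End locality.

End admissible.

(** * The divergence theorem between two graphs *)

Section divergence.
Context {R : realType}.
Notation L1 := (@lebesgue_measure R).
Implicit Types (v w : plane R) (f g h : plane R -> R).

Lemma Rintegral_affine (G : R -> R) (a b : R) : continuous G -> a < b ->
  \int[L1]_(x in `[a, b]) G x = \int[L1]_(t in `[0, 1]) ((b - a) * G (a + t * (b - a))).
Proof.
move=> cG ab; pose F (t : R) := a + t * (b - a).
have dF (t : R) : is_derive t 1 F (b - a).
  have := derD (der_cst a t) (derM (der_id t) (der_cst (b - a) t)).
  by move=> hd; apply: (der_eq hd); ring.
have F' : derive1 F = fun=> b - a by apply/funext => t; rewrite derive1E; exact: derive_val.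
have cF : continuous F by exact: der_continuous dF.
have F0 : F 0 = a by rewrite /F mul0r addr0.
have F1 : F 1 = b by rewrite /F mul1r addrCA subrr addr0.
rewrite /Rintegral; congr fine.
have := @integration_by_substitution_increasing R F G 0 1 ler01.
rewrite F0 F1 F' => -> //.
- by apply: eq_integral => t _; rewrite /F/= mulrC.
- by move=> x y _ _ xy; rewrite /F ltrD2l ltr_pM2r// subr_gt0.
- by move=> x _; exact: cvg_cst.
- exact: is_cvg_cst.
- exact: is_cvg_cst.
- split; first by move=> x _; case: (dF x).
  + by apply: cvg_at_right_filter; exact: cF.
  + by apply: cvg_at_left_filter; exact: cF.
- exact: continuous_subspaceT.
Qed.

Definition region f h : set (heis R) := [set p | f (vproj p) < hy p /\ hy p < h (vproj p)].

Lemma vproj_continuous : continuous (@vproj R).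
Proof.
have c11 : continuous (fun p : heis R => p.1.1).
  by move=> p; apply: (@continuous_comp _ _ _ fst fst); exact: cvg_fst.
have c12 : continuous (fun p : heis R => p.1.2).
  by move=> p; apply: (@continuous_comp _ _ _ fst snd); [exact: cvg_fst|exact: cvg_snd].
have c2 : continuous (fun p : heis R => p.2) by move=> p; exact: cvg_snd.
have ch : continuous (fun _ : heis R => 2^-1 : R) by move=> p; exact: cvg_cst.
exact: (continuous_pair c11 (contB c2 (contM (contM c11 c12) ch))).
Qed.

Lemma hy_continuous : continuous (@hy R).
Proof.
by move=> p; apply: (@continuous_comp _ _ _ fst snd); [exact: cvg_fst|exact: cvg_snd].
Qed.

Lemma open_ltfun (T : topologicalType) (F G : T -> R) : continuous F -> continuous G ->
  open [set x | F x < G x].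
Proof.
move=> cF cG; have -> : [set x | F x < G x] = (fun x => G x - F x) @^-1` [set t | 0 < t].
  by apply/seteqP; split=> x /=; rewrite subr_gt0.
by apply: open_comp; [move=> x _; exact: (contB cG cF)|exact: open_gt].
Qed.

Lemma region_open f h : continuous f -> continuous h -> open (region f h).
Proof.
move=> cf ch; apply: openI; apply: open_ltfun.
- exact: contComp vproj_continuous cf.
- exact: hy_continuous.
- exact: hy_continuous.
- exact: contComp vproj_continuous ch.
Qed.

Lemma vproj_chart (p : heis R) : vproj (chart p) = p.1.
Proof. by case: p => -[x z] t; rewrite /vproj /chart /hx /hy /hz/=; congr (_, _); ring. Qed.

Lemma slabD N (F G : heis R -> R) : bdm (slab N) F -> bdm (slab N) G ->
  \int[leb3]_(p in slab N) (F p + G p) = \int[leb3]_(p in slab N) F p + \int[leb3]_(p in slab N) G p.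
Proof.
move=> bF bG; have mS := @measurable_slab R N.
by rewrite RintegralD//; apply: bdm_integrable => //; exact: slab_fin.
Qed.

Section formula.
Variables (V1 V2 : heis R -> R) (f h gf gh : plane R -> R).
Hypotheses (C1 : Cc1 V1) (C2 : Cc1 V2) (fA : admissible f gf) (hA : admissible h gh).

Let cf : continuous f. Proof. by case: fA => /half_holder_continuous. Qed.
Let ch : continuous h. Proof. by case: hA => /half_holder_continuous. Qed.

Lemma hdiv_continuous : continuous (hdiv V1 V2).
Proof.
have [d1 c1 _] := C1; have [d2 c2 _] := C2.
rewrite (_ : hdiv V1 V2 = fun p => (1 * 'D_(1, 0, 0) V1 p + 0 * 'D_(0, 1, 0) V1 p + - (hy p * 2^-1) * 'D_(0, 0, 1) V1 p) +
  (0 * 'D_(1, 0, 0) V2 p + 1 * 'D_(0, 1, 0) V2 p + (hx p * 2^-1) * 'D_(0, 0, 1) V2 p)); last first.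
  by apply/funext => p; rewrite /hdiv /Xfield /Yfield (heis_derive 1 0 (- (hy p / 2)) (d1 p)) (heis_derive 0 1 (hx p / 2) (d2 p)).
have cc (c : R) : continuous (fun _ : heis R => c) by move=> p; exact: cvg_cst.
have cx : continuous (@hx R).
  by move=> p; apply: (@continuous_comp _ _ _ fst fst); exact: cvg_fst.
have ny : continuous (fun p : heis R => - (hy p * 2^-1)).
  by move=> p; apply: cvgN; exact: (contM hy_continuous (cc 2^-1)).
exact: (contD (contD (contD (contM (cc 1) (c1 (1, 0, 0))) (contM (cc 0) (c1 (0, 1, 0))))
    (contM ny (c1 (0, 0, 1))))
  (contD (contD (contM (cc 0) (c2 (1, 0, 0))) (contM (cc 1) (c2 (0, 1, 0))))
    (contM (contM cx (cc 2^-1)) (c2 (0, 0, 1))))).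
Qed.

Let Xi (p : heis R) := tf1 V1 p - p.2 * tf2 V1 p + tf3 V2 p.
Let A : set (heis R) := [set p | f p.1 < p.2 /\ p.2 < h p.1].

Let hdiv_chart p : hdiv V1 V2 (chart p) = Xi p.
Proof. by rewrite /hdiv /Xi tf_Xfield// tf_Yfield. Qed.

Let cXi : continuous Xi.
Proof.
have [_ c1 c2 _] := tf_continuous C1; have [_ _ _ c3] := tf_continuous C2.
have cs : continuous (fun p : heis R => p.2) by move=> p; exact: cvg_snd.
exact: (contD (contB c1 (contM cs c2)) c3).
Qed.

Let mA : measurable A.
Proof.
have c1 : continuous (fun p : heis R => p.1) by move=> p; exact: cvg_fst.
have cs : continuous (fun p : heis R => p.2) by move=> p; exact: cvg_snd.
apply: heis_open_measurable; apply: openI; apply: open_ltfun => //.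
  exact: contComp c1 cf.
exact: contComp c1 ch.
Qed.

Let edge (v : plane R) := tf0 V2 (v, h v) - tf0 V2 (v, f v).

Let at_graph (psi : heis R -> R) (u : plane R -> R) : continuous psi -> continuous u ->
  continuous (fun v => psi (v, u v)).
Proof.
move=> cpsi cu; have ci : continuous (fun v : plane R => v) by move=> y; exact: cvg_id.
exact: contComp (continuous_pair ci cu) cpsi.
Qed.

Let at_point (psi : heis R -> R) v : continuous psi -> continuous (fun t : R => psi (v, t)).
Proof.
move=> cpsi; have ci : continuous (fun t : R => t) by move=> y; exact: cvg_id.
have cc : continuous (fun _ : R => v) by move=> y; exact: cvg_cst.
exact: contComp (continuous_pair cc ci) cpsi.
Qed.

(** Along a fibre Y is d/dt and integrates to the difference [edge] of the end values, whereas the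
    X-derivative is only brought to the form [limit_bulk]. *)
Let inner (T : R) v : `|f v| <= T -> `|h v| <= T ->
  \int[L1]_(t in `[(- T), T]) (Xi \_ A) (v, t) =
  \int[L1]_(t in `[0, 1]) (limit_bulk f h (tf1 V1) (tf2 V1) (v, t) + (f v < h v)%R%:R * edge v).
Proof.
rewrite !ler_norml => /andP[f1 f2] /andP[h1 h2].
have [_ c1 c2 _] := tf_continuous C1; have [c0 _ _ c3] := tf_continuous C2.
rewrite /limit_bulk/=; have [fh|hf] := ltP (f v) (h v); last first.
  rewrite (@eq_Rintegral _ _ _ L1 _ (fun=> 0)); last first.
    by move=> t _ /=; rewrite patchE memNset// => -[/= a b]; move: hf; lra.
  rewrite Rintegral_cst// mul0r (@eq_Rintegral _ _ _ L1 _ (fun=> 0)) ?Rintegral_cst ?mul0r//.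
  by move=> t _ /=; rewrite !mul0r addr0.
pose S : set R := `]f v, h v[%classic.
have SE : S `<=` `[(- T), T]%classic.
  by move=> t; rewrite /S/= !in_itv/= => /andP[? ?]; apply/andP; split; lra.
rewrite (@Rintegral_subset _ _ _ L1 S)//; last first.
  move=> t _ nS /=; rewrite patchE memNset// => -[/= a b]; apply: nS.
  by rewrite /S/= in_itv/= a b.
rewrite (@eq_Rintegral _ _ _ L1 _ (fun t => Xi (v, t))); last first.
  move=> t /set_mem; rewrite /S/= in_itv/= => /andP[a b].
  by rewrite patchE mem_set.
have cXv := @at_point _ v cXi.
have itg (F : R -> R) (a b : R) : continuous F -> L1.-integrable `[a, b] (EFin \o F).
  move=> cF; apply: continuous_compact_integrable; first exact: segment_compact.
  exact: continuous_subspaceT.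
have iX := itg _ (f v) (h v) cXv.
rewrite /S Rintegral_itv_obnd_cbnd; last first.
  by apply: integrableS iX => // x /=; rewrite !in_itv/= => /andP[/ltW -> /ltW ->].
rewrite Rintegral_itv_bndo_bndc; last first.
  by apply: integrableS iX => // x /=; rewrite !in_itv/= => /andP[-> /ltW ->].
have cX : continuous (fun t => tf1 V1 (v, t) - t * tf2 V1 (v, t)).
  have ci : continuous (fun x : R => x) by move=> x; exact: cvg_id.
  exact: (contB (@at_point _ v c1) (contM ci (@at_point _ v c2))).
have c3v := @at_point _ v c3.
transitivity (\int[L1]_(t in `[f v, h v]) (tf1 V1 (v, t) - t * tf2 V1 (v, t)) +
  \int[L1]_(t in `[f v, h v]) tf3 V2 (v, t)).
  by rewrite -RintegralD//; exact: itg.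
have [N1 /(_ N1 (lexx _)) [_ _ _ d3 _]] := testfun_heis C2.
rewrite (Rintegral_affine cX fh) (@Rintegral_derive _ _ _ _ _ fh (d3 v) c3v).
set w := h v - f v; have cc (c : R) : continuous (fun _ : R => c) by move=> x; exact: cvg_cst.
have ci : continuous (fun x : R => x) by move=> x; exact: cvg_id.
rewrite RintegralD//; last exact: itg.
- congr (_ + _).
    by apply: eq_Rintegral => t _; rewrite mulr1n mul1r.
  rewrite Rintegral_cst// mulr1n mul1r -[LHS]mulr1; congr (_ * _).
  have itv1 : L1 `[0%R, 1%R]%classic = 1%E.
    by rewrite lebesgue_measure_itv/= lte_fin ltr01 -EFinB subr0.
  exact: (esym (congr1 fine itv1)).
- apply: itg; apply: (contM (cc (1 * w))).
  have cm := contD (cc (f v)) (contM ci (cc w)).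
  exact: (contB (contComp cm (@at_point _ v c1)) (contM cm (contComp cm (@at_point _ v c2)))).
Qed.

(** In the chart, [V2] contributes by the fundamental theorem of calculus on fibres, and [V1]
    through [key_admissible], which trades the interior term for integrals over the two graphs. The
    threshold [N0] makes the box contain both supports. *)
Lemma divergence_formula : exists N0 : R, forall N, N0 <= N -> 0 < N ->
  (\int[leb3]_(p in region f h) (hdiv V1 V2 p)%:E =
   (\int[leb2]_(v in box N) ((f v < h v)%R%:R * (gf v * tf0 V1 (v, f v) - tf0 V2 (v, f v)) +
      (f v < h v)%R%:R * (tf0 V2 (v, h v) - gh v * tf0 V1 (v, h v))))%:E)%E.
Proof.
have [N1 t1] := testfun_heis C1; have [N2 t2] := testfun_heis C2.
exists (Num.max N1 N2) => N; rewrite ge_max => /andP[/t1 {}t1 /t2 {}t2] N0.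
have [Mf0 [Mf fM]] := @bdm_continuous_plane _ N _ cf.
have [Mh0 [Mh hM]] := @bdm_continuous_plane _ N _ ch.
pose T := `|Mf| + `|Mh|.
have fT v : box N v -> `|f v| <= T.
  by move=> /fM /le_trans; apply; rewrite (le_trans (ler_norm _))// lerDl.
have hT v : box N v -> `|h v| <= T.
  by move=> /hM /le_trans; apply; rewrite (le_trans (ler_norm _))// lerDr.
pose D : set (heis R) := box N `*` `[- T, T]%classic.
have TI : (L1 `[(- T)%R, T]%classic < +oo)%E by exact: itv_fin.
have mD : measurable D by apply: measurableX; [exact: measurable_box|exact: measurable_itv].
have fD : (leb3 D < +oo)%E.
  exact: (@rect_fin _ _ _ _ _ (@sleb2 R) L1 (box N) `[- T, T]%classic
    (measurable_box N) (measurable_itv _) (box_fin N) TI).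
have cD : compact D by apply: compact_setX; [exact: compact_box|exact: segment_compact].
have bD : bdm D (Xi \_ A).
  split.
    have mXi : measurable_fun A Xi.
      exact: (measurable_funTS (@heis_continuous_measurable R Xi cXi)).
    exact: (measurable_funTS ((measurable_restrictT Xi mA).1 mXi)).
  have /compact_bounded[M [_ FM]] : compact (Xi @` D).
    by apply: continuous_compact => //; exact: continuous_subspaceT.
  exists (`|M| + 1) => p Dp; rewrite patchE; case: ifP => _; last by rewrite normr0 addr_ge0.
  apply: (FM (`|M| + 1)); last by exists p.
  by rewrite ltr_pwDr// ler_norm.
transitivity (\int[leb3]_p ((Xi \_ A) p)%:E)%E.
  have mreg : measurable (region f h) := heis_open_measurable (region_open cf ch).
  rewrite integral_mkcond -[LHS](@integral_heis_chart R); last first.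
    have md : measurable_fun (region f h) (EFin \o hdiv V1 V2).
      apply/measurable_EFinP.
      exact: (measurable_funTS (@heis_continuous_measurable R _ hdiv_continuous)).
    exact: ((measurable_restrictT _ mreg).1 md).
  apply: eq_integral => p _; rewrite !patchE.
  have -> : (heis_chart p \in region f h) = (p \in A).
    by rewrite -[heis_chart p]/(chart p); apply/idP/idP => /set_mem [a b]; apply/mem_set; split;
      move: a b; rewrite /hy vproj_chart.
  by case: ifP => // _; rewrite -hdiv_chart.
rewrite (@integral_vanish _ _ _ leb3 D _ mD fD bD); last first.
  move=> p nD; rewrite patchE; case: ifP => // /set_mem [a b].
  have [bp|/off_box op] := pselect (box N p.1).
    exfalso; apply: nD; split=> //=; rewrite in_itv/=.
    by have := fT _ bp; have := hT _ bp; rewrite !ler_norml => /andP[? ?] /andP[? ?]; apply/andP; split; lra.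
  have [_ _ _ _ o1] := t1; have [_ _ _ _ o2] := t2.
  have [_ x1 x2 _] := o1 _ p.2 op; have [_ _ _ x3] := o2 _ p.2 op.
  by rewrite /Xi (surjective_pairing p) x1 x2 x3 mulr0 subr0 addr0.
congr (_%:E).
rewrite (@rect_Fubini1 _ _ _ _ _ (@sleb2 R) L1 (box N) `[- T, T]%classic _
    (measurable_box N) (measurable_itv _) (box_fin N) TI bD).
have [c0 c1 c2 _] := tf_continuous C1; have [c0' _ _ c3] := tf_continuous C2.
have ce : continuous edge by exact: (contB (at_graph c0' ch) (at_graph c0' cf)).
have bi := bdm_ind (box N) cf ch.
have be : bdm (box N) (fun v => (f v < h v)%R%:R * edge v).
  by apply: bdmM => //; exact: bdm_continuous_plane ce.
have bB := limit_bulk_bdm N cf ch c1 c2.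
transitivity (\int[leb2]_(v in box N) \int[L1]_(t in `[0, 1])
  (limit_bulk f h (tf1 V1) (tf2 V1) (v, t) + (f v < h v)%R%:R * edge v)).
  by apply: eq_Rintegral => v /set_mem Nv; rewrite (inner (fT _ Nv) (hT _ Nv)).
rewrite -(@slab_Fubini1 R N (fun p => limit_bulk f h (tf1 V1) (tf2 V1) p + (f p.1 < h p.1)%R%:R * edge p.1)); last first.
  by apply: bdmD => //; exact: (bdm_slab_fst be).
rewrite (slabD bB (bdm_slab_fst be)).
rewrite (slab_cst be).
have K := key_admissible fA hA N0 t1.
have [_ mf [Gf Gf0 gfG] _] := fA; have [_ mh [Gh Gh0 ghG] _] := hA.
have bgf : bdm (box N) gf by split; [exact: measurable_funTS|exists Gf].
have bgh : bdm (box N) gh by split; [exact: measurable_funTS|exists Gh].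
have b0f := @bdm_continuous_plane _ N _ (at_graph c0 cf).
have b0h := @bdm_continuous_plane _ N _ (at_graph c0 ch).
have bf := bdmM (bdmM bi b0f) bgf; have bh := bdmM (bdmM bi b0h) bgh.
have := bdmD (bdmB bf bh) be => bE.
transitivity (\int[leb2]_(v in box N) ((f v < h v)%R%:R * tf0 V1 (v, f v) * gf v -
  (f v < h v)%R%:R * tf0 V1 (v, h v) * gh v + (f v < h v)%R%:R * edge v)).
  rewrite (IntD (bdmB bf bh) be) (IntB bf bh); congr (_ + _).
  by move: K; set X := \int[leb3]_(_ in _) _; lra.
by apply: eq_Rintegral => v _; rewrite /edge; ring.
Qed.

End formula.

End divergence.

(** * Perimeter and flux *)

Section restricted_measure.
Local Open Scope ereal_scope.
Context d (T : measurableType d) {R : realType} (mu : {measure set T -> \bar R}) (S : set T) (mS : measurable S).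

Lemma ge0_integral_mrestr (f : T -> \bar R) : measurable_fun setT f -> (forall x, 0 <= f x) ->
  \int[mrestr mu mS]_x f x = \int[mu]_(x in S) f x.
Proof.
move=> mf f0; have mSC : measurable (~` S) by exact: measurableC.
rewrite (ge0_negligible_integral (mu := mrestr mu mS) mSC measurableT mf)//; last first.
  by rewrite -[LHS]/(mu (~` S `&` S)) setICl measure0.
rewrite setTD setCK; apply: eq_measure_integral => A mA AS.
by rewrite -[LHS]/(mu (A `&` S)) (setIidl AS).
Qed.

Lemma integral_mrestr (f : T -> \bar R) : measurable_fun setT f ->
  \int[mrestr mu mS]_x f x = \int[mu]_(x in S) f x.
Proof.
move=> mf; rewrite [LHS]integralE [RHS]integralE !ge0_integral_mrestr//.
- exact: measurable_funeneg.
- exact: measurable_funepos.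
Qed.

Lemma integrable_mrestr (f : T -> \bar R) : measurable_fun setT f ->
  mu.-integrable S f -> (mrestr mu mS).-integrable setT f.
Proof.
move=> mf /integrableP[_ fS]; apply/integrableP; split=> //.
by rewrite ge0_integral_mrestr//; exact: measurableT_comp.
Qed.

End restricted_measure.

(** * Measures carried by graphs *)

Section surface.
Context {R : realType}.
Notation L1 := (@lebesgue_measure R).
Notation mR := (measurableTypeR R).
Implicit Types (v : plane R).
Variables (D : set (plane R)) (N K : R) (u k : plane R -> R).
Hypotheses (mD : measurable D) (DN : D `<=` box N) (cu : continuous u)
  (mk : measurable_fun setT k) (k0 : forall v, 0 <= k v) (kK : forall v, k v <= K).

Definition subgraph : set (heis R) := [set p | D p.1 /\ 0 <= p.2 /\ p.2 <= k p.1].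

Lemma measurable_subgraph : measurable subgraph.
Proof.
have -> : subgraph = D `*` setT `&` ((fun p : heis R => p.2) @^-1` `[0, +oo[ `&`
  (fun p : heis R => k p.1 - p.2) @^-1` `[0, +oo[).
  apply/seteqP; split=> p /=; rewrite /subgraph/= !in_itv/= !andbT subr_ge0.
    by move=> [? [? ?]].
  by move=> [[? _] [? ?]].
have m2 : measurable_fun setT (fun p : heis R => p.2) by exact: measurable_snd.
have m1 : measurable_fun setT (fun p : heis R => k p.1).
  by apply: (measurableT_comp mk); exact: measurable_fst.
apply: measurableI; first exact: measurableX.
apply: measurableI; rewrite -[X in measurable X]setTI.
  by apply: m2 => //; exact: measurable_itv.
by apply: (measurable_funB m1 m2) => //; exact: measurable_itv.
Qed.

Definition graph_point (v : plane R) : heis R := chart (v, u v).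

Let param (p : mR * mR * mR) : heis R := graph_point p.1.

Lemma measurable_param : measurable_fun setT param.
Proof.
have m1 : measurable_fun setT (fun p : heis R => p.1) by exact: measurable_fst.
have mu' : measurable_fun setT (fun p : heis R => u p.1).
  by apply: (measurableT_comp (plane_continuous_measurable cu)).
exact: (measurableT_comp (@measurable_heis_chart R) (measurable_fun_pair m1 mu')).
Qed.

(* The measure k dv carried by the graph of u, as the image of the volume of the
   subgraph of k. *)
Definition surface : {measure set (heis R) -> \bar R} :=
  @measure_function_pushforward__canonical__measure_function_Measure _ _ _ _ R
    (mrestr (@leb3 R) measurable_subgraph) param measurable_param.

Section integrals.
Variables (phi : heis R -> R) (M : R).
Hypotheses (mphi : measurable_fun setT phi) (phiM : forall v, D v -> `|phi (graph_point v)| <= M).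

Let G := (phi \o param) \_ subgraph.
Let Q : set (heis R) := box N `*` `[0, K]%classic.

Let K0 : 0 <= K. Proof. by rewrite (le_trans (k0 0)). Qed.

Let mG : measurable_fun setT G.
Proof.
have mg : measurable_fun subgraph (phi \o param).
  by apply: measurable_funTS; exact: (measurableT_comp mphi measurable_param).
exact: ((measurable_restrictT _ measurable_subgraph).1 mg).
Qed.

Let IK : (L1 `[0%R, K]%classic < +oo)%E.
Proof. by rewrite lebesgue_measure_itv/=; case: ifP => _; rewrite ?ltry// -EFinB ltry. Qed.

Let mQ : measurable Q.
Proof. by apply: measurableX; [exact: measurable_box|exact: measurable_itv]. Qed.

Let fQ : (leb3 Q < +oo)%E.
Proof.
exact: (@rect_fin _ _ _ _ _ (@sleb2 R) L1 (box N) `[0, K]%classic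
    (measurable_box N) (measurable_itv _) (box_fin N) IK).
Qed.

Let SQ : subgraph `<=` Q.
Proof.
move=> p [Dp [p0 pk]]; split; first exact: DN.
by rewrite /= in_itv/= p0 (le_trans pk).
Qed.

Let bG : bdm Q G.
Proof.
split; first exact: measurable_funTS.
exists `|M| => p _; rewrite /G patchE; case: ifPn => [/set_mem[Dp _]|_]; last by rewrite normr0.
by rewrite (le_trans (phiM Dp))// ler_norm.
Qed.

Let bS : bdm subgraph (phi \o param).
Proof.
split; first by apply: measurable_funTS; exact: (measurableT_comp mphi measurable_param).
by exists M => p [Dp _]; exact: phiM.
Qed.

Let fS : (leb3 subgraph < +oo)%E.
Proof.
apply: le_lt_trans fQ; apply: le_measure => //; rewrite inE//; exact: measurable_subgraph.
Qed.

Lemma surface_integrable : surface.-integrable setT (EFin \o phi).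
Proof.
have me : measurable_fun setT (EFin \o phi) by exact/measurable_EFinP.
apply: (integrable_pushforward measurable_param me) => //.
apply: integrable_mrestr; first by apply/measurable_EFinP; exact: (measurableT_comp mphi measurable_param).
exact: (@bdm_integrable _ _ _ leb3 _ measurable_subgraph fS _ bS).
Qed.

(** The fibre of the subgraph over v has length k v, and along it the integrand is constant. *)
Lemma surface_integral :
  (\int[surface]_p (phi p)%:E = (\int[leb2]_(v in box N) ((v \in D)%:R * (k v * phi (graph_point v))))%:E)%E.
Proof.
have me : measurable_fun setT (EFin \o phi) by exact/measurable_EFinP.
have ml : measurable_fun setT (EFin \o (phi \o param)).
  by apply/measurable_EFinP; exact: (measurableT_comp mphi measurable_param).
rewrite (integral_pushforward measurable_param me)//; last first.
  apply: integrable_mrestr => //.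
  exact: (@bdm_integrable _ _ _ leb3 _ measurable_subgraph fS _ bS).
rewrite preimage_setT (integral_mrestr _ _ ml).
transitivity (\int[leb3]_p (G p)%:E)%E.
  by rewrite integral_mkcond; apply: eq_integral => p _; rewrite /G !patchE; case: ifP.
rewrite (@integral_vanish _ _ _ leb3 Q _ mQ fQ bG); last first.
  by move=> p nQ; rewrite /G patchE memNset// => /SQ.
congr (_%:E).
rewrite (@rect_Fubini1 _ _ _ _ _ (@sleb2 R) L1 (box N) `[0, K]%classic _
    (measurable_box N) (measurable_itv _) (box_fin N) IK bG).
apply: eq_Rintegral => v _; case: (boolP (v \in D)) => [/set_mem Dv|nDv]; last first.
  rewrite mul0r (@eq_Rintegral _ _ _ L1 _ (fun=> 0)) ?Rintegral_cst ?mul0r//.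
  by move=> s _; rewrite /G patchE memNset// => -[/= /mem_set]; rewrite (negPf nDv).
rewrite (@Rintegral_subset _ _ _ L1 `[0, k v]%classic); first last.
- move=> s _ ns; rewrite /G patchE memNset// => -[/= _ [s0 sk]]; apply: ns.
  by rewrite /= in_itv/= s0.
- by move=> s; rewrite /= !in_itv/= => /andP[-> /le_trans]; apply.
rewrite (@eq_Rintegral _ _ _ L1 _ (fun=> phi (graph_point v))); last first.
  move=> s /set_mem; rewrite /= in_itv/= => /andP[s0 sk].
  by rewrite /G patchE mem_set.
rewrite Rintegral_cst// mul1r mulrC; congr (_ * _).
have kv : L1 `[0%R, k v]%classic = (k v)%:E.
  rewrite lebesgue_measure_itv/= lte_fin; have [_|] := ltP 0 (k v); first by rewrite -EFinB subr0.
  by move=> kv; congr (_%:E); apply/eqP; rewrite eq_le k0.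
exact: (congr1 fine kv).
Qed.

End integrals.

End surface.

Section slope.
Context {R : realType}.
Implicit Types (s : R).

(** The density, with respect to Lebesgue measure on V_0, of the perimeter of an intrinsic graph
    whose gradient is s. *)
Definition area_factor s : R := Num.sqrt (1 + s ^+ 2).

Lemma area_factor_gt0 s : 0 < area_factor s.
Proof. by rewrite sqrtr_gt0 ltr_pwDl// sqr_ge0. Qed.

Lemma area_factor_sqr s : area_factor s ^+ 2 = 1 + s ^+ 2.
Proof. by rewrite sqr_sqrtr// addr_ge0// sqr_ge0. Qed.

Lemma area_factor_le s : area_factor s <= 1 + `|s|.
Proof.
have a0 := ltW (area_factor_gt0 s).
rewrite -(@ler_pXn2r _ 2)// ?nnegrE ?addr_ge0//.
rewrite area_factor_sqr; have := real_normK (num_real s); have := normr_ge0 s.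
by move: `|s| => a a1 <-; nra.
Qed.

Lemma area_factor_continuous : continuous area_factor.
Proof.
have cc (c : R) : continuous (fun _ : R => c) by move=> x; exact: cvg_cst.
have ci : continuous (fun x : R => x) by move=> x; exact: cvg_id.
have c2 : continuous (fun s => 1 + s ^+ 2) by exact: (contD (cc 1) (contM ci ci)).
exact: contComp c2 (@sqrt_continuous R).
Qed.

Lemma area_factorV_continuous : continuous (fun s => (area_factor s)^-1).
Proof.
move=> s; apply: cvgV; first by rewrite gt_eqF// area_factor_gt0.
exact: area_factor_continuous.
Qed.

End slope.

Lemma Cc1_bounded {R : realType} (V : heis R -> R) : Cc1 V -> exists M, forall p, `|V p| <= M.
Proof.
move=> V1; have [_ _ cK] := V1; have cV := Cc1_continuous V1.
have /compact_bounded[M [_ VM]] : compact (V @` closure [set x | V x != 0]).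
  by apply: continuous_compact => //; exact: continuous_subspaceT.
exists (`|M| + 1) => p; have [Vp|Vp] := eqVneq (V p) 0; first by rewrite Vp normr0 addr_ge0.
apply: (VM (`|M| + 1)); first by rewrite ltr_pwDr// ler_norm.
by exists p => //; apply: subset_closure.
Qed.

(** * Perimeter of the region between two graphs *)

Section perimeter.
Context {R : realType}.
Implicit Types (v : plane R) (p : heis R).
Variables (N : R) (f h gf gh : plane R -> R).
Hypotheses (fA : admissible f gf) (hA : admissible h gh).

Definition gap : set (plane R) := [set v | f v < h v].

Hypothesis gapN : gap `<=` box N.

Let cf : continuous f. Proof. by case: fA => /half_holder_continuous. Qed.
Let ch : continuous h. Proof. by case: hA => /half_holder_continuous. Qed.
Let mf : measurable_fun setT gf. Proof. by case: fA. Qed.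
Let mh : measurable_fun setT gh. Proof. by case: hA. Qed.

Lemma measurable_gap : measurable gap.
Proof. exact: (plane_open_measurable (open_ltfun cf ch)). Qed.

Let kf v := area_factor (gf v).
Let kh v := area_factor (gh v).

Let mkf : measurable_fun setT kf.
Proof. by apply: measurableT_comp mf; exact: continuous_measurable_fun (@area_factor_continuous R). Qed.

Let mkh : measurable_fun setT kh.
Proof. by apply: measurableT_comp mh; exact: continuous_measurable_fun (@area_factor_continuous R). Qed.

Let bkf : exists K, forall v, kf v <= K.
Proof.
have [_ _ [G G0 gG] _] := fA; exists (1 + G) => v.
by rewrite (le_trans (area_factor_le _))// lerD2l.
Qed.

Let bkh : exists K, forall v, kh v <= K.
Proof.
have [_ _ [G G0 gG] _] := hA; exists (1 + G) => v.
by rewrite (le_trans (area_factor_le _))// lerD2l.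
Qed.

(** There is no lateral part: over the boundary of [gap] the two graphs meet. *)
Definition perimeter : {measure set (heis R) -> \bar R} :=
  measure_add (surface measurable_gap cf mkf) (surface measurable_gap ch mkh).

(** Over [gap] the two graphs are disjoint, so the equality test tells them apart; away from both,
    the second formula keeps the vector of unit length. *)
Definition conormal p : plane R := let v := vproj p in
  if hy p == f v then (- gf v / kf v, (kf v)^-1) else (gh v / kh v, - (kh v)^-1).

Let gpf v : vproj (graph_point f v) = v. Proof. exact: vproj_chart. Qed.
Let gph v : vproj (graph_point h v) = v. Proof. exact: vproj_chart. Qed.

Lemma conormal_bot v : conormal (graph_point f v) = (- gf v / kf v, (kf v)^-1).
Proof. by rewrite /conormal gpf /hy /= eqxx. Qed.

Lemma conormal_top v : gap v -> conormal (graph_point h v) = (gh v / kh v, - (kh v)^-1).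
Proof. by move=> fh; rewrite /conormal gph /hy /= gt_eqF. Qed.

Lemma conormal_unit p : (conormal p).1 ^+ 2 + (conormal p).2 ^+ 2 = 1.
Proof.
rewrite /conormal; case: ifP => _ /=.
  have k0 := area_factor_gt0 (gf (vproj p)); have k2 := area_factor_sqr (gf (vproj p)).
  rewrite expr_div_n sqrrN exprVn -[X in _ + X]mul1r -mulrDl k2 addrC divff// gt_eqF//.
  by rewrite ltr_pwDl// sqr_ge0.
have k0 := area_factor_gt0 (gh (vproj p)); have k2 := area_factor_sqr (gh (vproj p)).
rewrite expr_div_n sqrrN exprVn -[X in _ + X]mul1r -mulrDl k2 addrC divff// gt_eqF//.
by rewrite ltr_pwDl// sqr_ge0.
Qed.

Lemma measurable_conormal : measurable_fun setT conormal.
Proof.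
have mv : measurable_fun setT (@vproj R).
  have c : continuous (@vproj R) by exact: vproj_continuous.
  apply: measurable_fun_pair; apply: heis_continuous_measurable.
    have c1 : continuous (fun v : plane R => v.1) by move=> v; exact: cvg_fst.
    exact: contComp c c1.
  have c2 : continuous (fun v : plane R => v.2) by move=> v; exact: cvg_snd.
  exact: contComp c c2.
have my : measurable_fun setT (@hy R) by apply: heis_continuous_measurable; exact: hy_continuous.
have m1 (g : plane R -> R) : measurable_fun setT g -> measurable_fun setT (fun p => g (vproj p)).
  by move=> mg; exact: (measurableT_comp mg mv).
have mV (g : plane R -> R) : measurable_fun setT g ->
    measurable_fun setT (fun p => (area_factor (g (vproj p)))^-1).
  move=> mg; apply: (measurableT_comp (f := fun s : R => (area_factor s)^-1)); last exact: m1.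
  exact: continuous_measurable_fun (@area_factorV_continuous R).
apply: measurable_fun_ifT.
- by apply: measurable_fun_eqr => //; apply: m1; exact: plane_continuous_measurable.
- apply: measurable_fun_pair; last exact: mV.
  by apply: measurable_funM; [apply: measurable_funN; exact: m1|exact: mV].
- apply: measurable_fun_pair; last by apply: measurable_funN; exact: mV.
  by apply: measurable_funM; [exact: m1|exact: mV].
Qed.

Section integral.
Variables (N' : R) (phi : heis R -> R) (M : R).
Hypotheses (NN : N <= N') (mphi : measurable_fun setT phi)
  (phif : forall v, gap v -> `|phi (graph_point f v)| <= M)
  (phih : forall v, gap v -> `|phi (graph_point h v)| <= M).

Let gapN' : gap `<=` box N'.
Proof.
move=> v /gapN; rewrite /box/= !in_itv/= -!ler_norml => -[a b].
by split; [exact: le_trans a NN|exact: le_trans b NN].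
Qed.

Lemma perimeter_integrable : perimeter.-integrable setT (EFin \o phi).
Proof.
have [K kK] := bkf; have [K' kK'] := bkh.
have k0 v : 0 <= kf v by rewrite ltW// area_factor_gt0.
have k0' v : 0 <= kh v by rewrite ltW// area_factor_gt0.
have i1 := surface_integrable measurable_gap gapN' cf mkf kK mphi phif.
have i2 := surface_integrable measurable_gap gapN' ch mkh kK' mphi phih.
apply/integrableP; split; first exact/measurable_EFinP.
rewrite ge0_integral_measure_add//; last first.
  by apply: measurableT_comp => //; exact/measurable_EFinP.
move: i1 i2 => /integrableP[_ i1] /integrableP[_ i2].
by apply: lte_add_pinfty; [exact: i1|exact: i2].
Qed.

Lemma bdm_graph (u k : plane R -> R) (C : R) : continuous u -> measurable_fun setT k ->
  (forall v, 0 <= k v) -> (forall v, k v <= C) -> (forall v, gap v -> `|phi (graph_point u v)| <= M) ->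
  bdm (box N') (fun v => (v \in gap)%:R * (k v * phi (graph_point u v))).
Proof.
have mfg (w : plane R -> R) : continuous w -> measurable_fun setT (fun v => phi (graph_point w v)).
  move=> cw; have c : continuous (fun v : plane R => (v, w v)).
    by apply: continuous_pair => // v; exact: cvg_id.
  have mg : measurable_fun setT (fun v : plane R => (v, w v)).
    apply: measurable_fun_pair; first exact: measurable_id.
    exact: plane_continuous_measurable.
  exact: (measurableT_comp mphi (measurableT_comp (@measurable_heis_chart R) mg)).
have mi : measurable_fun setT (fun v : plane R => (v \in gap)%:R : R).
  apply: (eq_measurable_fun (\1_gap : plane R -> R)); last by apply: measurable_indic; exact: measurable_gap.
  by move=> v _; rewrite indicE.
move=> cu mk kp kC pM; split.
  apply: measurable_funTS; apply: measurable_funM => //; apply: measurable_funM => //.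
  exact: mfg.
exists (C * `|M|) => v _; case: (boolP (v \in gap)) => [/set_mem gv|_]; last first.
  by rewrite mul0r normr0 mulr_ge0// (le_trans (kp v)).
rewrite mul1r normrM (ger0_norm (kp v)); apply: ler_pM => //.
by rewrite (le_trans (pM v gv))// ler_norm.
Qed.

(** The larger box [N'] is left free because the box in [divergence_formula] depends on the test
    field. *)
Lemma perimeter_integral :
  (\int[perimeter]_p (phi p)%:E = (\int[leb2]_(v in box N') ((v \in gap)%:R *
    (kf v * phi (graph_point f v) + kh v * phi (graph_point h v))))%:E)%E.
Proof.
have [K kK] := bkf; have [K' kK'] := bkh.
have k0 v : 0 <= kf v by rewrite ltW// area_factor_gt0.
have k0' v : 0 <= kh v by rewrite ltW// area_factor_gt0.
have i1 := surface_integrable measurable_gap gapN' cf mkf kK mphi phif.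
have i2 := surface_integrable measurable_gap gapN' ch mkh kK' mphi phih.
transitivity (\int[surface measurable_gap cf mkf]_p (phi p)%:E +
  \int[surface measurable_gap ch mkh]_p (phi p)%:E)%E.
  exact: (integral_measure_add measurableT i1 i2).
have e1 := surface_integral measurable_gap gapN' cf mkf k0 kK mphi phif.
have e2 := surface_integral measurable_gap gapN' ch mkh k0' kK' mphi phih.
etransitivity; first exact: (congr2 (fun a b => a + b)%E e1 e2).
rewrite -EFinD -(IntD (bdm_graph cf mkf k0 kK phif) (bdm_graph ch mkh k0' kK' phih)).
by congr (_%:E); apply: eq_Rintegral => v _; rewrite mulrDr.
Qed.

End integral.

Lemma perimeter_fin : (perimeter setT < +oo)%E.
Proof.
have b (u : plane R -> R) v : gap v -> `|cst (1 : R) (graph_point u v)| <= 1.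
  by rewrite /= normr1.
have /integrableP[_] := perimeter_integrable (lexx N) (@measurable_cst _ _ _ _ setT (1 : R)) (b f) (b h).
rewrite (@eq_integral _ _ _ perimeter _ (cst 1%E)); last by move=> p _; rewrite /= normr1.
by rewrite integral_cst// mul1e.
Qed.

Lemma conormal_dot_le p (x y : R) : `|hdot (conormal p) (x, y)| <= `|x| + `|y|.
Proof.
rewrite /hdot/=; have := conormal_unit p; case: (conormal p) => a b /= ab.
have a1 : `|a| <= 1 by rewrite -(@expr_le1 _ 2)// real_normK ?num_real// -ab lerDl sqr_ge0.
have b1 : `|b| <= 1 by rewrite -(@expr_le1 _ 2)// real_normK ?num_real// -ab lerDr sqr_ge0.
rewrite (le_trans (ler_normD _ _))// !normrM lerD//; exact: ler_piMl.
Qed.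

Lemma conormal_dot_le1 p (x y : R) : x ^+ 2 + y ^+ 2 <= 1 -> `|hdot (conormal p) (x, y)| <= 1.
Proof.
rewrite /hdot/=; have := conormal_unit p; case: (conormal p) => a b /= ab xy.
have p1 := sqr_ge0 (a + x); have p2 := sqr_ge0 (b + y).
have m1 := sqr_ge0 (a - x); have m2 := sqr_ge0 (b - y).
by rewrite ler_norml; apply/andP; split; lra.
Qed.

Lemma measurable_conormal_dot (V1 V2 : heis R -> R) : measurable_fun setT V1 ->
  measurable_fun setT V2 -> measurable_fun setT (fun p => hdot (conormal p) (V1 p, V2 p)).
Proof.
move=> m1 m2; have mc := measurable_conormal.
have mc1 : measurable_fun setT (fun p => (conormal p).1) by exact: (measurableT_comp measurable_fst mc).
have mc2 : measurable_fun setT (fun p => (conormal p).2) by exact: (measurableT_comp measurable_snd mc).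
by apply: measurable_funD; apply: measurable_funM.
Qed.

(** The area factor cancels the normalisation of the conormal, leaving (- gf, 1) and (gh, -1): the
    integrand of [divergence_formula] up to sign. *)
Lemma region_Gauss_Green (V1 V2 : heis R -> R) : Cc1 V1 -> Cc1 V2 ->
  (\int[leb3]_(p in region f h) (hdiv V1 V2 p)%:E =
   - \int[perimeter]_p (hdot (conormal p) (V1 p, V2 p))%:E)%E.
Proof.
move=> C1 C2; have [N0 formula] := divergence_formula C1 C2 fA hA.
pose N' := Num.max (Num.max N N0) 1.
have NN : N <= N' by rewrite !le_max lexx.
have [M1 VM1] := Cc1_bounded C1; have [M2 VM2] := Cc1_bounded C2.
have mV := measurable_conormal_dot (heis_continuous_measurable (Cc1_continuous C1))
  (heis_continuous_measurable (Cc1_continuous C2)).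
have b (u : plane R -> R) v : gap v ->
    `|hdot (conormal (graph_point u v)) (V1 (graph_point u v), V2 (graph_point u v))| <= M1 + M2.
  by move=> _; rewrite (le_trans (conormal_dot_le _ _ _))// lerD.
rewrite (perimeter_integral NN mV (b f) (b h)) (formula N'); first last.
- by rewrite lt_max ltr01 orbT.
- by rewrite !le_max lexx orbT.
have [K kK] := bkf; have [K' kK'] := bkh.
have k0 v : 0 <= kf v by rewrite ltW// area_factor_gt0.
have k0' v : 0 <= kh v by rewrite ltW// area_factor_gt0.
have bd := bdmD (bdm_graph N' mV cf mkf k0 kK (b f)) (bdm_graph N' mV ch mkh k0' kK' (b h)).
rewrite -EFinN; congr (_%:E); rewrite -[RHS]mulN1r -IntZ; last first.
  move: bd; congr (bdm _ _); apply/funext => v; exact: (esym (mulrDr _ _ _)).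
apply: eq_Rintegral => v _.
have -> : (f v < h v) = (v \in gap) by rewrite mem_setE.
case: (boolP (v \in gap)) => [/set_mem gv|_]; last by rewrite !mul0r addr0 mulr0.
rewrite conormal_bot (conormal_top gv) /hdot /= /tf0 -/(graph_point f v) -/(graph_point h v).
have := area_factor_gt0 (gf v); have := area_factor_gt0 (gh v); rewrite -/(kf v) -/(kh v).
move: (V1 _) (V2 _) (V1 _) (V2 _) (kf v) (kh v) => x1 x2 x3 x4 k1 k2 k10 k20.
by field; rewrite !gt_eqF.
Qed.

End perimeter.

(** * Flux of the field through the region *)

Section flux.
Context {R : realType}.
Implicit Types (v : plane R) (p : heis R).
Variables (N : R) (f h gf gh : plane R -> R).
Hypotheses (fA : admissible f gf) (hA : admissible h gh) (gapN : gap f h `<=` box N).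

Let cf : continuous f. Proof. by case: fA => /half_holder_continuous. Qed.
Let ch : continuous h. Proof. by case: hA => /half_holder_continuous. Qed.

Let E := region f h.
Let P := perimeter fA hA.
Let nu := conormal f gf gh.

(** Conservativity speaks of all pairs satisfying [perimeter_of]; this supplies an explicit one for
    which the flux can be computed. *)
Lemma region_perimeter_of : perimeter_of E P nu.
Proof.
split.
- move=> K cK; have mK : measurable K.
    rewrite -[K]setCK; apply: measurableC; apply: heis_open_measurable.
    by apply: closed_openC; apply: compact_closed => //; exact: (@norm_hausdorff _ (heis R)).
  apply: le_lt_trans (perimeter_fin fA hA gapN).
  by apply: le_measure => //; rewrite inE.
- exact: (measurable_conormal fA hA).
- apply: aeW => p; rewrite -(sqrtr1 R); congr (Num.sqrt _).
  by rewrite /hdot -!expr2; exact: (conormal_unit f gf gh p).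
- exact: (region_Gauss_Green fA hA gapN).
Qed.

Lemma region_finite_perimeter : finite_perimeter E.
Proof.
split.
  exists E; first exact: (heis_open_measurable (region_open cf ch)).
  by rewrite setYK; exact: negligible_set0.
apply: le_lt_trans (perimeter_fin fA hA gapN).
apply: ge_ereal_sup => _ [V1 [V2 [C1 C2 V12 ->]]].
rewrite (region_Gauss_Green fA hA gapN C1 C2).
have mV := measurable_conormal_dot fA hA (heis_continuous_measurable (Cc1_continuous C1))
  (heis_continuous_measurable (Cc1_continuous C2)).
apply: (@le_trans _ _ (\int[P]_p `|(hdot (nu p) (V1 p, V2 p))%:E|)%E).
  apply: le_trans (le_abse_integral P measurableT _); last exact/measurable_EFinP.
  by rewrite -abseN lee_abs.
apply: (@le_trans _ _ (\int[P]_p (cst 1%E p))%E); last by rewrite integral_cst// mul1e.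
apply: ge0_le_integral => //.
- by apply: measurableT_comp => //; exact/measurable_EFinP.
- move=> p _; rewrite /= lee_fin; apply: conormal_dot_le1.
  have := V12 p; rewrite -{1}(sqrtr1 R) ler_sqrt//.
Qed.

(** The region is open and misses both graphs, but they lie in its closure over [gap]; compact
    containment thus puts them in W, where [tau] is controlled. *)
Lemma gap_closure v : gap f h v -> closure E (graph_point f v) /\ closure E (graph_point h v).
Proof.
move=> fh; have c (B : set (heis R)) t0 : nbhs (chart (v, t0)) B ->
    \forall t \near t0, B (chart (v, t)).
  move=> nB; have cv : continuous (fun t : R => chart (v, t)).
    have ci : continuous (fun t : R => t) by move=> y; exact: cvg_id.
    have cc : continuous (fun _ : R => v) by move=> y; exact: cvg_cst.
    exact: contComp (continuous_pair cc ci) chart_continuous.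
  exact: cv.
have w0 : 0 < h v - f v by rewrite subr_gt0.
split=> B /c /nbhs_ballP[e /= e0 eB].
  pose s := Num.min e (h v - f v) / 2; have s0 : 0 < s by rewrite divr_gt0// lt_min e0.
  have se : s < e by rewrite ltr_pdivrMr// (@le_lt_trans _ _ e)// ?ge_min ?lexx// ltr_pMr// ltr1n.
  have sw : s < h v - f v.
    by rewrite ltr_pdivrMr// (@le_lt_trans _ _ (h v - f v))// ?ge_min ?lexx ?orbT// ltr_pMr// ltr1n.
  exists (chart (v, f v + s)); split.
    by rewrite /E /region/= vproj_chart /hy/=; split; lra.
  by apply: eB; rewrite /ball/= opprD addNKr normrN gtr0_norm.
pose s := Num.min e (h v - f v) / 2; have s0 : 0 < s by rewrite divr_gt0// lt_min e0.
have se : s < e by rewrite ltr_pdivrMr// (@le_lt_trans _ _ e)// ?ge_min ?lexx// ltr_pMr// ltr1n.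
have sw : s < h v - f v.
  by rewrite ltr_pdivrMr// (@le_lt_trans _ _ (h v - f v))// ?ge_min ?lexx ?orbT// ltr_pMr// ltr1n.
exists (chart (v, h v - s)); split.
  by rewrite /E /region/= vproj_chart /hy/=; split; lra.
by apply: eB; rewrite /ball/= opprB addrC subrK gtr0_norm.
Qed.

Section conservative.
Variables (W : set (heis R)) (tau : heis R -> R).
Hypotheses (oW : open W) (mtau : measurable_fun W tau)
  (btau : [locally [bounded tau p | p in W]])
  (cW : conservative W (fun p => (- tau p, 1 - tau p ^+ 2 / 2)))
  (EW : compactly_contained E W).

Lemma gap_tau_bounded : exists2 T, 0 <= T &
  forall v, gap f h v -> `|tau (graph_point f v)| <= T /\ `|tau (graph_point h v)| <= T.
Proof.
have [cE EsW] := EW.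
have [T0 [_ TB]] : \forall T \near +oo%R, closure E `<=` [set p | W p -> `|tau p| <= T].
  move/compact_near_coveringP: cE; apply => p /EsW Wp.
  have [M [_ MB]] := btau Wp; have bM : `|M| + 1 > M by rewrite ltr_pwDr// ler_norm.
  exists ([set q | W q -> `|tau q| <= `|M| + 1], [set T | `|M| + 1 <= T]) => /=.
    by split; [exact: (MB _ bM)|exact: nbhs_pinfty_ge].
  by move=> [q T] /= [qM MT] Wq; exact: le_trans (qM Wq) MT.
exists (`|T0| + 1); first exact: addr_ge0.
move=> v /gap_closure[cf' ch'].
have TT : T0 < `|T0| + 1 by rewrite ltr_pwDr// ler_norm.
by split; apply: (TB _ TT) => //; exact: EsW.
Qed.

(** The vanishing flux, written over V_0: multiplied by the area factor, the conormal paired with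
    [M] gives g tau + 1 - tau^2 / 2 on the lower graph and its opposite on the upper one. *)
Lemma flux_balance : let F v := (v \in gap f h)%:R *
    ((gf v * tau (graph_point f v) + (1 - tau (graph_point f v) ^+ 2 / 2)) -
     (gh v * tau (graph_point h v) + (1 - tau (graph_point h v) ^+ 2 / 2))) in
  bdm (box N) F /\ \int[leb2]_(v in box N) F v = 0.
Proof.
move=> F; have [T T0 bT] := gap_tau_bounded; have [cE EsW] := EW.
pose phi0 p := hdot (nu p) (- tau p, 1 - tau p ^+ 2 / 2).
(* [tau] is measurable on W only, hence the extension by zero. *)
pose phi := phi0 \_ W.
have mW : measurable W := heis_open_measurable oW.
have mnu := measurable_conormal fA hA.
have mphi : measurable_fun setT phi.
  have m0 : measurable_fun W phi0.
    have m1 : measurable_fun W (fun p => (nu p).1).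
      by apply: measurable_funTS; exact: (measurableT_comp measurable_fst mnu).
    have m2 : measurable_fun W (fun p => (nu p).2).
      by apply: measurable_funTS; exact: (measurableT_comp measurable_snd mnu).
    apply: measurable_funD; apply: measurable_funM => //; first exact: measurable_funN.
    apply: measurable_funB => //; apply: measurable_funM => //; exact: measurable_funX.
  exact: ((measurable_restrictT _ mW).1 m0).
have inW u v : closure E (graph_point u v) -> phi (graph_point u v) = phi0 (graph_point u v).
  by move=> /EsW Wv; rewrite /phi patchE mem_set.
have bphi0 p : `|tau p| <= T -> `|phi0 p| <= T + (1 + T * T).
  move=> pT; rewrite (le_trans (conormal_dot_le _ _ _ _ _ _))// normrN lerD//.
  rewrite (le_trans (ler_normB _ _))// normr1 lerD2l normrM normrX.
  apply: (@le_trans _ _ (`|tau p| ^+ 2)); last by rewrite expr2; apply: ler_pM.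
  by rewrite ler_piMr// ?sqr_ge0// ger0_norm// invf_le1// ler1n.
have bf v : gap f h v -> `|phi (graph_point f v)| <= T + (1 + T * T).
  by move=> gv; have [c1 c2] := gap_closure gv; rewrite (inW _ _ c1); apply: bphi0; have [] := bT v gv.
have bh v : gap f h v -> `|phi (graph_point h v)| <= T + (1 + T * T).
  by move=> gv; have [c1 c2] := gap_closure gv; rewrite (inW _ _ c2); apply: bphi0; have [] := bT v gv.
have := cW region_finite_perimeter EW region_perimeter_of.
rewrite /flux integral_mkcond => fl.
have := perimeter_integral fA hA gapN (lexx N) mphi bf bh.
rewrite (@eq_integral _ _ _ P _ (EFin \o phi)) in fl; last first.
  by move=> p _; rewrite /phi /= !patchE; case: ifP.
rewrite fl => -[int0].
have FE : (fun v => (v \in gap f h)%:R * (area_factor (gf v) * phi (graph_point f v) +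
    area_factor (gh v) * phi (graph_point h v))) = F.
  apply/funext => v; rewrite /F; case: (boolP (v \in gap f h)) => [/set_mem gv|_]; last by rewrite !mul0r.
  have [c1 c2] := gap_closure gv; rewrite !inW// /phi0 /nu conormal_bot (conormal_top gf gh gv) /hdot/=.
  have k1 := area_factor_gt0 (gf v); have k2 := area_factor_gt0 (gh v).
  move: (tau _) (tau _) (area_factor _) (area_factor _) k1 k2 => t1 t2 k1 k2 k10 k20.
  by field; rewrite !gt_eqF.
split; last by rewrite -FE int0.
have mk (g : plane R -> R) : measurable_fun setT g -> measurable_fun setT (fun v => area_factor (g v)).
  by move=> mg; exact: (measurableT_comp (continuous_measurable_fun (@area_factor_continuous R)) mg).
have k0 (g : plane R -> R) v : 0 <= area_factor (g v) by rewrite ltW// area_factor_gt0.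
have kK (g : plane R -> R) G : (forall v, `|g v| <= G) -> forall v, area_factor (g v) <= 1 + G.
  by move=> gG v; rewrite (le_trans (area_factor_le _))// lerD2l.
have [_ mf [Gf Gf0 gfG] _] := fA; have [_ mh [Gh Gh0 ghG] _] := hA.
have bd1 := bdm_graph fA hA N mphi cf (mk _ mf) (k0 gf) (kK _ _ gfG) bf.
have bd2 := bdm_graph fA hA N mphi ch (mk _ mh) (k0 gh) (kK _ _ ghG) bh.
rewrite -FE; move: (bdmD bd1 bd2); congr (bdm _ _).
by apply/funext => v; rewrite mulrDr.
Qed.

End conservative.

End flux.

(** * The Carnot-Caratheodory metric *)

Section horizontal_curves.
Context {R : realType}.
Notation L1 := (@lebesgue_measure R).
Implicit Types (t : R) (p q : heis R).

Lemma Rintegral_derive0 (F F' : R -> R) t : 0 <= t -> (forall x : R, is_derive x 1 F (F' x)) ->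
  continuous F' -> \int[L1]_(x in `[0, t]) F' x = F t - F 0.
Proof.
rewrite le_eqVlt => /orP[/eqP <- _ _|t0 dF cF']; last exact: Rintegral_derive.
by rewrite set_itv1 Rintegral_set1 subrr.
Qed.

Lemma ccdist_le_smooth (x y z x' y' : R -> R) (l : R) :
  (forall t : R, is_derive t 1 x (x' t)) -> (forall t : R, is_derive t 1 y (y' t)) ->
  (forall t : R, is_derive t 1 z ((x t * y' t - y t * x' t) / 2)) ->
  continuous x' -> continuous y' -> 0 <= l ->
  (forall t, 0 <= t <= 1 -> `|x' t| + `|y' t| <= l) ->
  (ccdist (x 0, y 0, z 0)%R (x 1, y 1, z 1)%R <= l%:E)%E.
Proof.
move=> dx dy dz cx' cy' l0 ll.
have cx := der_continuous dx; have cy := der_continuous dy.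
have itg (F : R -> R) (a b : R) : continuous F -> L1.-integrable `[a, b] (EFin \o F).
  move=> cF; apply: continuous_compact_integrable; first exact: segment_compact.
  exact: continuous_subspaceT.
have cc (c : R) : continuous (fun _ : R => c) by move=> s; exact: cvg_cst.
have cz' : continuous (fun t => (x t * y' t - y t * x' t) / 2).
  exact: (contM (contB (contM cx cy') (contM cy cx')) (cc 2^-1)).
apply: (@le_trans _ _ (curve_length x' y')).
  apply: ge_ereal_inf; exists (curve_length x' y') => //; exists (fun t => (x t, y t, z t)), x', y'; split=> //.
  split; [exact: itg|exact: itg|move=> t /andP[t0 _] /=].
  set X := \int[_]_(_ in _) _; set Y := \int[_]_(_ in _) _; set Z := \int[_]_(_ in _) _.
  have -> : X = x t - x 0.
    rewrite -(Rintegral_derive0 t0 dx cx'); apply: eq_Rintegral => s _.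
    by rewrite /hx/= -[LHS]/(x' s * 1 + y' s * 0) mulr1 mulr0 addr0.
  have -> : Y = y t - y 0.
    rewrite -(Rintegral_derive0 t0 dy cy'); apply: eq_Rintegral => s _.
    by rewrite /hy/= -[LHS]/(x' s * 0 + y' s * 1) mulr1 mulr0 add0r.
  have -> : Z = z t - z 0.
    rewrite -(Rintegral_derive0 t0 dz cz'); apply: eq_Rintegral => s _.
    rewrite -[LHS]/(x' s * - (y s / 2) + y' s * (x s / 2)); by field.
  rewrite -[RHS]/(x 0 + (x t - x 0), y 0 + (y t - y 0), z 0 + (z t - z 0)).
  by rewrite !subrKC.
have sq (a b : R) : Num.sqrt (a ^+ 2 + b ^+ 2) <= `|a| + `|b|.
  have ab : 0 <= `|a| + `|b| by rewrite addr_ge0.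
  rewrite -[leRHS]ger0_norm// -sqrtr_sqr ler_sqrt ?sqr_ge0//.
  have := real_normK (num_real a); have := real_normK (num_real b).
  have := normr_ge0 a; have := normr_ge0 b.
  by move: `|a| `|b| => u w w0 u0 <- <-; nra.
rewrite /curve_length; apply: (@le_trans _ _ (\int[L1]_(t in `[0%R, 1%R]) (l%:E))%E).
  apply: ge0_le_integral => //.
  - apply/measurable_EFinP; apply: measurable_funTS; apply: continuous_measurable_fun.
    exact: (contComp (contD (contM cx' cx') (contM cy' cy')) (@sqrt_continuous R)).
  - move=> t; rewrite /= in_itv/= => t01; rewrite lee_fin.
    exact: le_trans (sq _ _) (ll t t01).
have itv1 : L1 `[0%R, 1%R]%classic = 1%E.
  by rewrite lebesgue_measure_itv/= lte_fin ltr01 -EFinB subr0.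
rewrite integral_cst// -[leRHS]mule1 -itv1; exact: lexx.
Qed.

(** Degree 7 is what the curves below require: x is cubic and y quartic, so (x y' - y x') / 2 has
    degree 6. *)
Lemma der_horner (c0 c1 c2 c3 c4 c5 c6 c7 t : R) : is_derive t 1
  (fun t => c0 + t * (c1 + t * (c2 + t * (c3 + t * (c4 + t * (c5 + t * (c6 + t * c7)))))))
  (c1 + t * (2 * c2 + t * (3 * c3 + t * (4 * c4 + t * (5 * c5 + t * (6 * c6 + t * (7 * c7))))))).
Proof.
have cs (c : R) (F : R -> R) F' : is_derive t 1 F F' -> is_derive t 1 (fun t => c + t * F t) (F t + t * F').
  move=> dF; have hd := derD (der_cst c t) (derM (der_id t) dF).
  by apply: (der_eq hd); ring.
have d6 := cs c6 _ _ (der_cst c7 t); have d5 := cs c5 _ _ d6; have d4 := cs c4 _ _ d5.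
have d3 := cs c3 _ _ d4; have d2 := cs c2 _ _ d3; have d1 := cs c1 _ _ d2.
by have hd := cs c0 _ _ d1; apply: (der_eq hd); ring.
Qed.

(* The loop (k1 l1, k2 l2), with l1 = w w', l2 = w / 5 - w ^ 2, w = t (1 - t),
   has int l1 = int l2 = 0 and encloses the signed area - k1 k2 / 350, so that
   superposing it on a segment only changes the vertical displacement. *)
Lemma ccdist_upper (x0 f0 z0 a D k1 k2 : R) :
  (ccdist (x0, f0, z0) (x0 + a, f0 + D, z0 + (x0 * D - f0 * a) / 2 - k1 * k2 / 350)%R
   <= (`|a| + `|D| + 13 * (`|k1| + `|k2|))%:E)%E.
Proof.
pose x t : R := x0 + t * ((a + k1) + t * (-3 * k1 + t * (2 * k1 + t * (0 + t * (0 + t * (0 + t * 0)))))).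
pose y t : R := f0 + t * ((D + k2 / 5) + t * (- (6 / 5) * k2 + t * (2 * k2 + t * (- k2 + t * (0 + t * (0 + t * 0)))))).
(* The coefficients are those of the primitive of (x y' - y x') / 2 starting at z0. *)
pose z t : R := z0 + t * ((x0 * D - f0 * a + x0 * k2 / 5 - f0 * k1) / 2 +
  t * ((- (6 / 5) * x0 * k2 + 3 * f0 * k1) / 2 +
  t * ((2 * x0 * k2 - 2 * f0 * k1 - 2 / 5 * a * k2 + D * k1 - k1 * k2 / 5) / 2 +
  t * ((- x0 * k2 + a * k2 - D * k1 + 4 / 5 * k1 * k2) / 2 +
  t * ((- (3 / 5) * a * k2 - 33 / 25 * k1 * k2) / 2 +
  t * (k1 * k2 / 2 + t * (- k1 * k2 / 7))))))).
pose x' t : R := a + k1 * (1 + t * (- 6 + t * 6)).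
pose y' t : R := D + k2 * (1 / 5 + t * (- (12 / 5) + t * (6 + t * (- 4)))).
have dx t : is_derive t 1 x (x' t).
  have hd := der_horner x0 (a + k1) (-3 * k1) (2 * k1) 0 0 0 0 t.
  by apply: (der_eq hd); rewrite /x'; ring.
have dy t : is_derive t 1 y (y' t).
  have hd := der_horner f0 (D + k2 / 5) (- (6 / 5) * k2) (2 * k2) (- k2) 0 0 0 t.
  by apply: (der_eq hd); rewrite /y'; field.
have dz t : is_derive t 1 z ((x t * y' t - y t * x' t) / 2).
  have hd := der_horner z0 _ _ _ _ _ _ _ t.
  by apply: (der_eq (hd _ _ _ _ _ _ _)); rewrite /x /y /x' /y'; field.
have cc (c : R) : continuous (fun _ : R => c) by move=> s; exact: cvg_cst.
have ci : continuous (fun s : R => s) by move=> s; exact: cvg_id.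
have cx' : continuous x'.
  exact: (contD (cc a) (contM (cc k1) (contD (cc 1) (contM ci (contD (cc (- 6)) (contM ci (cc 6))))))).
have cy' : continuous y'.
  exact: (contD (cc D) (contM (cc k2) (contD (cc (1 / 5)) (contM ci (contD (cc (- (12 / 5)))
   (contM ci (contD (cc 6) (contM ci (cc (- 4)))))))))).
have := @ccdist_le_smooth x y z x' y' (`|a| + `|D| + 13 * (`|k1| + `|k2|)) dx dy dz cx' cy'.
have -> : (x 0, y 0, z 0) = (x0, f0, z0) by rewrite /x /y /z !mul0r !addr0.
have -> : (x 1, y 1, z 1) = (x0 + a, f0 + D, z0 + (x0 * D - f0 * a) / 2 - k1 * k2 / 350).
  by rewrite /x /y /z; congr (_, _, _); field.
apply; first by rewrite !addr_ge0// mulr_ge0// addr_ge0.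
move=> t /andP[t0 t1].
(* 13 dominates the sums of absolute coefficients, 1 + 6 + 6 and 1/5 + 12/5 + 6 + 4. *)
have b1 : `|1 + t * (- 6 + t * 6)| <= 13 by rewrite ler_norml; apply/andP; split; nra.
have b2 : `|1 / 5 + t * (- (12 / 5) + t * (6 + t * (- 4)))| <= 13.
  by rewrite ler_norml; apply/andP; split; nra.
have e1 : `|x' t| <= `|a| + 13 * `|k1|.
  by rewrite /x' (le_trans (ler_normD _ _))// lerD2l normrM mulrC ler_wpM2r.
have e2 : `|y' t| <= `|D| + 13 * `|k2|.
  by rewrite /y' (le_trans (ler_normD _ _))// lerD2l normrM mulrC ler_wpM2r.
by move: e1 e2; lra.
Qed.

End horizontal_curves.

Section intrinsic_holder.
Context {R : realType}.
Implicit Types (v w : plane R) (f : plane R -> R).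

Lemma hmul_Ypow v (t : R) : hmul (emb v) (Ypow t) = (v.1, t, v.2 + v.1 * t / 2).
Proof.
rewrite /hmul /emb /Ypow /hx /hy /hz/=.
by rewrite addr0 add0r addr0 mul0r subr0.
Qed.

(** The quantity under the root is the vertical displacement left after a straight horizontal
    segment between the two graph points. A loop closes it at a cost of 13 (19 + 19) = 494 times its
    square root. The Lipschitz inequality then has [D] on both sides, and lam < 1 lets it be
    absorbed, whence 494 / (1 - lam). *)
Lemma intrinsic_increment f : intrinsic_lipschitz f -> exists2 K, 1 <= K & forall v w,
  `|f w - f v| <= K * (`|w.1 - v.1| +
     Num.sqrt `|w.2 - v.2 + (w.1 - v.1) * (f v + f w) / 2|).
Proof.
move=> [lam /andP[lam0 lam1] fl]; exists (494 / (1 - lam)).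
  by rewrite ler_pdivlMr ?subr_gt0//; lra.
move=> v w; set a := w.1 - v.1; set c := w.2 - v.2 + _; set D := f w - f v.
pose k1 := 19 * Num.sqrt `|c|; pose s := Num.sqrt `|c|.
have s0 : 0 <= s by exact: sqrtr_ge0.
have s2 : s ^+ 2 = `|c| by rewrite sqr_sqrtr.
(* The loop parameters k s and - sg(c) k s have product - 350 c, so the loop contributes exactly
   c. *)
pose k : R := Num.sqrt 350; have k0 : 0 <= k by exact: sqrtr_ge0.
have k2 : k ^+ 2 = 350 by apply: sqr_sqrtr; exact: ler0n.
have k19 : k <= 19 by rewrite -(@ler_pXn2r _ 2)// ?nnegrE// k2; lra.
have sgc : `|Num.sg c| <= 1 by rewrite normr_sg; case: (_ == _); rewrite ?lexx ?ler01.
have := @ccdist_upper R v.1 (f v) (v.2 + v.1 * f v / 2) a D (k * s) (- (Num.sg c * (k * s))).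
have -> : v.1 + a = w.1 by rewrite addrC subrK.
have -> : f v + D = f w by rewrite addrC subrK.
have -> : v.2 + v.1 * f v / 2 + (v.1 * D - f v * a) / 2 - k * s * - (Num.sg c * (k * s)) / 350 =
   w.2 + w.1 * f w / 2.
  have -> : k * s * - (Num.sg c * (k * s)) / 350 = - (Num.sg c * (k ^+ 2 * s ^+ 2) / 350) by field.
  by rewrite k2 s2 (mulrC 350) (mulrA (Num.sg c)) -numEsg /c /a /D; field.
set l := (X in (_ <= X%:E)%E) => dl.
have := fl _ _ (ex_intro2 _ _ v I (hmul_Ypow v (f v))) (ex_intro2 _ _ w I (hmul_Ypow w (f w))).
rewrite /hy/= -/D => Dl.
have {Dl dl} Dl : D%:E = D%:E -> `|D| <= lam * l.
  move=> _; rewrite -lee_fin EFinM; apply: (le_trans Dl).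
  by rewrite lee_wpmul2l// lee_fin ltW.
have {}Dl := Dl erefl.
have ks : `|k * s| <= 19 * s by rewrite ger0_norm ?mulr_ge0// ler_wpM2r.
have sks : `|- (Num.sg c * (k * s))| <= 19 * s.
  by rewrite normrN normrM (le_trans _ ks)// ler_piMl.
have lb : l <= `|a| + `|D| + 494 * s by rewrite /l; lra.
have a0 := normr_ge0 a; have D0 := normr_ge0 D.
rewrite -/s mulrAC ler_pdivlMr ?subr_gt0//.
have lamb : lam * l <= lam * (`|a| + `|D| + 494 * s) by rewrite ler_wpM2l// ltW.
have key (A E m r : R) : 0 <= A -> 0 <= E -> 0 <= m -> 0 < r -> r < 1 ->
    E <= r * (A + E + 494 * m) -> E * (1 - r) <= 494 * (A + m) by nra.
by apply: key => //; exact: le_trans Dl lamb.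
Qed.

(** The increment bound contains the values of [f] themselves, so [f] is first bounded on the box by
    comparison with the origin; the vertical term is then at most linear in the increments of the
    coordinates. *)
Lemma intrinsic_lipschitz_half_holder f : intrinsic_lipschitz f -> half_holder f.
Proof.
move=> /intrinsic_increment[K K1 fK] L.
have K0 : 0 < K by rewrite (lt_le_trans ltr01).
have [F F0 fF] : exists2 F, 0 <= F & forall v, box L v -> `|f v| <= F.
  pose M := `|L| + 1; pose f0 := `|f 0|.
  have M0 : 0 < M by rewrite ltr_wpDl.
  have f00 : 0 <= f0 by exact: normr_ge0.
  have KM : 0 <= K * M by rewrite mulr_ge0// ltW.
  have KKM : 0 <= K * (K * M) by rewrite mulr_ge0// ltW.
  exists (f0 + 2 * (K * M + (1 + f0) / 2 + K * (K * M) / 2)); first by lra.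
  move=> v [/=]; rewrite !in_itv/= -!ler_norml => v1 v2.
  have LM : L <= M by rewrite (le_trans (ler_norm _))// lerDl.
  have := fK 0 v; rewrite !subr0.
  set c := _ + _ / 2; set D := `|f v - f 0| => DK.
  have D0 : 0 <= D by exact: normr_ge0.
  have fvD : `|f v| <= f0 + D by rewrite -[f v](subrKC (f 0)) ler_normD.
  have cM : `|c| <= M * (1 + f0 + D / 2).
    rewrite (le_trans (ler_normD _ _))// -mulrA normrM mulrDr mulrDr mulr1 -addrA lerD ?(le_trans v2)//.
    rewrite -mulrDr ler_pM// ?(le_trans v1)// normrM (ger0_norm (_ : 0 <= 2^-1))// ler_pdivrMr//.
    by rewrite (le_trans (ler_normD _ _))//; rewrite -/f0; lra.
  (* Under the root the increment [D] occurs linearly; expanding (S - K M)^2 >= 0 leaves it with the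
     coefficient 1 / 4, and it can be absorbed. *)
  have amgm (S C : R) : S ^+ 2 = C -> C <= M * (1 + f0 + D / 2) ->
      K * S <= (1 + f0) / 2 + D / 4 + K * (K * M) / 2.
    move=> S2 CM; rewrite -(ler_pM2r M0); have := sqr_ge0 (S - K * M); lra.
  have KS := amgm (Num.sqrt `|c|) _ (sqr_sqrtr (normr_ge0 c)) cM.
  have : K * `|v.1| <= K * M by rewrite ler_pM2l// (le_trans v1).
  by move: DK; rewrite mulrDr; lra.
exists (K * (1 + 2 * `|L| + Num.sqrt (1 + F))).
  by rewrite mulr_ge0 ?(ltW K0)// !addr_ge0// ?mulr_ge0// sqrtr_ge0.
move=> s v w s0 Lv Lw w1 w2; apply: le_trans (fK v w) _; rewrite -[leRHS](mulrA K) ler_pM2l//.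
rewrite [leRHS]mulrDl; apply: lerD.
  (* For s <= 1 the increment is at most s^2 <= s; for s > 1 it is at most the width of the box. *)
  have [s1|s1] := leP s 1.
    rewrite (le_trans w1)// expr2 ler_wpM2r// (le_trans s1)// lerDl mulr_ge0//.
  have : `|w.1 - v.1| <= 2 * `|L|.
    move: Lv Lw => [+ _] [+ _]; rewrite /= !in_itv/= -!ler_norml => a b.
    by have := ler_normB w.1 v.1; have := ler_norm L; lra.
  have := normr_ge0 L; move: `|w.1 - v.1| `|L| => u l l0 ul; nra.
have F1 : 0 <= 1 + F by exact: addr_ge0.
have -> : Num.sqrt (1 + F) * s = Num.sqrt ((1 + F) * s ^+ 2).
  by rewrite sqrtrM// sqrtr_sqr ger0_norm.
rewrite ler_sqrt; last by rewrite mulr_ge0// sqr_ge0.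
apply: le_trans (ler_normD _ _) _; rewrite [leRHS]mulrDl mul1r (mulrC F); apply: lerD => //.
rewrite -mulrA normrM; apply: ler_pM => //; rewrite normrM (ger0_norm (_ : 0 <= 2^-1))//.
rewrite ler_pdivrMr//; apply: le_trans (ler_normD _ _) _.
by have := fF v Lv; have := fF w Lw; lra.
Qed.

End intrinsic_holder.

(** * Projection of balls and null sets *)

Section ball_projection.
Context {R : realType}.
Notation L1 := (@lebesgue_measure R).
Notation I := (`[0%R, 1%R]%classic : set R).
Implicit Types (p q : heis R).

(** Integrals of this shape are the signed areas that give the vertical coordinate of a horizontal
    curve. *)
Lemma integrable_primitive_mul (a b : R -> R) :
  L1.-integrable I (EFin \o a) -> L1.-integrable I (EFin \o b) ->
  [/\ forall t, I t -> `|\int[L1]_(s in `[0, t]) b s| <= \int[L1]_(s in I) `|b s|,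
      L1.-integrable I (EFin \o (fun t => a t * \int[L1]_(s in `[0, t]) b s)) &
      `|\int[L1]_(t in I) (a t * \int[L1]_(s in `[0, t]) b s)| <=
        (\int[L1]_(s in I) `|a s|) * (\int[L1]_(s in I) `|b s|)].
Proof.
move=> ia ib; set B := \int[L1]_(s in I) `|b s|; pose Y t := \int[L1]_(s in `[0, t]) b s.
have mI : measurable (I : set (measurableTypeR R)) by exact: measurable_itv.
have nrm (c : R -> R) (D : set R) : L1.-integrable D (EFin \o c) -> L1.-integrable D (EFin \o (fun s => `|c s|)).
  by move=> ic; exact: integrable_norm.
have B0 : 0 <= B by exact: Rintegral_ge0.
have YB t : I t -> `|Y t| <= B.
  rewrite /= in_itv/= => /andP[t0 t1].
  have sI : `[0, t] `<=` I by move=> s; rewrite /= !in_itv/= => /andP[-> /le_trans]; apply.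
  have mt : measurable (`[0, t]%classic : set (measurableTypeR R)) by exact: measurable_itv.
  have ibt : L1.-integrable `[0, t] (EFin \o b) by exact: integrableS ib.
  rewrite (le_trans (le_normr_Rintegral mt ibt))// /B /Rintegral fine_le//.
  - exact: integrable_fin_num (nrm _ _ ibt).
  - exact: integrable_fin_num (nrm _ _ ib).
  - by apply: ge0_subset_integral => //; have /integrableP[] := nrm _ _ ib.
have mY : measurable_fun I Y.
  apply: subspace_continuous_measurable_fun => //.
  exact: (parameterized_integral_continuous ler01 ib).
have ma : measurable_fun I a by apply/measurable_EFinP; case/integrableP: ia.
have iBa : L1.-integrable I (EFin \o (fun t => B * `|a t|)).
  exact: (integrableZl mI B (nrm _ _ ia)).
have iaY : L1.-integrable I (EFin \o (fun t => a t * Y t)).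
  apply: (le_integrable mI _ _ iBa); first by apply/measurable_EFinP; exact: measurable_funM.
  move=> t It; rewrite /= lee_fin normrM normrM normr_id mulrC (ger0_norm B0).
  by apply: ler_wpM2r => //; exact: YB.
split=> //; rewrite (le_trans (le_normr_Rintegral mI iaY))// mulrC.
rewrite -(RintegralZl B mI (nrm _ _ ia)); apply: le_Rintegral => //; first exact: nrm.
by move=> t It; rewrite normrM mulrC; apply: ler_wpM2r => //; exact: YB.
Qed.

(** Relative to the starting point, the vertical coordinate is the mean of two iterated integrals of
    the controls, each at most the square of the length. *)
Lemma curve_displacement (gamma : R -> heis R) (a b : R -> R) (r : R) :
  horizontal_curve gamma a b -> (curve_length a b < r%:E)%E ->
  let p := gamma 0 in let q := gamma 1 in
  [/\ `|hx q - hx p| <= r, `|hy q - hy p| <= r &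
      `|hz q - hz p - (hx p * (hy q - hy p) - hy p * (hx q - hx p)) / 2| <= r ^+ 2].
Proof.
move=> [ia ib gammaE] lr p q.
have mI : measurable (I : set (measurableTypeR R)) by exact: measurable_itv.
have nrm (c : R -> R) : L1.-integrable I (EFin \o c) -> L1.-integrable I (EFin \o (fun s => `|c s|)).
  by move=> ic; exact: integrable_norm.
have ma : measurable_fun I a by apply/measurable_EFinP; case/integrableP: ia.
have mb : measurable_fun I b by apply/measurable_EFinP; case/integrableP: ib.
have lt_r (c : R -> R) : L1.-integrable I (EFin \o c) -> (forall s, `|c s| <= Num.sqrt (a s ^+ 2 + b s ^+ 2)) ->
    \int[L1]_(s in I) `|c s| <= r.
  move=> ic cl; rewrite -lee_fin /Rintegral fineK; last exact: integrable_fin_num (nrm _ ic).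
  apply: le_trans (ltW lr); apply: ge0_le_integral => //.
  - by have /integrableP[] := nrm _ ic.
  - have msq : measurable_fun setT (Num.sqrt : R -> R).
      exact: continuous_measurable_fun (@sqrt_continuous R).
    have mab : measurable_fun I (fun s => a s ^+ 2 + b s ^+ 2).
      by apply: measurable_funD; exact: measurable_funX.
    apply/measurable_EFinP; exact: (measurableT_comp msq mab).
  - by move=> s _; rewrite lee_fin.
set A := \int[L1]_(s in I) `|a s|; set B := \int[L1]_(s in I) `|b s|.
have A0 : 0 <= A by exact: Rintegral_ge0.
have B0 : 0 <= B by exact: Rintegral_ge0.
have Ar : A <= r.
  by apply: lt_r => // s; rewrite -sqrtr_sqr ler_wsqrtr// lerDl sqr_ge0.
have Br : B <= r.
  by apply: lt_r => // s; rewrite -sqrtr_sqr ler_wsqrtr// lerDr sqr_ge0.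
pose X t := \int[L1]_(s in `[0, t]) a s; pose Y t := \int[L1]_(s in `[0, t]) b s.
have gx t : I t -> hx (gamma t) = hx p + X t.
  rewrite /= in_itv/= => /gammaE ->; rewrite -[LHS]/(hx p + _); congr (_ + _).
  apply: eq_Rintegral => s _.
  by rewrite -[LHS]/(a s * 1 + b s * 0) mulr1 mulr0 addr0.
have gy t : I t -> hy (gamma t) = hy p + Y t.
  rewrite /= in_itv/= => /gammaE ->; rewrite -[LHS]/(hy p + _); congr (_ + _).
  apply: eq_Rintegral => s _.
  by rewrite -[LHS]/(a s * 0 + b s * 1) mulr1 mulr0 add0r.
have I1 : I 1 by rewrite /= in_itv/= ler01 lexx.
have [XA ibX bX] := integrable_primitive_mul ib ia.
have [YB iaY aY] := integrable_primitive_mul ia ib.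
rewrite -/X -/Y -/A -/B in XA ibX bX YB iaY aY.
have dx : hx q - hx p = X 1 by rewrite /q gx// addrC addKr.
have dy : hy q - hy p = Y 1 by rewrite /q gy// addrC addKr.
have dz : hz q - hz p = (\int[L1]_(s in I) (b s * X s) - \int[L1]_(s in I) (a s * Y s)) / 2 +
    (hx p * Y 1 - hy p * X 1) / 2.
  have -> : hz q - hz p = \int[L1]_(s in I)
      (2^-1 * (b s * X s) + - 2^-1 * (a s * Y s) + (hx p / 2 * b s + - (hy p / 2) * a s)).
    rewrite /q gammaE ?ler01 ?lexx// -[X in X - _]/(hz p + _) addrC addKr.
    apply: eq_Rintegral => s /set_mem Is.
    by rewrite -[LHS]/(a s * - (hy (gamma s) / 2) + b s * (hx (gamma s) / 2)) gx// gy//; ring.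
  have i1 := integrableZl mI 2^-1 ibX; have i2 := integrableZl mI (- 2^-1) iaY.
  have i3 := integrableZl mI (hx p / 2) ib; have i4 := integrableZl mI (- (hy p / 2)) ia.
  rewrite (RintegralD mI (integrableD mI i1 i2) (integrableD mI i3 i4)).
  rewrite (RintegralD mI i1 i2) (RintegralD mI i3 i4).
  rewrite (RintegralZl _ mI ibX) (RintegralZl _ mI iaY) (RintegralZl _ mI ib) (RintegralZl _ mI ia).
  rewrite -/(X 1) -/(Y 1); move: (\int[L1]_(s in I) _) (\int[L1]_(s in I) _) (X 1) (Y 1) => u w x y.
  by ring.
rewrite dz dx dy addrK; split.
- exact: le_trans (XA _ I1) Ar.
- exact: le_trans (YB _ I1) Br.
- have AB : A * B <= r ^+ 2 by rewrite expr2; exact: ler_pM.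
  rewrite normrM (ger0_norm (_ : 0 <= 2^-1))// ler_pdivrMr//.
  have key (u w c : R) : `|u| <= c -> `|w| <= c -> c <= r ^+ 2 -> `|u - w| <= r ^+ 2 * 2.
    move=> uc wc cr; rewrite (le_trans (ler_normB _ _))// mulr_natr mulr2n.
    by apply: lerD; [exact: le_trans uc cr|exact: le_trans wc cr].
  by rewrite (mulrC B) in bX; exact: (key _ _ _ bX aY AB).
Qed.

End ball_projection.

Section null_projection.
Context {R : realType}.
Notation L1 := (@lebesgue_measure R).
Implicit Types (c p q : heis R) (v : plane R) (r : R).

(** Projecting to V_0 turns left translation by [c] into a shear, which preserves area. The area 2 r
    times 4 r^2 is precisely the summand (2 r)^3 of the Hausdorff measure. *)
Definition sheared_box c r : set (plane R) := [set v | `|v.1 - hx c| <= r /\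
  `|v.2 - (vproj c).2 + hy c * (v.1 - hx c)| <= 2 * r ^+ 2].

Lemma ccball_sheared_box c r q : ccball c r q -> sheared_box c r (vproj q).
Proof.
move=> /ereal_inf_lt[_ [gamma [a [b [hab gc gq ->]]]] lr].
have [] := curve_displacement hab lr; rewrite gc gq => dx dy dz.
split=> //; rewrite /vproj/=; set z := (X in `|X| <= _) in dz.
have -> : hz q - hx q * hy q / 2 - (hz c - hx c * hy c / 2) + hy c * (hx q - hx c) =
  z - (hx q - hx c) * (hy q - hy c) / 2 by rewrite /z; field.
have xy : `|(hx q - hx c) * (hy q - hy c)| <= r ^+ 2 by rewrite normrM expr2 ler_pM.
rewrite (le_trans (ler_normB _ _))// mulr_natl mulr2n lerD// normrM (ger0_norm (_ : 0 <= 2^-1))//.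
by rewrite ler_pdivrMr//; have := sqr_ge0 r; lra.
Qed.

Lemma measurable_sheared_box c r : measurable (sheared_box c r).
Proof.
have c1 : continuous (fun v : plane R => v.1) by move=> v; exact: cvg_fst.
have c2 : continuous (fun v : plane R => v.2) by move=> v; exact: cvg_snd.
have cc (k : R) : continuous (fun _ : plane R => k) by move=> v; exact: cvg_cst.
have cn (F : plane R -> R) : continuous F -> continuous (fun v => `|F v|).
  by move=> cF; exact: contComp cF (@norm_continuous _ R).
have mle (F : plane R -> R) k : continuous F -> measurable [set v | F v <= k].
  move=> cF; have -> : [set v | F v <= k] = ~` [set v | k < F v].
    by apply/seteqP; split=> v /=; rewrite leNgt => /negP.
  by apply: measurableC; apply: plane_open_measurable; exact: (open_ltfun (cc k) cF).
apply: measurableI; apply: mle; apply: cn; first exact: (contB c1 (cc (hx c))).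
exact: (contD (contB c2 (cc (vproj c).2)) (contM (cc (hy c)) (contB c1 (cc (hx c))))).
Qed.

Lemma lebesgue_centered_itv (m e : R) : 0 <= e -> L1 `[m - e, m + e]%classic = (2 * e)%:E.
Proof.
move=> e0; rewrite lebesgue_measure_itv/= lte_fin; case: ifPn => [_|].
  by rewrite -EFinB; congr (_%:E); ring.
by rewrite -leNgt => me; congr (_%:E); lra.
Qed.

Lemma leb2_sheared_box c r : 0 <= r -> leb2 (sheared_box c r) = ((2 * r) ^+ 3)%:E.
Proof.
move=> r0; set J : set R := `[hx c - r, hx c + r]%classic.
transitivity (\int[L1]_(x in J) (4 * r ^+ 2)%:E)%E; last first.
  rewrite integral_cst//; last exact: measurable_itv.
  transitivity ((4 * r ^+ 2)%:E * (2 * r)%:E)%E; last by rewrite -EFinM; congr (_%:E); ring.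
  by congr (_ * _)%E; exact: lebesgue_centered_itv.
rewrite integral_mkcond; apply: eq_integral => x _; rewrite patchE.
case: ifPn => xJ.
  pose m := (vproj c).2 - hy c * (x - hx c).
  have zmE (z : R) : z - m = z - (vproj c).2 + hy c * (x - hx c) by rewrite /m; ring.
  have -> : 4 * r ^+ 2 = 2 * (2 * r ^+ 2) by ring.
  rewrite -(@lebesgue_centered_itv m); last by rewrite mulr_ge0// sqr_ge0.
  congr (L1 _); apply/seteqP; split=> z; rewrite /xsection/= in_itv/= -ler_distl.
    by move=> /set_mem[_]; rewrite zmE.
  rewrite zmE => zm; apply/mem_set; split=> //.
  by move: xJ => /set_mem; rewrite /J/= in_itv/= -ler_distl.
transitivity (L1 set0); last exact: measure0.
congr (L1 _); apply/seteqP; split=> z //.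
rewrite /xsection/= => /set_mem[/= xz _]; move: xJ => /negP; apply; apply/mem_set.
by rewrite /J/= in_itv/= -ler_distl.
Qed.

(** A covering by balls projects to a covering by sheared boxes whose measures are the terms of the
    covering sum. Sums below 1 / (n + 1) give measurable sets around the projection; their
    intersection is null. *)
Lemma null_projection (S : set (heis R)) : spherical_hausdorff 3 S = 0%E ->
  exists N : set (plane R), [/\ measurable N, leb2 N = 0%E & vproj @` S `<=` N].
Proof.
move=> S0.
have /choice[U UP] : forall n : nat, exists U : set (plane R), [/\ measurable U,
    (leb2 U <= (n.+1%:R^-1)%:E)%E & vproj @` S `<=` U].
  move=> n.
  have : (spherical_hausdorff_pre 3 1 S < (n.+1%:R^-1 : R)%:E)%E.
    apply: (@le_lt_trans _ _ (spherical_hausdorff 3 S)); last by rewrite S0 lte_fin invr_gt0.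
    (* Any positive bound on the radii would do, since each premeasure is below the supremum; it is
       taken to be 1. *)
    by apply: ereal_sup_ubound; exists 1 => //=.
  move=> /ereal_inf_lt[_ [c [r [r01 Sc ->]]] sr].
  exists (\bigcup_i sheared_box (c i) (r i)); split.
  - by apply: bigcup_measurable => i _; exact: measurable_sheared_box.
  - apply: le_trans (ltW sr).
    rewrite (eq_eseriesr (g := fun i => leb2 (sheared_box (c i) (r i)))); last first.
      by move=> i _; rewrite leb2_sheared_box//; have /andP[] := r01 i.
    apply: measure_sigma_subadditive => //; first by move=> i; exact: measurable_sheared_box.
    by apply: bigcup_measurable => i _; exact: measurable_sheared_box.
  - by move=> _ [p /Sc[i _ cp] <-]; exists i => //; exact: ccball_sheared_box.
exists (\bigcap_n U n); split.
- by apply: bigcap_measurable => // n _; have [] := UP n.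
- apply/eqP; rewrite eq_le measure_ge0 andbT.
  apply/lee_addgt0Pr => e e0; rewrite add0e.
  have [n ne] : exists n, (n.+1%:R^-1 : R) <= e.
    exists (Num.truncn e^-1); rewrite invf_ple ?posrE//; exact: ltW (truncnS_gt _).
  have [mU Un _] := UP n.
  apply: (@le_trans _ _ (leb2 (U n))); last by rewrite (le_trans Un)// lee_fin.
  apply: le_measure; rewrite ?inE//; last by move=> v; apply.
  by apply: bigcap_measurable => // k _; have [] := UP k.
- by move=> v Sv n _; have [_ _] := UP n; apply.
Qed.

End null_projection.

Lemma measurable_mem d (T : measurableType d) (D : set T) : measurable D ->
  measurable_fun setT (fun x => x \in D).
Proof.
move=> mD; apply: (measurable_fun_bool true); rewrite setTI (_ : _ @^-1` _ = D)//.
by apply/seteqP; split=> x /=; [move/set_mem|move/mem_set].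
Qed.

(** * Comparison of energies *)

Section nonmeasurable_domain.
Local Open Scope ereal_scope.
Context d (T : measurableType d) {R : realType} (mu : {measure set T -> \bar R}).
Implicit Types (F G : T -> \bar R).

Import HBNNSimple.

(** The integral of a nonnegative function is the supremum over the simple functions below it, and a
    larger function has more of them; [F] and [G] may be nonmeasurable. *)
Lemma ge0_integral_mono F G : (forall x, 0 <= F x) -> (forall x, F x <= G x) ->
  \int[mu]_x F x <= \int[mu]_x G x.
Proof.
move=> F0 FG; have G0 x : 0 <= G x by exact: le_trans (F0 x) (FG x).
rewrite !ge0_integralTE//; apply: ge_ereal_sup => _ [s /= sF <-].
by apply: ereal_sup_ubound; exists s => //= x; exact: le_trans (sF x) (FG x).
Qed.

Lemma ge0_integral_le_nnsfun F c : (forall x, 0 <= F x) ->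
  (forall s : {nnsfun T >-> R}, (forall x, (s x)%:E <= F x) -> \int[mu]_x (s x)%:E <= c) ->
  \int[mu]_x F x <= c.
Proof.
move=> F0 Fc; rewrite ge0_integralTE//; apply: ge_ereal_sup => _ [s /= sF <-].
by rewrite -integralT_nnsfun; exact: Fc.
Qed.

(* [A] need not be measurable, so the integrals over [A] are compared through
   the simple functions below the left-hand side. *)
Lemma ge0_integral_le_replace (A D N : set T) (a b c : T -> R) :
  measurable D -> measurable N -> mu N = 0 -> D `<=` A ->
  measurable_fun setT a -> measurable_fun setT c ->
  (forall x, (0 <= a x)%R) -> (forall x, (0 <= b x)%R) -> (forall x, (0 <= c x)%R) ->
  (forall x, ~ N x -> b x = c x) -> (forall x, ~ D x -> a x = c x) ->
  \int[mu]_(x in D) (a x)%:E <= \int[mu]_(x in D) (c x)%:E ->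
  \int[mu]_(x in A) (a x)%:E <= \int[mu]_(x in A) (b x)%:E.
Proof.
move=> mD mN N0 DA ma mc a0 b0 c0 bc ac Dle.
rewrite [leLHS]integral_mkcond [leRHS]integral_mkcond.
apply: ge0_integral_le_nnsfun => [x|s sA].
  by rewrite patchE; case: ifP => _ //; rewrite lee_fin.
have mDC : measurable (~` D) by exact: measurableC.
have mNC : measurable (~` N) by exact: measurableC.
have split_int (u : T -> R) : measurable_fun setT u -> (forall x, (0 <= u x)%R) ->
    \int[mu]_x (u x)%:E = \int[mu]_(x in D) (u x)%:E + \int[mu]_(x in ~` D) (u x)%:E.
  move=> mu' u0; rewrite -ge0_integral_setU ?setUv//.
  - exact/measurable_EFinP.
  - by move=> x _; rewrite lee_fin.
  - by apply/disj_setPCl.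
have ms : measurable_fun setT s by exact: measurable_funP.
(* The simple function is raised to [c] on [D], where the inequality is between measurable
   integrands. Elsewhere s <= a = c on [A], and s <= 0 off [A]. *)
pose w x : R := if x \in D then c x else s x.
have mw : measurable_fun setT w.
  by apply: measurable_fun_ifT => //; exact: measurable_mem.
have w0 x : (0 <= w x)%R by rewrite /w; case: ifP.
apply: (@le_trans _ _ (\int[mu]_x (w x)%:E)).
  rewrite !split_int//; apply: leeD.
    apply: (@le_trans _ _ (\int[mu]_(x in D) (a x)%:E)).
      apply: ge0_le_integral => //.
      - by move=> x _; rewrite lee_fin.
      - by apply/measurable_EFinP; exact: measurable_funTS.
      - by apply/measurable_EFinP; exact: measurable_funTS.
      - by move=> x Dx; have := sA x; rewrite patchE mem_set//; exact: DA.
    rewrite (le_trans Dle)// le_eqVlt; apply/orP; left; apply/eqP.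
    by apply: eq_integral => x xD; rewrite /w xD.
  rewrite le_eqVlt; apply/orP; left; apply/eqP.
  by apply: eq_integral => x /set_mem nD; rewrite /w memNset.
(* Off the null set [N], [b] and [c] agree, so w lies below [b] restricted to [A]. *)
rewrite (ge0_negligible_integral mN)//; last 2 first.
- exact/measurable_EFinP.
- by move=> x _; rewrite lee_fin.
rewrite setTD integral_mkcond; apply: ge0_integral_mono => x.
  by rewrite patchE; case: ifP => _ //; rewrite lee_fin.
rewrite !patchE; case: ifPn => [/set_mem nN|_]; last by case: ifP => _ //; rewrite lee_fin.
rewrite /w; case: ifPn => [/set_mem Dx|nD]; first by rewrite mem_set ?bc//; exact: DA.
have := sA x; rewrite patchE; case: ifP => // _; rewrite !lee_fin ac ?bc//.
by move=> /mem_set; rewrite (negPf nD).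
Qed.

End nonmeasurable_domain.

(** * Bounded representatives of the gradient *)

Section truncation.
Context {R : realType}.
Implicit Types (f g : plane R -> R).

(** The L_infty norm is the essential supremum only when the total mass is positive. *)
Lemma leb2_setT_gt0 : (0 < (@leb2 R) setT)%E.
Proof.
apply: (@lt_le_trans _ _ (leb2 (box 1 : set (plane R)))).
  by rewrite box_leb2// lte_fin exprn_gt0// mulr1.
by apply: le_measure; rewrite ?inE//; exact: measurable_box.
Qed.

Lemma Lfun_bounded_ae g : g \in Lfun leb2 +oo%E -> measurable_fun setT g /\
  exists N (C : R), [/\ measurable N, leb2 N = 0%E & forall v, ~ N v -> `|g v| <= C].
Proof.
move=> /andP[]; rewrite !inE/= => mg; rewrite /finite_norm unlock leb2_setT_gt0 => sg.
split=> //.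
have [C [N [mN N0 CN]]] := @ess_sup_inf.ess_supr_bounded _ _ _ leb2 (fun v => `|g v|) sg.
exists N, C; split=> // v nN; apply: contrapT => nv; exact/nN/CN.
Qed.

Lemma bounded_Lfun g C : measurable_fun setT g -> (forall v, `|g v| <= C) -> g \in Lfun leb2 +oo%E.
Proof.
move=> mg gC; apply/andP; split; rewrite !inE//= /finite_norm unlock leb2_setT_gt0.
apply: (@le_lt_trans _ _ C%:E); last exact: ltry.
by apply/ess_sup_inf.ess_supP; apply: aeW => v; rewrite /= lee_fin.
Qed.

(** Resetting [g] to zero on the null set where its essential bound fails leaves the integrals of
    the weak equation unchanged. *)
Lemma bounded_gradient f g : intrinsic_gradient f g -> exists g' N (C : R),
  [/\ measurable_fun setT g', forall v, `|g' v| <= C, weak_gradient f g' &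
   [/\ 0 <= C, measurable N, leb2 N = 0%E & forall v, ~ N v -> g v = g' v]].
Proof.
move=> [/Lfun_bounded_ae[mg [N [C [mN N0 gC]]]] fg].
pose g' v := if v \in N then 0 else g v.
have mg' : measurable_fun setT g'.
  by apply: measurable_fun_ifT => //; exact: measurable_mem.
have gg' v : ~ N v -> g v = g' v by move=> nN; rewrite /g' memNset.
exists g', N, `|C|; split=> //.
- move=> v; rewrite /g'; case: ifPn => [_|/negP nN]; first by rewrite normr0.
  by rewrite (le_trans (gC _ _)) ?ler_norm// => /mem_set.
- move=> psi psi1; rewrite -fg//.
  have mpsi : measurable_fun setT psi.
    by apply: plane_continuous_measurable => v; apply: differentiable_continuous; case: psi1.
  apply: ae_eq_integral => //.
  + by apply/measurable_EFinP; exact: measurable_funM.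
  + by apply/measurable_EFinP; exact: measurable_funM.
  exists N; split=> // v /= nv; apply: contrapT => nN; apply: nv => _.
  by rewrite gg'.
Qed.

End truncation.

Section graphs.
Context {R : realType}.
Implicit Types (v : plane R) (p : heis R) (f h : plane R -> R).

Lemma epigraphE f p : epigraph f p <-> f (vproj p) <= hy p.
Proof.
split=> [[_ [t [[v _ <-] t0 ->]]]|fp].
  rewrite hmul_Ypow; have -> : hmul (v.1, f v, v.2 + v.1 * f v / 2) (Ypow t) = chart (v, f v + t).
    by rewrite /hmul /chart /Ypow /hx /hy /hz/=; congr (_, _, _); field.
  by rewrite vproj_chart /hy/= lerDl.
exists (graph_point f (vproj p)), (hy p - f (vproj p)); split.
- by exists (vproj p) => //; rewrite hmul_Ypow.
- by rewrite subr_ge0.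
- case: p {fp} => -[x y] z; rewrite /hmul /graph_point /chart /vproj /Ypow /hx /hy /hz/=.
  by congr (_, _, _); field.
Qed.

Lemma graph_projection (B : set (heis R)) f :
  vproj @` (B `&` graph f) = [set v | B (graph_point f v)].
Proof.
apply/seteqP; split=> [_ [p [Bp [v _ fv]] <-]|v Bv] /=.
  have e : hmul (emb v) (Ypow (f v)) = graph_point f v by exact: hmul_Ypow.
  by move: Bp; rewrite -fv e => Bv; rewrite (vproj_chart (v, f v)).
exists (graph_point f v); last exact: vproj_chart.
by split=> //; exists v => //; rewrite hmul_Ypow.
Qed.

(** The condition on competitors is about epigraphs; this passes it on to the two regions whose flux
    is computed. *)
Lemma region_epigraph f h :
  region f h `<=` epigraph f `+` epigraph h /\ region h f `<=` epigraph f `+` epigraph h.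
Proof.
split=> p [a b].
- by left; split; [apply/epigraphE; exact: ltW|move=> /epigraphE; rewrite leNgt b].
- by right; split; [apply/epigraphE; exact: ltW|move=> /epigraphE; rewrite leNgt b].
Qed.

Lemma compactly_contained_sub (A B U V : set (heis R)) : A `<=` B -> U `<=` V ->
  compactly_contained B U -> compactly_contained A V.
Proof.
move=> AB UV [cB BU]; have cAB := closure_subset AB; split.
  exact: subclosed_compact (@closed_closure _ A) cB cAB.
by move=> p /cAB /BU /UV.
Qed.

End graphs.

Section energy_comparison.
Context {R : realType}.
Implicit Types (v : plane R).

Lemma integral_in_box (N : R) (D : set (plane R)) (u : plane R -> R) : measurable D ->
  D `<=` box N -> bdm setT u ->
  bdm (box N) (fun v => (v \in D)%:R * u v) /\
  (\int[leb2]_(v in D) (u v)%:E = (\int[leb2]_(v in box N) ((v \in D)%:R * u v))%:E)%E.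
Proof.
move=> mD DN bu.
have b : bdm (box N) (fun v => (v \in D)%:R * u v).
  apply: bdmM; last exact: (bdm_sub (measurableT) _ bu).
  split; last by exists 1 => v _; case: (_ \in _); rewrite ?normr1 ?normr0.
  apply: measurable_funTS; apply: (eq_measurable_fun (\1_D : plane R -> R)); last exact: measurable_indic.
  by move=> v _; rewrite indicE.
split=> //; rewrite integral_mkcond -(@integral_vanish _ _ _ leb2 (box N) _ (measurable_box N) (box_fin N) b); last first.
  by move=> v nN; rewrite memNset ?mul0r// => /DN.
by apply: eq_integral => v _; rewrite patchE; case: (v \in D); rewrite ?mul1r ?mul0r.
Qed.

(** Adding [F], whose integral vanishes, makes b - a nonnegative almost everywhere. *)
Lemma integral_le_of_balance (N : R) (D N0 : set (plane R)) (a b F : plane R -> R) :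
  measurable D -> D `<=` box N -> measurable N0 -> leb2 N0 = 0%E ->
  bdm setT a -> bdm setT b -> bdm (box N) F -> \int[leb2]_(v in box N) F v = 0 ->
  (forall v, ~ N0 v -> (v \in D)%:R * (a v - b v) <= F v) ->
  (\int[leb2]_(v in D) (a v)%:E <= \int[leb2]_(v in D) (b v)%:E)%E.
Proof.
move=> mD DN mN0 N00 ba bb bF F0 abF.
have [ba' ->] := integral_in_box mD DN ba; have [bb' ->] := integral_in_box mD DN bb.
rewrite lee_fin -subr_ge0 -[X in _ <= X]add0r -[X in _ <= X + _]F0.
have bG := bdmD bF (bdmB bb' ba').
rewrite -(IntB bb' ba') -(IntD bF (bdmB bb' ba')) -lee_fin.
rewrite -(@RintegralE_bdm _ _ _ leb2 (box N) (measurable_box N) (box_fin N) _ bG).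
rewrite (@negligible_integral _ _ _ leb2 (box N) N0 _ mN0 (measurable_box N) _ N00); last first.
  exact: (@bdm_integrable _ _ _ leb2 (box N) (measurable_box N) (box_fin N) _ bG).
apply: integral_ge0 => v [_ nv]; rewrite lee_fin.
by have := abF v nv; rewrite mulrBr; lra.
Qed.

End energy_comparison.

(** * The minimality inequality *)

Section minimizing.
Context {R : realType}.
Variables (f : plane R -> R) (W : set (heis R)) (gradf : plane R -> R) (tau : heis R -> R).
Hypotheses (f_lip : intrinsic_lipschitz f) (W_open : open W)
  (gradfP : intrinsic_gradient f gradf)
  (tau_borel : measurable_fun W tau)
  (tau_bounded : [locally [bounded tau p | p in W]])
  (tauE : spherical_hausdorff 3
       [set p | (W `&` graph f) p /\ tau p <> gradf (vproj p)] = 0%E)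
  (M_conservative : conservative W (fun p => (- tau p, 1 - tau p ^+ 2 / 2))).
Variables (B : set (heis R)) (h : plane R -> R).
Hypotheses (h_lip : intrinsic_lipschitz h) (BW : B `<=` W)
  (fhB : compactly_contained (epigraph f `+` epigraph h) B).

Let rfB : compactly_contained (region f h) B.
Proof. by apply: compactly_contained_sub fhB => //; have [] := region_epigraph f h. Qed.

Let rhB : compactly_contained (region h f) B.
Proof. by apply: compactly_contained_sub fhB => //; have [] := region_epigraph f h. Qed.

Let fH := intrinsic_lipschitz_half_holder f_lip.
Let hH := intrinsic_lipschitz_half_holder h_lip.

Let gap_box : exists N, gap f h `<=` box N /\ gap h f `<=` box N.
Proof.
have [N N0 EN] := compact_heis_bound fhB.1; exists (N + N * N / 2).
have vN u v : closure (epigraph f `+` epigraph h) (graph_point u v) -> box (N + N * N / 2) v.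
  move=> /EN[]; rewrite /hx /hy /hz/= => a b c; rewrite /box/= !in_itv/= -!ler_norml.
  have NN : 0 <= N * N / 2 by rewrite divr_ge0// mulr_ge0// ltW.
  have v1u : `|v.1 * u v / 2| <= N * N / 2.
    by rewrite !normrM (ger0_norm (_ : 0 <= 2^-1))// ler_wpM2r// ler_pM// ltW.
  split; first lra.
  have -> : v.2 = (v.2 + v.1 * u v / 2) - v.1 * u v / 2 by ring.
  by rewrite (le_trans (ler_normB _ _))//; lra.
have [s1 s2] := region_epigraph f h.
split=> v gv; apply: (vN f); have := gap_closure gv.
- by move=> [c1 _]; exact: (closure_subset s1).
- by move=> [_ c2]; exact: (closure_subset s2).
Qed.

(** The energy being an infimum over representatives, it suffices to bound the one of [f] by a
    single well-chosen representative, against an arbitrary [g] for [h]. *)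
Lemma energy_le_gradient g : intrinsic_gradient h g ->
  (energy (vproj @` (B `&` graph f)) f <=
   2^-1%:E * \int[leb2]_(v in vproj @` (B `&` graph h)) (g v ^+ 2)%:E)%E.
Proof.
move=> hg.
have [gf [Nf [Cf [mf bf wf [Cf0 mNf Nf0 fNf]]]]] := bounded_gradient gradfP.
have [gh [Nh [Ch [mh bh wh [Ch0 mNh Nh0 hNh]]]]] := bounded_gradient hg.
have fA : admissible f gf by split=> //; exists Cf.
have hA : admissible h gh by split=> //; exists Ch.
have cf := half_holder_continuous fH; have ch := half_holder_continuous hH.
have [Nt [mNt Nt0 St]] := null_projection tauE.
have [N [gN gN']] := gap_box.
pose D := gap f h `|` gap h f.
have mg1 : measurable (gap f h) := measurable_gap fA hA.
have mg2 : measurable (gap h f) := measurable_gap hA fA.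
have mD : measurable D by exact: measurableU.
have Deq v : ~ D v -> f v = h v.
  by move=> nD; apply/eqP; rewrite eq_le !leNgt; apply/andP; split; apply/negP => ?; apply: nD; [right|left].
have DB v : D v -> B (graph_point f v) /\ B (graph_point h v).
  move=> [gv|gv]; have [c1 c2] := gap_closure gv.
    by split; [exact: rfB.2|exact: rfB.2].
  by split; [exact: rhB.2|exact: rhB.2].
(* The graphs differ only over [D], and there both lie in [B]: the two energies are integrals over
   the same set. *)
have Aeq : vproj @` (B `&` graph h) = vproj @` (B `&` graph f).
  rewrite !graph_projection; apply/seteqP; split=> v /= Bv.
    by have [/DB[]//|/Deq e] := pselect (D v); rewrite /graph_point e.
  by have [/DB[]//|/Deq e] := pselect (D v); rewrite /graph_point -e.
pose gm v := if f v == h v then gh v else gf v.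
have mgm : measurable_fun setT gm.
  by apply: measurable_fun_ifT => //; apply: measurable_fun_eqr; exact: plane_continuous_measurable.
have bgm v : `|gm v| <= Cf + Ch.
  rewrite /gm; case: ifP => _; first by rewrite (le_trans (bh v))// lerDr.
  by rewrite (le_trans (bf v))// lerDl.
have gmP : intrinsic_gradient f gm.
  by split; [exact: bounded_Lfun mgm bgm|exact: merged_gradient fA hA].
apply: (@le_trans _ _ (2^-1%:E * \int[leb2]_(v in vproj @` (B `&` graph f)) (gm v ^+ 2)%:E)%E).
  by apply: ge_ereal_inf; exists (2^-1%:E * \int[leb2]_(v in vproj @` (B `&` graph f)) (gm v ^+ 2)%:E)%E => //; exists gm.
rewrite Aeq lee_wpmul2l// ?lee_fin//.
have gmf v : D v -> gm v = gf v.
  by move=> [gv|gv]; rewrite /gm; move: gv; rewrite /gap/= => gv; rewrite ?(lt_eqF gv)// (gt_eqF gv).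
have bsq (u : plane R -> R) C : measurable_fun setT u -> (forall v, `|u v| <= C) -> bdm setT (fun v => u v ^+ 2).
  by move=> mu uC; apply: bdmX; split=> //; exists C.
have N00 : leb2 (Nt `|` Nf) = 0%E by rewrite measureU0.
have mN0 : measurable (Nt `|` Nf) by exact: measurableU.
(* The almost everywhere hypothesis on [tau] concerns points of the graph; [Nt] carries its
   exceptional set to V_0, and [Nf] accounts for the change of representative. *)
have tf v : D v -> ~ (Nt `|` Nf) v -> tau (graph_point f v) = gf v.
  move=> Dv nN; rewrite -fNf; last by move=> ?; apply: nN; right.
  apply: contrapT => tg; apply: nN; left; apply: St; exists (graph_point f v); last exact: vproj_chart.
  split; last by rewrite vproj_chart.
  by split; [exact/BW/(DB v Dv).1|exists v => //; rewrite hmul_Ypow].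
have W1 := compactly_contained_sub (@subset_refl _ _) BW rfB.
have W2 := compactly_contained_sub (@subset_refl _ _) BW rhB.
have [bF1 F1] := flux_balance fA hA gN W_open tau_borel tau_bounded M_conservative W1.
have [bF2 F2] := flux_balance hA fA gN' W_open tau_borel tau_bounded M_conservative W2.
(* As tau = gf on the lower graph, twice the balance is gf^2 - gh^2 + (gh - tau)^2 with tau taken on
   the graph of [h]; hence the factor 2 and the square. *)
have le1 : (\int[leb2]_(v in gap f h) (gf v ^+ 2)%:E <= \int[leb2]_(v in gap f h) (gh v ^+ 2)%:E)%E.
  apply: (integral_le_of_balance mg1 gN mN0 N00 (bsq _ _ mf bf) (bsq _ _ mh bh)
    (bdmM (bdm_cst _ 2) bF1)); first by rewrite (IntZ 2 bF1) F1 mulr0.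
  move=> v nN; case: (boolP (v \in gap f h)) => [/set_mem gv|_]; last by rewrite !mul0r mulr0.
  rewrite (tf v (or_introl gv) nN) !mul1r; move: (tau _) (gf v) (gh v) => t x y.
  by have := sqr_ge0 (y - t); lra.
(* Here [h] is the lower graph, so the balance and its factor change sign. *)
have le2 : (\int[leb2]_(v in gap h f) (gf v ^+ 2)%:E <= \int[leb2]_(v in gap h f) (gh v ^+ 2)%:E)%E.
  apply: (integral_le_of_balance mg2 gN' mN0 N00 (bsq _ _ mf bf) (bsq _ _ mh bh)
    (bdmM (bdm_cst _ (- 2)) bF2)); first by rewrite (IntZ (- 2) bF2) F2 mulr0.
  move=> v nN; case: (boolP (v \in gap h f)) => [/set_mem gv|_]; last by rewrite !mul0r mulr0.
  rewrite (tf v (or_intror gv) nN) !mul1r; move: (tau _) (gf v) (gh v) => t x y.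
  by have := sqr_ge0 (y - t); lra.
have dj : [disjoint gap f h & gap h f]%classic.
  by apply/disj_setPS => v [/= fh hf]; have := lt_trans fh hf; rewrite ltxx.
have split_int (u : plane R -> R) : measurable_fun setT u ->
    (\int[leb2]_(v in D) (u v ^+ 2)%:E =
     \int[leb2]_(v in gap f h) (u v ^+ 2)%:E + \int[leb2]_(v in gap h f) (u v ^+ 2)%:E)%E.
  move=> mu; apply: ge0_integral_setU => //.
  - by apply/measurable_EFinP; apply: measurable_funTS; exact: measurable_funX.
  - by move=> v _; rewrite lee_fin sqr_ge0.
apply: (@ge0_integral_le_replace _ _ _ leb2 _ D Nh (fun v => gm v ^+ 2) (fun v => g v ^+ 2)
  (fun v => gh v ^+ 2)) => //.
- by rewrite graph_projection => v /DB[].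
- exact: measurable_funX.
- exact: measurable_funX.
- by move=> v; exact: sqr_ge0.
- by move=> v; exact: sqr_ge0.
- by move=> v; exact: sqr_ge0.
- by move=> v nN; rewrite hNh.
- by move=> v /Deq e; rewrite /gm e eqxx.
- rewrite (@eq_integral _ _ _ leb2 _ (fun v => (gf v ^+ 2)%:E)); last by move=> v /set_mem /gmf ->.
  by rewrite !split_int//; exact: leeD.
Qed.

End minimizing.

Theorem proposition3p6 (R : realType) (f : plane R -> R) (W : set (heis R))
    (gradf : plane R -> R) (tau : heis R -> R)
    (f_lip : intrinsic_lipschitz f)
    (W_open : open W)
    (gradfP : intrinsic_gradient f gradf)
    (tau_borel : measurable_fun W tau)
    (tau_bounded : [locally [bounded tau p | p in W]])
    (tauE : spherical_hausdorff 3
       [set p | (W `&` graph f) p /\ tau p <> gradf (vproj p)] = 0%E)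
    (M_conservative :
       conservative W (fun p => (- tau p, 1 - tau p ^+ 2 / 2))) :
  energy_minimizing f W.
Proof.
move=> p r h r0 h_lip fhB; apply: le_ereal_inf_tmp => _ [g hg <-].
apply: (energy_le_gradient f_lip W_open gradfP tau_borel tau_bounded tauE M_conservative h_lip _ fhB hg).
by move=> q [].
Qed.
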